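(* There is a deterministic algorithm which, given a set $P$ of $n$ points in the plane $\mathbb{R}^2$, enumerates (reports, each exactly once) all axis-parallel squares defined by points of $P$, i.e. all 4-element subsets $\{(x,y),(x+\delta,y),(x,y+\delta),(x+\delta,y+\delta)\}\subseteq P$ with $\delta>0$, in time $O(n\sqrt{n})$ and using $O(n)$ space.
   Context: Model of computation: the standard word-RAM model; each input coordinate fits in $O(1)$ machine words, and arithmetic operations (addition, subtraction) and comparisons on coordinates take constant time. Time and space bounds are worst-case over all inputs of size $n$ and include the time to report all output squares. *)

(* Defs.v *)
(* A deterministic unit-cost word-RAM-style machine model,
   used to state the existence of an algorithm with time/space bounds. *)
From Stdlib Require Import ZArith List Lia.
Import ListNotations.

(* Instructions.  Registers are indexed by nat (a program only ever touches
   the finitely many registers it names); memory is indexed by Z. *)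
Inductive instr : Type :=
| IConst (d : nat) (c : Z)
| IAdd   (d a b : nat)
| ISub   (d a b : nat)
| ILoad  (d a : nat)
| IStore (a s : nat)
| IJlt   (a b : nat) (target : nat)
| IOut   (a b c : nat)
| IHalt.

Definition program := list instr.

Record config : Type := Config {
  pc  : nat;
  reg : nat -> Z;
  mem : Z -> Z;
  out : list (Z * Z * Z)
}.

Definition updn (f : nat -> Z) (i : nat) (v : Z) : nat -> Z :=
  fun j => if Nat.eqb j i then v else f j.
Definition updz (f : Z -> Z) (i : Z) (v : Z) : Z -> Z :=
  fun j => if Z.eqb j i then v else f j.

Definition step (p : program) (c : config) : option config :=
  match nth_error p (pc c) with
  | None => None
  | Some IHalt => None
  | Some (IConst d k) => Some (Config (S (pc c)) (updn (reg c) d k) (mem c) (out c))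
  | Some (IAdd d a b) =>
      Some (Config (S (pc c)) (updn (reg c) d (reg c a + reg c b)%Z) (mem c) (out c))
  | Some (ISub d a b) =>
      Some (Config (S (pc c)) (updn (reg c) d (reg c a - reg c b)%Z) (mem c) (out c))
  | Some (ILoad d a) =>
      Some (Config (S (pc c)) (updn (reg c) d (mem c (reg c a))) (mem c) (out c))
  | Some (IStore a s) =>
      Some (Config (S (pc c)) (reg c) (updz (mem c) (reg c a) (reg c s)) (out c))
  | Some (IJlt a b t) =>
      Some (Config (if Z.ltb (reg c a) (reg c b) then t else S (pc c))
                   (reg c) (mem c) (out c))
  | Some (IOut a b d) =>
      Some (Config (S (pc c)) (reg c) (mem c) (out c ++ [(reg c a, reg c b, reg c d)]))
  end.

Fixpoint iter_step (p : program) (k : nat) (c : config) : option config :=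
  match k with
  | O => Some c
  | S k' => match step p c with
            | Some c' => iter_step p k' c'
            | None => None
            end
  end.

Definition addr_of (p : program) (c : config) : option Z :=
  match nth_error p (pc c) with
  | Some (ILoad _ a) => Some (reg c a)
  | Some (IStore a _) => Some (reg c a)
  | _ => None
  end.

(* Input encoding: mem[0] = n, mem[2i+1] = x_i, mem[2i+2] = y_i, rest 0. *)
Definition input_mem (P : list (Z * Z)) : Z -> Z :=
  fun a =>
    if Z.eqb a 0 then Z.of_nat (length P)
    else if Z.ltb a 1 then 0%Z
    else let i := Z.to_nat (a - 1) in
         match nth_error P (Nat.div i 2) with
         | Some (x, y) => if Nat.even i then x else y
         | None => 0%Z
         end.

Definition init (P : list (Z * Z)) : config :=
  Config 0 (fun _ => 0%Z) (input_mem P) [].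

Definition maxcoord (P : list (Z * Z)) : Z :=
  fold_right (fun xy m => Z.max m (Z.max (Z.abs (fst xy)) (Z.abs (snd xy)))) 0%Z P.

(* (x, y, d) encodes the axis-parallel square with lower-left corner (x,y)
   and side d; it is defined by P iff d > 0 and all four corners lie in P. *)
Definition is_square (P : list (Z * Z)) (s : Z * Z * Z) : Prop :=
  let '(x, y, d) := s in
  (0 < d)%Z /\ In (x, y) P /\ In (x + d, y)%Z P /\ In (x, y + d)%Z P
  /\ In (x + d, y + d)%Z P.

(* Main.v *)
(** Call a row heavy if it contains more than [s = isqrt n] points; there are at most [s]
    heavy rows.  For each heavy row, mark the columns that meet it and scan all points, row
    by row: the squares having one horizontal side on the heavy row are the pairs of marked
    points of another row whose distance is the distance [d] of the two rows, and a pair of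
    pointers finds them in time O(n).

    The other squares have two light horizontal sides.  Each point has at most [s] points to
    its left in a light row, so there are at most [n * s] pairs of points on light rows.
    The pairs are enumerated by increasing right point in the order [(x, y)], so that
    those joining two fixed columns come by increasing height.  The sides of a square with
    these vertical sides are two such pairs at vertical distance [d], where [d] is the
    distance of the columns, so that a pointer into the linked list of the pairs seen so far
    finds the lower side when the upper one is met.  Each list is indexed by its left column
    alone, and restarted when the right column changes.

    Both passes need the points sorted by [(y, x)] and by [(x, y)].  Splitting them into about [s]
    blocks and maintaining the minimum of each block sorts them in time O(n * s). *)

Require Import Defs.
From Stdlib Require Import ZArith List Lia FinFun.
Import ListNotations.
Local Open Scope Z_scope.

(** The machine only adds, subtracts and compares, and coordinates are integers of any size, so they
    cannot serve as addresses: columns and rows are named by positions obtained from sorting, and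
    products and quotients are replaced by running sums and tables.

    Linear space is the obstacle of the second pass, since there may be quadratically many pairs of
    columns and more than linearly many pairs of points. The cells of a list are therefore named by
    left points: in its row a left point meets a fixed right column at most once, and it belongs to
    one left column, so a single link per point suffices for the current right column. Along a list
    the distance d is fixed, so the ordinate y - d that is looked for only grows, the pointer never
    moves back, and its moves are charged to pairs.

    The algorithm is written in a small while language over 17 arrays of common length 2n + 2. A
    compiler, verified once, transfers output, exact step counts, register bounds and address bounds
    to the machine, so that all reasoning about squares concerns structured programs. *)

(** * A while language with a cost semantics *)

Inductive expr : Type :=
| EConst (c : Z)
| EVar (x : nat)
| EAdd (e1 e2 : expr)
| ESub (e1 e2 : expr)
| ELoad (a : nat) (e : expr).

Inductive stmt : Type :=
| Skip
| Assign (x : nat) (e : expr)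
| Store (a : nat) (e1 e2 : expr)
| Out (e1 e2 e3 : expr)
| Seq (s1 s2 : stmt)
| If (e1 e2 : expr) (s1 s2 : stmt)
| While (e1 e2 : expr) (s : stmt).

Record state : Type := State {
  var : nat -> Z;
  arr : nat -> Z -> Z;
  outp : list (Z * Z * Z);
  time : Z
}.

Definition upd2 (f : nat -> Z -> Z) (a : nat) (i v : Z) : nat -> Z -> Z :=
  fun b => if Nat.eqb b a then updz (f a) i v else f b.

Definition setv (st : state) (x : nat) (v : Z) : state :=
  State (updn (var st) x v) (arr st) (outp st) (time st).
Definition seta (st : state) (a : nat) (i v : Z) : state :=
  State (var st) (upd2 (arr st) a i v) (outp st) (time st).
Definition emit (st : state) (s : Z * Z * Z) : state :=
  State (var st) (arr st) (outp st ++ [s]) (time st).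
Definition tick (k : Z) (st : state) : state :=
  State (var st) (arr st) (outp st) (time st + k).

Fixpoint eval (e : expr) (st : state) : Z :=
  match e with
  | EConst c => c
  | EVar x => var st x
  | EAdd e1 e2 => eval e1 st + eval e2 st
  | ESub e1 e2 => eval e1 st - eval e2 st
  | ELoad a e => arr st a (eval e st)
  end.

(** Expressions compile to straight-line code, and the cost is the length of that code: [ELoad] adds
    one addition of the array base and one load. *)
Fixpoint ecost (e : expr) : Z :=
  match e with
  | EConst _ | EVar _ => 1
  | EAdd e1 e2 | ESub e1 e2 => ecost e1 + ecost e2 + 1
  | ELoad _ e => ecost e + 2
  end.

(** All arrays share one machine memory, so an index outside [[0, L)] could hit another array; every
    load inside the expression is checked. *)
Fixpoint eidx (L : Z) (e : expr) (st : state) : Prop :=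
  match e with
  | EConst _ | EVar _ => True
  | EAdd e1 e2 | ESub e1 e2 => eidx L e1 st /\ eidx L e2 st
  | ELoad a e => eidx L e st /\ 0 <= eval e st < L
  end.

(** [L] is the length of every array and [V] bounds the absolute values of
    variables and array cells; [time] counts the machine steps of the compiled code. *)
Inductive exec (L V : Z) : stmt -> state -> state -> Prop :=
| exec_skip st : exec L V Skip st st
| exec_assign x e st :
    eidx L e st -> Z.abs (eval e st) <= V ->
    exec L V (Assign x e) st (tick (ecost e + 1) (setv st x (eval e st)))
| exec_store a e1 e2 st :
    eidx L e1 st -> eidx L e2 st -> 0 <= eval e1 st < L -> Z.abs (eval e2 st) <= V ->
    exec L V (Store a e1 e2) st
      (tick (ecost e1 + ecost e2 + 2) (seta st a (eval e1 st) (eval e2 st)))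
| exec_out e1 e2 e3 st :
    eidx L e1 st -> eidx L e2 st -> eidx L e3 st ->
    exec L V (Out e1 e2 e3) st
      (tick (ecost e1 + ecost e2 + ecost e3 + 1)
         (emit st (eval e1 st, eval e2 st, eval e3 st)))
| exec_seq s1 s2 st st1 st2 :
    exec L V s1 st st1 -> exec L V s2 st1 st2 -> exec L V (Seq s1 s2) st st2
| exec_if_then e1 e2 s1 s2 st st1 :
    eidx L e1 st -> eidx L e2 st -> eval e1 st < eval e2 st ->
    exec L V s1 (tick (ecost e1 + ecost e2 + 1) st) st1 ->
    exec L V (If e1 e2 s1 s2) st st1
| exec_if_else e1 e2 s1 s2 st st1 :
    eidx L e1 st -> eidx L e2 st -> eval e2 st <= eval e1 st ->
    exec L V s2 (tick (ecost e1 + ecost e2 + 1) st) st1 ->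
    exec L V (If e1 e2 s1 s2) st (tick 2 st1)
| exec_while_stop e1 e2 s st :
    eidx L e1 st -> eidx L e2 st -> eval e2 st <= eval e1 st ->
    exec L V (While e1 e2 s) st (tick (ecost e1 + ecost e2 + 3) st)
| exec_while_loop e1 e2 s st st1 st2 :
    eidx L e1 st -> eidx L e2 st -> eval e1 st < eval e2 st ->
    exec L V s (tick (ecost e1 + ecost e2 + 1) st) st1 ->
    exec L V (While e1 e2 s) (tick 2 st1) st2 ->
    exec L V (While e1 e2 s) st st2.

Definition bounded (V : Z) (st : state) : Prop :=
  (forall x, Z.abs (var st x) <= V) /\ (forall a i, Z.abs (arr st a i) <= V).

Lemma bounded_setv V st x v k :
  bounded V st -> Z.abs v <= V -> bounded V (tick k (setv st x v)).
Proof.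
  intros [H1 H2] Hv; split; simpl; auto.
  intros y; unfold updn; destruct (Nat.eqb y x); auto.
Qed.

Lemma bounded_seta V st a i v k :
  bounded V st -> Z.abs v <= V -> bounded V (tick k (seta st a i v)).
Proof.
  intros [H1 H2] Hv; split; simpl; auto.
  intros b j; unfold upd2; destruct (Nat.eqb b a); auto.
  unfold updz; destruct (Z.eqb j i); auto.
Qed.

(** * Compilation to the machine *)

(** Register 0 is kept at zero. The residues mod 3 separate variables, array bases and temporaries
    without fixing how many there are of each. *)
Definition rz : nat := 0.
Definition rv (x : nat) : nat := (3 * x + 1)%nat.
Definition ra (a : nat) : nat := (3 * a + 2)%nat.
Definition rt (d : nat) : nat := (3 * d + 3)%nat.

Arguments rz : simpl never.
Arguments rv : simpl never.
Arguments ra : simpl never.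
Arguments rt : simpl never.

Definition narr : nat := 17.
(** Leaves are bounded by [V], so an expression with at most 16 of them, and each of its
    subexpressions, has a value bounded by [16 * V]. *)
Definition max_size : Z := 16.

Fixpoint esize (e : expr) : Z :=
  match e with
  | EConst _ | EVar _ => 1
  | EAdd e1 e2 | ESub e1 e2 => esize e1 + esize e2
  | ELoad _ e => esize e
  end.

Fixpoint ewf (e : expr) : bool :=
  match e with
  | EConst c => Z.abs c <=? 8
  | EVar _ => true
  | EAdd e1 e2 | ESub e1 e2 =>
      ewf e1 && ewf e2 && (esize e1 + esize e2 <=? max_size)
  | ELoad a e => ewf e && Nat.ltb a narr
  end.

Fixpoint swf (s : stmt) : bool :=
  match s with
  | Skip => true
  | Assign _ e => ewf e
  | Store a e1 e2 => Nat.ltb a narr && ewf e1 && ewf e2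
  | Out e1 e2 e3 => ewf e1 && ewf e2 && ewf e3
  | Seq s1 s2 => swf s1 && swf s2
  | If e1 e2 s1 s2 => ewf e1 && ewf e2 && swf s1 && swf s2
  | While e1 e2 s => ewf e1 && ewf e2 && swf s
  end.

(** Stack discipline: the value ends in temporary [d], the temporaries above [d] are scratch and
    those below are preserved. *)
Fixpoint ecode (e : expr) (d : nat) : list instr :=
  match e with
  | EConst c => [IConst (rt d) c]
  | EVar x => [IAdd (rt d) (rv x) rz]
  | EAdd e1 e2 => ecode e1 d ++ ecode e2 (S d) ++ [IAdd (rt d) (rt d) (rt (S d))]
  | ESub e1 e2 => ecode e1 d ++ ecode e2 (S d) ++ [ISub (rt d) (rt d) (rt (S d))]
  | ELoad a e => ecode e d ++ [IAdd (rt d) (rt d) (ra a); ILoad (rt d) (rt d)]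
  end.

(** An unconditional jump is the test [0 < 1]; this is where the two steps charged for jumps in
    [exec] come from. *)
Definition goto (l : nat) : list instr := [IConst (rt 1) 1; IJlt rz (rt 1) l].

(** Jump targets are absolute and may point forward, so lengths are needed before the code exists;
    they do not depend on its position. *)
Fixpoint slen (s : stmt) : nat :=
  match s with
  | Skip => 0
  | Assign _ e => length (ecode e 0) + 1
  | Store _ e1 e2 => length (ecode e1 0) + 1 + length (ecode e2 1) + 1
  | Out e1 e2 e3 => length (ecode e1 0) + length (ecode e2 1) + length (ecode e3 2) + 1
  | Seq s1 s2 => slen s1 + slen s2
  | If e1 e2 s1 s2 => length (ecode e1 0) + length (ecode e2 1) + 1 + slen s2 + 2 + slen s1
  | While e1 e2 s => length (ecode e1 0) + length (ecode e2 1) + 1 + 2 + slen s + 2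
  end%nat.

(** The conditional jump is taken on a strict inequality. Hence the [else] branch is laid out first
    and ends with a jump over the other branch, and a loop test jumps over the exit jump into the
    body. *)
Fixpoint code (s : stmt) (l : nat) : list instr :=
  match s with
  | Skip => []
  | Assign x e => ecode e 0 ++ [IAdd (rv x) (rt 0) rz]
  | Store a e1 e2 =>
      ecode e1 0 ++ [IAdd (rt 0) (rt 0) (ra a)] ++ ecode e2 1 ++ [IStore (rt 0) (rt 1)]
  | Out e1 e2 e3 => ecode e1 0 ++ ecode e2 1 ++ ecode e3 2 ++ [IOut (rt 0) (rt 1) (rt 2)]
  | Seq s1 s2 => code s1 l ++ code s2 (l + slen s1)
  | If e1 e2 s1 s2 =>
      let l1 := (l + length (ecode e1 0) + length (ecode e2 1) + 1)%nat in
      let l2 := (l1 + slen s2 + 2)%nat in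
      ecode e1 0 ++ ecode e2 1 ++ [IJlt (rt 0) (rt 1) l2]
        ++ code s2 l1 ++ goto (l2 + slen s1) ++ code s1 l2
  | While e1 e2 s =>
      let l1 := (l + length (ecode e1 0) + length (ecode e2 1) + 1)%nat in
      ecode e1 0 ++ ecode e2 1 ++ [IJlt (rt 0) (rt 1) (l1 + 2)]
        ++ goto (l1 + 2 + slen s + 2) ++ code s (l1 + 2) ++ goto l
  end%nat.

Lemma length_code s : forall l, length (code s l) = slen s.
Proof.
  induction s; intros l; cbn; rewrite ?length_app; cbn;
    rewrite ?length_app; cbn; rewrite ?length_app; cbn;
    rewrite ?length_app, ?IHs, ?IHs1, ?IHs2; cbn; lia.
Qed.

Lemma length_ecode e : forall d, Z.of_nat (length (ecode e d)) = ecost e.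
Proof.
  induction e; intros d; cbn; rewrite ?length_app; cbn; rewrite ?length_app; cbn;
    try reflexivity; try (specialize (IHe1 d); specialize (IHe2 (S d)); lia).
  specialize (IHe d); lia.
Qed.

Definition code_at (p : program) (l : nat) (q : list instr) : Prop :=
  exists p1 p2, p = p1 ++ q ++ p2 /\ length p1 = l.

Lemma code_at_app p l q1 q2 :
  code_at p l (q1 ++ q2) -> code_at p l q1 /\ code_at p (l + length q1) q2.
Proof.
  intros (p1 & p2 & -> & <-); split.
  - exists p1, (q2 ++ p2); rewrite <- app_assoc; auto.
  - exists (p1 ++ q1), p2; rewrite length_app, <- !app_assoc; auto.
Qed.

Lemma code_at_cons p l i q :
  code_at p l (i :: q) -> nth_error p l = Some i /\ code_at p (S l) q.
Proof.
  intros (p1 & p2 & -> & <-); split.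
  - rewrite nth_error_app2, Nat.sub_diag by lia; reflexivity.
  - exists (p1 ++ [i]), p2; rewrite length_app, <- app_assoc; cbn; split; auto; lia.
Qed.

Definition conf_ok (p : program) (W A : Z) (c : config) : Prop :=
  (forall r, Z.abs (reg c r) <= W) /\
  (forall a, addr_of p c = Some a -> 0 <= a < A).

(** The bounds are required of every configuration that is left but not of the last one, so that
    runs compose; [runs_ok] adds the last one. *)
Inductive runs (p : program) (W A : Z) : nat -> config -> config -> Prop :=
| runs_refl c : runs p W A 0 c c
| runs_step k c c1 c2 :
    conf_ok p W A c -> step p c = Some c1 -> runs p W A k c1 c2 ->
    runs p W A (S k) c c2.

Lemma runs_trans p W A k1 k2 c1 c2 c3 :
  runs p W A k1 c1 c2 -> runs p W A k2 c2 c3 -> runs p W A (k1 + k2) c1 c3.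
Proof. induction 1; intros; cbn; auto; econstructor; eauto. Qed.

Lemma runs_one p W A c c1 :
  conf_ok p W A c -> step p c = Some c1 -> runs p W A 1 c c1.
Proof. intros; econstructor; eauto; constructor. Qed.

Lemma runs_iter p W A k c1 c2 : runs p W A k c1 c2 -> iter_step p k c1 = Some c2.
Proof. induction 1; cbn; auto; rewrite H0; auto. Qed.

Lemma runs_ok p W A k c1 c2 :
  runs p W A k c1 c2 -> conf_ok p W A c2 ->
  forall j c, (j <= k)%nat -> iter_step p j c1 = Some c -> conf_ok p W A c.
Proof.
  induction 1 as [c0 | k c0 c1' c2' Hok Hst Hr IH]; intros H2 j c Hj Hi.
  - assert (j = O) by lia; subst; cbn in Hi; congruence.
  - destruct j; cbn in Hi; [congruence|].
    rewrite Hst in Hi; apply (IH H2 j c); auto; lia.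
Qed.

Section Compile.
Variables (p : program) (L V W A : Z).
Hypothesis HL : 0 <= L.
Hypothesis HV : 8 <= V.
Hypothesis HW : max_size * V + Z.of_nat narr * L <= W.
Hypothesis HA : Z.of_nat narr * L <= A.

(** The simulation invariant: array [a] occupies the [L] cells from [a * L] on. Registers are
    bounded by [W] rather than [V], since temporaries hold values of expressions and addresses. *)
Definition rel (st : state) (c : config) : Prop :=
  bounded V st /\
  reg c rz = 0 /\
  (forall a, (a < narr)%nat -> reg c (ra a) = Z.of_nat a * L) /\
  (forall x, reg c (rv x) = var st x) /\
  (forall a i, (a < narr)%nat -> 0 <= i < L -> mem c (Z.of_nat a * L + i) = arr st a i) /\
  out c = outp st /\
  (forall r, Z.abs (reg c r) <= W).

Lemma eval_bound e st :
  bounded V st -> ewf e = true -> Z.abs (eval e st) <= esize e * V /\ 1 <= esize e <= max_size.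
Proof.
  intros [H1 H2]; unfold max_size; induction e; cbn [eval esize ewf]; intros Hw.
  - apply Z.leb_le in Hw; lia.
  - specialize (H1 x); lia.
  - apply andb_prop in Hw as [Hw Hw3]; apply andb_prop in Hw as [Hw1 Hw2].
    apply Z.leb_le in Hw3; unfold max_size in Hw3.
    destruct (IHe1 Hw1), (IHe2 Hw2); lia.
  - apply andb_prop in Hw as [Hw Hw3]; apply andb_prop in Hw as [Hw1 Hw2].
    apply Z.leb_le in Hw3; unfold max_size in Hw3.
    destruct (IHe1 Hw1), (IHe2 Hw2); lia.
  - apply andb_prop in Hw as [Hw1 Hw2]; specialize (IHe Hw1).
    specialize (H2 a (eval e st)); assert (1 * V <= esize e * V) by nia; lia.
Qed.

Lemma eval_boundW e st :
  bounded V st -> ewf e = true -> Z.abs (eval e st) <= W.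
Proof.
  intros H1 H2; destruct (eval_bound e st H1 H2).
  assert (esize e * V <= max_size * V) by (apply Z.mul_le_mono_nonneg_r; lia). lia.
Qed.

Lemma rel_temp st c l d v :
  rel st c -> Z.abs v <= W -> rel st (Config l (updn (reg c) (rt d) v) (mem c) (out c)).
Proof.
  intros (H1 & H2 & H3 & H4 & H5 & H6 & H7) Hv.
  unfold rel, updn, rt, rv, ra, rz in *; cbn -[Nat.mul].
  split; [exact H1|]; repeat split; auto.
  - replace (3 * d + 3)%nat with (S (3 * d + 2)) by lia; exact H2.
  - intros a Ha; destruct (Nat.eqb_spec (3 * a + 2) (3 * d + 3)); [lia|]; auto.
  - intros x; destruct (Nat.eqb_spec (3 * x + 1) (3 * d + 3)); [lia|]; auto.
  - intros r; destruct (Nat.eqb r (3 * d + 3)); auto.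
Qed.

Lemma rel_pc st c l : rel st c -> rel st (Config l (reg c) (mem c) (out c)).
Proof. intros H; exact H. Qed.

Lemma rel_tick st c k : rel st c -> rel (tick k st) c.
Proof. intros H; exact H. Qed.

Lemma rel_ok st c i :
  rel st c -> nth_error p (pc c) = Some i ->
  match i with ILoad _ a | IStore a _ => 0 <= reg c a < A | _ => True end ->
  conf_ok p W A c.
Proof.
  intros H Hi Ha; split; [apply H|].
  intros a; unfold addr_of; rewrite Hi; destruct i; try discriminate; congruence.
Qed.

Ltac one_step c0 :=
  eapply (runs_one p W A c0);
  [ eapply rel_ok; [eassumption | eassumption | cbn; trivial]
  | unfold step; match goal with H : nth_error p _ = Some _ |- _ => rewrite H end; reflexivity ].

Lemma addr_bound a i :
  (a < narr)%nat -> 0 <= i < L -> 0 <= Z.of_nat a * L + i < Z.of_nat narr * L.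
Proof. intros Ha Hi; unfold narr in *; nia. Qed.

Lemma updn_same f i v : updn f i v i = v.
Proof. unfold updn; rewrite Nat.eqb_refl; reflexivity. Qed.

Lemma updn_other f i j v : j <> i -> updn f i v j = f j.
Proof. intros H; unfold updn; destruct (Nat.eqb_spec j i); congruence. Qed.

Lemma rt_inj d d' : d <> d' -> rt d <> rt d'.
Proof. unfold rt; lia. Qed.

(** Preservation of the lower temporaries lets a binary operation find its left operand after the
    right one has been computed. *)
Lemma ecode_correct e : forall d st c,
  ewf e = true -> eidx L e st -> rel st c -> code_at p (pc c) (ecode e d) ->
  exists c', runs p W A (length (ecode e d)) c c' /\
    pc c' = (pc c + length (ecode e d))%nat /\ rel st c' /\
    reg c' (rt d) = eval e st /\
    (forall d', (d' < d)%nat -> reg c' (rt d') = reg c (rt d')).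
Proof.
  (* Addition and subtraction share this argument, with [op] the final instruction and [v] the value
     it produces. *)
  assert (bin : forall e1 e2 d st c (op : instr) v,
    (forall st c, ewf e1 = true -> eidx L e1 st -> rel st c -> code_at p (pc c) (ecode e1 d) ->
      exists c', runs p W A (length (ecode e1 d)) c c' /\
       pc c' = (pc c + length (ecode e1 d))%nat /\ rel st c' /\
       reg c' (rt d) = eval e1 st /\
      (forall d', (d' < d)%nat -> reg c' (rt d') = reg c (rt d'))) ->
    (forall st c, ewf e2 = true -> eidx L e2 st -> rel st c ->
      code_at p (pc c) (ecode e2 (S d)) ->
      exists c', runs p W A (length (ecode e2 (S d))) c c' /\
       pc c' = (pc c + length (ecode e2 (S d)))%nat /\ rel st c' /\
       reg c' (rt (S d)) = eval e2 st /\
      (forall d', (d' < S d)%nat -> reg c' (rt d') = reg c (rt d'))) ->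
    ewf e1 = true -> ewf e2 = true -> eidx L e1 st -> eidx L e2 st -> rel st c ->
    Z.abs v <= W ->
    (forall c, nth_error p (pc c) = Some op ->
       reg c (rt d) = eval e1 st -> reg c (rt (S d)) = eval e2 st ->
       step p c = Some (Config (S (pc c)) (updn (reg c) (rt d) v) (mem c) (out c))) ->
    match op with ILoad _ a | IStore a _ => False | _ => True end ->
    code_at p (pc c) (ecode e1 d ++ ecode e2 (S d) ++ [op]) ->
    exists c', runs p W A (length (ecode e1 d ++ ecode e2 (S d) ++ [op])) c c' /\
     pc c' = (pc c + length (ecode e1 d ++ ecode e2 (S d) ++ [op]))%nat /\ rel st c' /\
     reg c' (rt d) = v /\
     (forall d', (d' < d)%nat -> reg c' (rt d') = reg c (rt d'))).
  { intros e1 e2 d st c op v IH1 IH2 Hw1 Hw2 Hi1 Hi2 Hr Hv Hop Hno Hc.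
    apply code_at_app in Hc as [Hc1 Hc]; apply code_at_app in Hc as [Hc2 Hc].
    apply code_at_cons in Hc as [Hc3 _].
    destruct (IH1 st c Hw1 Hi1 Hr Hc1) as (c1 & R1 & P1 & Hr1 & E1 & F1).
    rewrite <- P1 in Hc2, Hc3.
    destruct (IH2 st c1 Hw2 Hi2 Hr1 Hc2) as (c2 & R2 & P2 & Hr2 & E2 & F2).
    rewrite <- P2 in Hc3.
    eexists; split; [|split; [|split; [|split]]].
    - rewrite !length_app; eapply runs_trans; [exact R1|].
      eapply runs_trans; [exact R2|].
      eapply (runs_one p W A c2);
        [eapply rel_ok; [exact Hr2 | exact Hc3 | destruct op; tauto]|].
      apply Hop; [exact Hc3 | rewrite F2 by lia; exact E1 | exact E2].
    - cbn; rewrite P2, P1, !length_app; cbn; lia.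
    - apply rel_temp; auto.
    - cbn; apply updn_same.
    - intros d' Hd; cbn; rewrite updn_other by (apply rt_inj; lia).
      rewrite F2, F1 by lia; reflexivity. }
  induction e as [z | x | e1 IHe1 e2 IHe2 | e1 IHe1 e2 IHe2 | a e IHe];
    intros d st c Hw Hi Hr Hc; pose proof (eval_boundW _ st (proj1 Hr) Hw) as Hb.
  - apply code_at_cons in Hc as [Hc _]; eexists; split; [|split; [|split; [|split]]].
    + one_step c.
    + cbn; lia.
    + apply rel_temp; auto.
    + apply updn_same.
    + intros d' Hd; cbn; apply updn_other, rt_inj; lia.
  - apply code_at_cons in Hc as [Hc _]; eexists.
    assert (E : reg c (rv x) + reg c rz = var st x).
    { destruct Hr as (_ & -> & _ & -> & _); lia. }
    split; [|split; [|split; [|split]]].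
    + one_step c.
    + cbn; lia.
    + apply rel_temp; auto; rewrite E; exact Hb.
    + cbn; rewrite updn_same; exact E.
    + intros d' Hd; cbn; apply updn_other, rt_inj; lia.
  - cbn in Hw, Hi; apply andb_prop in Hw as [Hw Hw3]; apply andb_prop in Hw as [Hw1 Hw2].
    cbn [ecode] in *; eapply (bin e1 e2); eauto; try tauto.
    intros c0 Hn E1 E2; unfold step; rewrite Hn, E1, E2; reflexivity.
  - cbn in Hw, Hi; apply andb_prop in Hw as [Hw Hw3]; apply andb_prop in Hw as [Hw1 Hw2].
    cbn [ecode] in *; eapply (bin e1 e2); eauto; try tauto.
    intros c0 Hn E1 E2; unfold step; rewrite Hn, E1, E2; reflexivity.
  - cbn [ecode eidx eval ewf] in *; apply andb_prop in Hw as [Hw1 Hw2].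
    apply Nat.ltb_lt in Hw2; destruct Hi as [Hi1 Hi2].
    apply code_at_app in Hc as [Hc1 Hc]; apply code_at_cons in Hc as [Hc2 Hc].
    apply code_at_cons in Hc as [Hc3 _].
    destruct (IHe d st c Hw1 Hi1 Hr Hc1) as (c1 & R1 & P1 & Hr1 & E1 & F1).
    rewrite <- P1 in Hc2, Hc3.
    pose proof (addr_bound a (eval e st) Hw2 Hi2) as Ha.
    assert (E : reg c1 (rt d) + reg c1 (ra a) = Z.of_nat a * L + eval e st).
    { destruct Hr1 as (_ & _ & Hra & _); rewrite Hra, E1 by auto; lia. }
    set (c2 := Config (S (pc c1)) (updn (reg c1) (rt d) (Z.of_nat a * L + eval e st))
                 (mem c1) (out c1)).
    assert (Hr2 : rel st c2).
    { apply rel_temp; auto; unfold max_size in *; lia. }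
    assert (E2 : mem c2 (reg c2 (rt d)) = arr st a (eval e st)).
    { unfold c2; cbn; rewrite updn_same; apply Hr1; auto. }
    exists (Config (S (pc c2)) (updn (reg c2) (rt d) (arr st a (eval e st)))
                 (mem c2) (out c2)); split; [|split; [|split; [|split]]].
    + rewrite length_app; eapply runs_trans; [exact R1|].
      eapply (runs_step p W A 1 c1 c2).
      * eapply rel_ok; [exact Hr1 | exact Hc2 | exact I].
      * unfold step; rewrite Hc2, E; reflexivity.
      * eapply (runs_one p W A c2).
        -- eapply rel_ok; [exact Hr2 | exact Hc3 |].
           unfold c2; cbn; rewrite updn_same; lia.
        -- unfold step; change (pc c2) with (S (pc c1)); rewrite Hc3, E2; reflexivity.
    + cbn; rewrite P1, !length_app; cbn; lia.
    + apply rel_temp; auto.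
    + cbn; apply updn_same.
    + intros d' Hd; cbn; rewrite !updn_other by (apply rt_inj; lia); apply F1; auto.
Qed.

Lemma goto_correct l st c :
  rel st c -> code_at p (pc c) (goto l) ->
  exists c', runs p W A 2 c c' /\ pc c' = l /\ rel st c'.
Proof.
  intros Hr Hc; apply code_at_cons in Hc as [Hc1 Hc]; apply code_at_cons in Hc as [Hc2 _].
  set (c1 := Config (S (pc c)) (updn (reg c) (rt 1) 1) (mem c) (out c)).
  assert (Hr1 : rel st c1).
  { apply rel_temp; auto; unfold max_size, narr in *; lia. }
  exists (Config l (reg c1) (mem c1) (out c1)); repeat split; try apply Hr1.
  eapply (runs_step p W A 1 c c1).
  - eapply rel_ok; [exact Hr | exact Hc1 | exact I].
  - unfold step; rewrite Hc1; reflexivity.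
  - eapply (runs_one p W A c1).
    + eapply rel_ok; [exact Hr1 | exact Hc2 | exact I].
    + unfold step; change (pc c1) with (S (pc c)); rewrite Hc2.
      destruct Hr as (_ & Hz & _); change (reg c1 rz) with (reg c rz); rewrite Hz; reflexivity.
Qed.

Lemma test_correct e1 e2 l st c :
  ewf e1 = true -> ewf e2 = true -> eidx L e1 st -> eidx L e2 st -> rel st c ->
  code_at p (pc c) (ecode e1 0 ++ ecode e2 1 ++ [IJlt (rt 0) (rt 1) l]) ->
  exists c' k, runs p W A k c c' /\ Z.of_nat k = ecost e1 + ecost e2 + 1 /\
    pc c' = (if Z.ltb (eval e1 st) (eval e2 st) then l
             else (pc c + length (ecode e1 0) + length (ecode e2 1) + 1)%nat) /\
    rel st c'.
Proof.
  intros Hw1 Hw2 Hi1 Hi2 Hr Hc.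
  apply code_at_app in Hc as [Hc1 Hc]; apply code_at_app in Hc as [Hc2 Hc].
  apply code_at_cons in Hc as [Hc3 _].
  destruct (ecode_correct e1 0 st c Hw1 Hi1 Hr Hc1) as (c1 & R1 & P1 & Hr1 & E1 & F1).
  rewrite <- P1 in Hc2, Hc3.
  destruct (ecode_correct e2 1 st c1 Hw2 Hi2 Hr1 Hc2) as (c2 & R2 & P2 & Hr2 & E2 & F2).
  rewrite <- P2 in Hc3.
  eexists; eexists; split; [|split; [|split]].
  - eapply runs_trans; [exact R1|]; eapply runs_trans; [exact R2|].
    eapply (runs_one p W A c2).
    + eapply rel_ok; [exact Hr2 | exact Hc3 | exact I].
    + unfold step; rewrite Hc3; reflexivity.
  - rewrite !Nat2Z.inj_add, !length_ecode; lia.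
  - cbn; rewrite E2, F2, E1 by lia; destruct (eval e1 st <? eval e2 st); lia.
  - apply rel_pc; auto.
Qed.

(** The induction is on the execution, not on the statement: the remaining iterations of a loop run
    the same code from the same position, reached by the jump back. *)
Lemma code_correct s st st' :
  exec L V s st st' -> swf s = true ->
  forall c, rel st c -> code_at p (pc c) (code s (pc c)) ->
  exists k c', runs p W A k c c' /\ pc c' = (pc c + slen s)%nat /\ rel st' c' /\
    Z.of_nat k = time st' - time st.
Proof.
  induction 1 as [st | x e st Hi Hb | a e1 e2 st Hi1 Hi2 Hix Hb | e1 e2 e3 st Hi1 Hi2 Hi3
    | s1 s2 st st1 st2 X1 IH1 X2 IH2 | e1 e2 s1 s2 st st1 Hi1 Hi2 Hlt X IH
    | e1 e2 s1 s2 st st1 Hi1 Hi2 Hlt X IH | e1 e2 s st Hi1 Hi2 Hlt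
    | e1 e2 s st st1 st2 Hi1 Hi2 Hlt X1 IH1 X2 IH2]; intros Hw c Hr Hc; cbn [swf] in Hw.
  - exists O, c; repeat split; try apply Hr; [constructor | cbn; lia | lia].
  - cbn [code] in Hc; apply code_at_app in Hc as [Hc1 Hc]; apply code_at_cons in Hc as [Hc2 _].
    destruct (ecode_correct e 0 st c Hw Hi Hr Hc1) as (c1 & R1 & P1 & Hr1 & E1 & F1).
    rewrite <- P1 in Hc2.
    assert (E : reg c1 (rt 0) + reg c1 rz = eval e st).
    { destruct Hr1 as (_ & -> & _); lia. }
    eexists; eexists; split; [|split; [|split]].
    + eapply runs_trans; [exact R1|]; eapply (runs_one p W A c1).
      * eapply rel_ok; [exact Hr1 | exact Hc2 | exact I].
      * unfold step; rewrite Hc2, E; reflexivity.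
    + cbn; lia.
    + destruct Hr1 as (G1 & G2 & G3 & G4 & G5 & G6 & G7).
      split; [apply bounded_setv; auto|].
      cbn; unfold updn, rt, rv, ra, rz in *; cbn -[Nat.mul]; repeat split; auto.
      * replace (3 * x + 1)%nat with (S (3 * x)) by lia; exact G2.
      * intros a Ha; destruct (Nat.eqb_spec (3 * a + 2) (3 * x + 1));
          [lia|]; auto.
      * intros y; destruct (Nat.eqb_spec (3 * y + 1) (3 * x + 1)),
          (Nat.eqb_spec y x); try lia; auto.
      * intros r; destruct (Nat.eqb r (3 * x + 1)); auto.
        unfold max_size, narr in *; lia.
    + cbn; rewrite Nat2Z.inj_add, length_ecode; lia.
  - apply andb_prop in Hw as [Hw Hw2]; apply andb_prop in Hw as [Hw0 Hw1].
    apply Nat.ltb_lt in Hw0.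
    cbn [code] in Hc; apply code_at_app in Hc as [Hc1 Hc].
    apply code_at_cons in Hc as [Hc2 Hc].
    apply code_at_app in Hc as [Hc3 Hc]; apply code_at_cons in Hc as [Hc4 _].
    destruct (ecode_correct e1 0 st c Hw1 Hi1 Hr Hc1) as (c1 & R1 & P1 & Hr1 & E1 & F1).
    rewrite <- P1 in Hc2, Hc3, Hc4.
    pose proof (addr_bound a (eval e1 st) Hw0 Hix) as Ha.
    assert (E : reg c1 (rt 0) + reg c1 (ra a) = Z.of_nat a * L + eval e1 st).
    { destruct Hr1 as (_ & _ & Hra & _); rewrite Hra, E1 by auto; lia. }
    set (c2 := Config (S (pc c1)) (updn (reg c1) (rt 0) (Z.of_nat a * L + eval e1 st))
                 (mem c1) (out c1)).
    assert (Hr2 : rel st c2).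
    { apply rel_temp; auto; unfold max_size in *; lia. }
    change (S (pc c1)) with (pc c2) in Hc3, Hc4.
    destruct (ecode_correct e2 1 st c2 Hw2 Hi2 Hr2 Hc3) as (c3 & R3 & P3 & Hr3 & E3 & F3).
    rewrite <- P3 in Hc4.
    assert (E4 : reg c3 (rt 0) = Z.of_nat a * L + eval e1 st).
    { rewrite F3 by lia; unfold c2; cbn; apply updn_same. }
    eexists; eexists; split; [|split; [|split]].
    + eapply runs_trans; [exact R1|]; eapply (runs_step p W A _ c1 c2).
      * eapply rel_ok; [exact Hr1 | exact Hc2 | exact I].
      * unfold step; rewrite Hc2, E; reflexivity.
      * eapply runs_trans; [exact R3|]; eapply (runs_one p W A c3).
        -- eapply rel_ok; [exact Hr3 | exact Hc4 | cbn; rewrite E4; lia].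
        -- unfold step; rewrite Hc4, E4, E3; reflexivity.
    + cbn; rewrite P3; unfold c2; cbn; lia.
    + destruct Hr3 as (G1 & G2 & G3 & G4 & G5 & G6 & G7).
      split; [apply bounded_seta; auto|].
      cbn; repeat split; auto.
      intros b i Hb' Hi; unfold updz, upd2.
      (* Segments of length [L] are disjoint, so equal addresses force equal arrays and equal
         indices. *)
      destruct (Z.eqb_spec (Z.of_nat b * L + i) (Z.of_nat a * L + eval e1 st)) as [Q|Q],
        (Nat.eqb_spec b a) as [Q'|Q']; subst.
      * replace i with (eval e1 st) by lia.
        unfold updz; rewrite Z.eqb_refl; reflexivity.
      * exfalso; apply Q'; destruct (Nat.lt_trichotomy b a) as [q|[q|q]]; auto; nia.
      * unfold updz; destruct (Z.eqb_spec i (eval e1 st)); [lia|]; apply G5; auto.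
      * apply G5; auto.
    + cbn; rewrite Nat2Z.inj_add, Nat2Z.inj_succ, Nat2Z.inj_add, !length_ecode; lia.
  - apply andb_prop in Hw as [Hw Hw3]; apply andb_prop in Hw as [Hw1 Hw2].
    cbn [code] in Hc; apply code_at_app in Hc as [Hc1 Hc].
    apply code_at_app in Hc as [Hc2 Hc].
    apply code_at_app in Hc as [Hc3 Hc]; apply code_at_cons in Hc as [Hc4 _].
    destruct (ecode_correct e1 0 st c Hw1 Hi1 Hr Hc1) as (c1 & R1 & P1 & Hr1 & E1 & F1).
    rewrite <- P1 in Hc2, Hc3, Hc4.
    destruct (ecode_correct e2 1 st c1 Hw2 Hi2 Hr1 Hc2) as (c2 & R2 & P2 & Hr2 & E2 & F2).
    rewrite <- P2 in Hc3, Hc4.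
    destruct (ecode_correct e3 2 st c2 Hw3 Hi3 Hr2 Hc3) as (c3 & R3 & P3 & Hr3 & E3 & F3).
    rewrite <- P3 in Hc4.
    eexists; eexists; split; [|split; [|split]].
    + eapply runs_trans; [exact R1|]; eapply runs_trans; [exact R2|].
      eapply runs_trans; [exact R3|]; eapply (runs_one p W A c3).
      * eapply rel_ok; [exact Hr3 | exact Hc4 | exact I].
      * unfold step; rewrite Hc4; reflexivity.
    + cbn; lia.
    + destruct Hr3 as (G1 & G2 & G3 & G4 & G5 & G6 & G7).
      split; [exact G1|]; cbn; repeat split; auto.
      rewrite G6, E3, (F3 0%nat), (F3 1%nat), (F2 0%nat), E2, E1 by lia; reflexivity.
    + cbn; rewrite !Nat2Z.inj_add, !length_ecode; lia.
  - apply andb_prop in Hw as [Hw1 Hw2]; cbn [code] in Hc.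
    apply code_at_app in Hc as [Hc1 Hc2]; rewrite length_code in Hc2.
    destruct (IH1 Hw1 c Hr Hc1) as (k1 & c1 & R1 & P1 & Hr1 & T1).
    rewrite <- P1 in Hc2.
    destruct (IH2 Hw2 c1 Hr1 Hc2) as (k2 & c2 & R2 & P2 & Hr2 & T2).
    exists (k1 + k2)%nat, c2; repeat split; try apply Hr2.
    + eapply runs_trans; eauto.
    + cbn; lia.
    + lia.
  - apply andb_prop in Hw as [Hw Hw4]; apply andb_prop in Hw as [Hw Hw3].
    apply andb_prop in Hw as [Hw1 Hw2].
    cbn [code] in Hc; rewrite (app_assoc (ecode e1 0)), (app_assoc (_ ++ _) [_]) in Hc.
    apply code_at_app in Hc as [Hc1 Hc].
    apply code_at_app in Hc as [Hc2 Hc]; apply code_at_app in Hc as [Hc3 Hc4].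
    rewrite <- app_assoc in Hc1.
    destruct (test_correct e1 e2 _ st c Hw1 Hw2 Hi1 Hi2 Hr Hc1) as (c1 & k1 & R1 & T1 & P1 & Hr1).
    rewrite (proj2 (Z.ltb_lt _ _) Hlt) in P1.
    rewrite length_code, !length_app in Hc4; cbn [length goto] in Hc4.
    replace (pc c + _ + _ + _)%nat with (pc c1) in Hc4 by lia.
    rewrite <- P1 in Hc4.
    destruct (IH Hw3 c1 (rel_tick _ _ _ Hr1) Hc4) as (k2 & c2 & R2 & P2 & Hr2 & T2).
    exists (k1 + k2)%nat, c2; repeat split; try apply Hr2.
    + eapply runs_trans; eauto.
    + cbn; lia.
    + cbn in T2; lia.
  - apply andb_prop in Hw as [Hw Hw4]; apply andb_prop in Hw as [Hw Hw3].
    apply andb_prop in Hw as [Hw1 Hw2].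
    cbn [code] in Hc; rewrite (app_assoc (ecode e1 0)), (app_assoc (_ ++ _) [_]) in Hc.
    apply code_at_app in Hc as [Hc1 Hc].
    apply code_at_app in Hc as [Hc2 Hc]; apply code_at_app in Hc as [Hc3 Hc4].
    rewrite <- app_assoc in Hc1.
    destruct (test_correct e1 e2 _ st c Hw1 Hw2 Hi1 Hi2 Hr Hc1) as (c1 & k1 & R1 & T1 & P1 & Hr1).
    rewrite (proj2 (Z.ltb_ge _ _) Hlt) in P1.
    rewrite !length_app in Hc2, Hc3; cbn [length] in Hc2, Hc3; rewrite length_code in Hc3.
    replace (pc c + (_ + _))%nat with (pc c1) in Hc2, Hc3 by lia.
    rewrite <- P1 in Hc2, Hc3.
    destruct (IH Hw4 c1 (rel_tick _ _ _ Hr1) Hc2) as (k2 & c2 & R2 & P2 & Hr2 & T2).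
    rewrite <- P2 in Hc3.
    destruct (goto_correct _ _ c2 Hr2 Hc3) as (c3 & R3 & P3 & Hr3).
    exists (k1 + (k2 + 2))%nat, c3; repeat split; try apply Hr3.
    + eapply runs_trans; eauto; eapply runs_trans; eauto.
    + cbn; lia.
    + cbn in T2; cbn; lia.
  - apply andb_prop in Hw as [Hw Hw3]; apply andb_prop in Hw as [Hw1 Hw2].
    cbn [code] in Hc; rewrite (app_assoc (ecode e1 0)), (app_assoc (_ ++ _) [_]) in Hc.
    apply code_at_app in Hc as [Hc1 Hc]; apply code_at_app in Hc as [Hc2 _].
    rewrite <- app_assoc in Hc1.
    destruct (test_correct e1 e2 _ st c Hw1 Hw2 Hi1 Hi2 Hr Hc1) as (c1 & k1 & R1 & T1 & P1 & Hr1).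
    rewrite (proj2 (Z.ltb_ge _ _) Hlt) in P1.
    rewrite !length_app in Hc2; cbn [length] in Hc2.
    replace (pc c + (_ + _))%nat with (pc c1) in Hc2 by lia.
    destruct (goto_correct _ _ c1 Hr1 Hc2) as (c3 & R3 & P3 & Hr3).
    exists (k1 + 2)%nat, c3; repeat split; try apply Hr3.
    + eapply runs_trans; eauto.
    + cbn; lia.
    + cbn; lia.
  - pose proof Hw as Hw'; pose proof Hc as Hc'.
    apply andb_prop in Hw as [Hw Hw3]; apply andb_prop in Hw as [Hw1 Hw2].
    cbn [code] in Hc; rewrite (app_assoc (ecode e1 0)), (app_assoc (_ ++ _) [_]) in Hc.
    apply code_at_app in Hc as [Hc1 Hc]; apply code_at_app in Hc as [_ Hc].
    apply code_at_app in Hc as [Hc2 Hc3].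
    rewrite <- app_assoc in Hc1.
    destruct (test_correct e1 e2 _ st c Hw1 Hw2 Hi1 Hi2 Hr Hc1) as (c1 & k1 & R1 & T1 & P1 & Hr1).
    rewrite (proj2 (Z.ltb_lt _ _) Hlt) in P1.
    rewrite !length_app in Hc2, Hc3; cbn [length goto] in Hc2, Hc3; rewrite length_code in Hc3.
    replace (pc c + _ + 2)%nat with (pc c1) in Hc2, Hc3 by lia.
    rewrite <- P1 in Hc2.
    destruct (IH1 Hw3 c1 (rel_tick _ _ _ Hr1) Hc2) as (k2 & c2 & R2 & P2 & Hr2 & T2).
    rewrite <- P2 in Hc3.
    destruct (goto_correct _ _ c2 Hr2 Hc3) as (c3 & R3 & P3 & Hr3).
    rewrite <- P3 in Hc'.
    destruct (IH2 Hw' c3 (rel_tick _ _ _ Hr3) Hc') as (k4 & c4 & R4 & P4 & Hr4 & T4).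
    exists (k1 + (k2 + (2 + k4)))%nat, c4; repeat split; try apply Hr4.
    + eapply runs_trans; eauto; eapply runs_trans; eauto; eapply runs_trans; eauto.
    + cbn [slen] in *; lia.
    + cbn in T2, T4; lia.
Qed.

End Compile.

(** * From structured programs to machine runs *)

(** The length [n + n + 2] is computed from the cell that holds [n], and the bases by repeated
    addition. The base of array 0 is 0 from the start, which makes 4 + 16 = 20 steps. *)
Definition prelude : program :=
  [ILoad (rt 0) rz; IAdd (rt 0) (rt 0) (rt 0); IConst (rt 1) 2; IAdd (rt 0) (rt 0) (rt 1)]
    ++ map (fun a => IAdd (ra (S a)) (ra a) (rt 0)) (seq 0 (narr - 1)).

Definition compile (s : stmt) : program :=
  prelude ++ code s (length prelude) ++ [IHalt].

(** Array 0 is the input where it lies; its 2n + 1 cells fit into the common length 2n + 2. *)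
Definition init_state (P : list (Z * Z)) : state :=
  State (fun _ => 0) (fun a i => if Nat.eqb a 0 then input_mem P i else 0) [] 0.

Lemma input_mem_big P a : 2 * Z.of_nat (length P) < a -> input_mem P a = 0.
Proof.
  intros H; unfold input_mem.
  destruct (Z.eqb_spec a 0); [lia|]; destruct (Z.ltb_spec a 1); [reflexivity|].
  rewrite (proj2 (nth_error_None P _)); [reflexivity|].
  apply Nat.div_le_lower_bound; lia.
Qed.

Lemma maxcoord_nonneg P : 0 <= maxcoord P.
Proof. induction P as [|[x y] P IH]; cbn; lia. Qed.

Lemma maxcoord_In P x y :
  In (x, y) P -> Z.abs x <= maxcoord P /\ Z.abs y <= maxcoord P.
Proof.
  unfold maxcoord; induction P as [|[x' y'] P IH]; cbn [In fold_right fst snd]; [tauto|].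
  intros [E|H]; [injection E as -> ->; lia|]; specialize (IH H); lia.
Qed.

Lemma input_mem_bound P a :
  Z.abs (input_mem P a) <= Z.max (Z.of_nat (length P)) (maxcoord P).
Proof.
  pose proof (maxcoord_nonneg P) as Hm; unfold input_mem.
  destruct (Z.eqb a 0); [lia|]; destruct (Z.ltb a 1); [lia|].
  destruct (nth_error P _) as [[x y]|] eqn:E; [|lia].
  apply nth_error_In, maxcoord_In in E; destruct (Nat.even _); lia.
Qed.

Lemma compile_correct s P V W A st' :
  let L := 2 * Z.of_nat (length P) + 2 in
  swf s = true -> 8 <= V -> Z.of_nat (length P) <= V -> maxcoord P <= V ->
  max_size * V + Z.of_nat narr * L <= W -> Z.of_nat narr * L <= A ->
  exec L V s (init_state P) st' ->
  exists t cf, iter_step (compile s) t (init P) = Some cf /\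
    step (compile s) cf = None /\
    Z.of_nat t = time st' + 20 /\
    (forall k c, (k <= t)%nat -> iter_step (compile s) k (init P) = Some c ->
       conf_ok (compile s) W A c) /\
    out cf = outp st'.
Proof.
  intros L Hs HV HVn HVm HW HA X.
  assert (HL : 2 <= L) by (unfold L; lia).
  (* The situation after [4 + m] steps of the prelude, when the bases of the arrays up to [m] are
     set. *)
  pose (pre := fun m c => pc c = (4 + m)%nat /\ mem c = input_mem P /\ out c = [] /\
    reg c rz = 0 /\ (forall a, (a <= m)%nat -> reg c (ra a) = Z.of_nat a * L) /\
    (forall x, reg c (rv x) = 0) /\ reg c (rt 0) = L /\ (forall r, Z.abs (reg c r) <= W)).
  assert (HW0 : 16 * V + 17 * L <= W) by exact HW.
  assert (HA0 : 17 * L <= A) by exact HA.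
  assert (Hnth : forall i, (i < 20)%nat -> nth_error (compile s) i = nth_error prelude i).
  { intros i Hi; unfold compile; rewrite nth_error_app1; auto. }
  assert (P0 : exists c, runs (compile s) W A 4 (init P) c /\ pre O c).
  { set (n := Z.of_nat (length P)) in *.
    assert (EL : n + n + 2 = L) by (unfold L; lia).
    set (q := updn (updn (updn (updn (fun _ => 0) (rt 0) n) (rt 0) (n + n)) (rt 1) 2)
                 (rt 0) L).
    exists (Config 4 q (input_mem P) []); split.
    - assert (R0 : forall c i, pc c = i -> (i < 20)%nat ->
                (forall r, Z.abs (reg c r) <= W) ->
                match nth_error prelude i with
                | Some (ILoad _ a) | Some (IStore a _) => reg c a = 0 | _ => True end ->
                conf_ok (compile s) W A c).
      { intros c i Hpc Hi Hr Hm; split; auto; intros a; unfold addr_of.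
        rewrite Hpc, Hnth by auto.
        destruct (nth_error prelude i) as [[]|]; try discriminate;
          intros E; injection E as <-; lia. }
      eapply (runs_step _ _ _ 3 _ (Config 1 (updn (fun _ => 0) (rt 0) n) (input_mem P) [])).
      { eapply R0; cbn; try reflexivity; try lia. }
      { unfold step, init; cbn [pc]; rewrite Hnth by lia; reflexivity. }
      eapply (runs_step _ _ _ 2 _ (Config 2 (updn (updn (fun _ => 0) (rt 0) n) (rt 0) (n + n))
         (input_mem P) [])).
      { eapply R0; cbn; try reflexivity; try lia.
        intros r; unfold updn; destruct (Nat.eqb _ _); lia. }
      { unfold step; cbn [pc]; rewrite Hnth by lia; reflexivity. }
      eapply (runs_step _ _ _ 1 _ (Config 3 (updn (updn (updn (fun _ => 0) (rt 0) n) (rt 0) (n +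
        n))
         (rt 1) 2) (input_mem P) [])).
      { eapply R0; cbn; try reflexivity; try lia.
        intros r; unfold updn; repeat destruct (Nat.eqb _ _); lia. }
      { unfold step; cbn [pc]; rewrite Hnth by lia; reflexivity. }
      apply runs_one.
      { eapply R0; cbn; try reflexivity; try lia.
        intros r; unfold updn; repeat destruct (Nat.eqb _ _); lia. }
      { unfold step; cbn [pc]; rewrite Hnth by lia; unfold q; rewrite <- EL; reflexivity. }
    - unfold pre, q; cbn -[Z.of_nat Nat.mul]; repeat split.
      + intros a Ha; replace a with O by lia; reflexivity.
      + intros x; unfold rv, rt; rewrite !updn_other by lia; reflexivity.
      + intros r; unfold updn; repeat destruct (Nat.eqb _ _); lia. }
  assert (Pm : forall m, (m <= 16)%nat -> exists c, runs (compile s) W A (4 + m) (init P) c /\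
    pre m c).
  { induction m as [|m IH]; intros Hm; [exact P0|].
    destruct IH as (c & R & G1 & G2 & G3 & G4 & G5 & G6 & G7 & G8); [lia|].
    assert (Hn : nth_error (compile s) (pc c) = Some (IAdd (ra (S m)) (ra m) (rt 0))).
    { rewrite G1, Hnth by lia; unfold prelude; rewrite nth_error_app2 by (cbn; lia).
      replace (4 + m - _)%nat with m by (cbn; lia).
      rewrite nth_error_map, nth_error_seq.
      unfold narr; destruct (Nat.ltb_spec m (17 - 1)); [reflexivity | lia]. }
    assert (E : reg c (ra m) + reg c (rt 0) = Z.of_nat (S m) * L) by (rewrite G5, G7; lia).
    eexists; split.
    - replace (4 + S m)%nat with (4 + m + 1)%nat by lia.
      eapply runs_trans; [exact R|]; eapply (runs_one _ _ _ c).
      + split; auto; intros a; unfold addr_of; rewrite Hn; discriminate.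
      + unfold step; rewrite Hn, E; reflexivity.
    - unfold pre; cbn -[Z.of_nat Nat.mul]; unfold updn; repeat split; auto.
      + intros a Ha; unfold ra; destruct (Nat.eqb_spec (3 * a + 2) (3 * S m + 2)).
        * replace a with (S m) by lia; reflexivity.
        * apply G5; lia.
      + intros x; unfold ra, rv; destruct (Nat.eqb_spec (3 * x + 1) (3 * S m + 2)); [lia|].
        apply G6.
      + unfold ra, rt; destruct (Nat.eqb_spec (3 * 0 + 3) (3 * S m + 2)); [lia|exact G7].
      + intros r; destruct (Nat.eqb _ _); auto.
        assert (Z.of_nat (S m) * L <= 17 * L) by (apply Z.mul_le_mono_nonneg_r; lia).
        assert (0 <= Z.of_nat (S m) * L) by (apply Z.mul_nonneg_nonneg; lia).
        rewrite Z.abs_eq by assumption; lia. }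
  destruct (Pm 16%nat (le_n _)) as (c & R & G1 & G2 & G3 & G4 & G5 & G6 & G7 & G8).
  assert (Hrel : rel L V W (init_state P) c).
  { unfold rel; cbn -[Z.of_nat Z.mul]; repeat split; auto.
    - cbn; lia.
    - cbn; intros a i; destruct (Nat.eqb a 0); [|lia].
      pose proof (input_mem_bound P i); lia.
    - intros a Ha; apply G5; unfold narr in Ha; lia.
    - intros a i Ha Hi; rewrite G2; destruct a as [|a].
      + reflexivity.
      + apply input_mem_big; fold L; unfold L in *; nia. }
  assert (Hc : code_at (compile s) (pc c) (code s (pc c))).
  { rewrite G1; exists prelude, [IHalt]; split; reflexivity. }
  destruct (code_correct (compile s) L V W A ltac:(lia) HV HW HA _ _ _ X Hs c Hrel Hc)
    as (k & c' & R' & P' & Hrel' & T').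
  assert (Hn : nth_error (compile s) (pc c') = Some IHalt).
  { rewrite P', G1; unfold compile; rewrite nth_error_app2 by (cbn; lia).
    rewrite nth_error_app2; rewrite length_code; [|cbn; lia].
    replace (_ - _ - _)%nat with O by (cbn; lia); reflexivity. }
  exists (20 + k)%nat, c'; split; [|split; [|split; [|split]]].
  - eapply runs_iter, runs_trans; eauto.
  - unfold step; rewrite Hn; reflexivity.
  - cbn [time init_state] in T'; lia.
  - intros j cj Hj Hi; refine (runs_ok _ _ _ (20 + k) _ c' _ _ j cj Hj Hi).
    { exact (runs_trans _ _ _ _ _ _ _ _ R R'). }
    eapply rel_ok; [exact Hrel' | exact Hn | exact I].
  - apply Hrel'.
Qed.

(** * Total-correctness rules *)

(** Frame conditions are computed as booleans, so that for a concrete program and a concrete name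
    they hold by [reflexivity]. *)
Fixpoint modv (s : stmt) (x : nat) : bool :=
  match s with
  | Skip | Store _ _ _ | Out _ _ _ => false
  | Assign y _ => Nat.eqb x y
  | Seq s1 s2 | If _ _ s1 s2 => modv s1 x || modv s2 x
  | While _ _ s => modv s x
  end.

Fixpoint moda (s : stmt) (a : nat) : bool :=
  match s with
  | Skip | Assign _ _ | Out _ _ _ => false
  | Store b _ _ => Nat.eqb a b
  | Seq s1 s2 | If _ _ s1 s2 => moda s1 a || moda s2 a
  | While _ _ s => moda s a
  end.

Fixpoint modo (s : stmt) : bool :=
  match s with
  | Skip | Assign _ _ | Store _ _ _ => false
  | Out _ _ _ => true
  | Seq s1 s2 | If _ _ s1 s2 => modo s1 || modo s2
  | While _ _ s => modo s
  end.

Definition same (s : stmt) (st st' : state) : Prop :=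
  (forall x, modv s x = false -> var st' x = var st x) /\
  (forall a, moda s a = false -> arr st' a = arr st a) /\
  (modo s = false -> outp st' = outp st).

Lemma same_refl s st : same s st st.
Proof. repeat split; auto. Qed.

Lemma same_trans s st1 st2 st3 : same s st1 st2 -> same s st2 st3 -> same s st1 st3.
Proof.
  intros (H1 & H2 & H3) (G1 & G2 & G3); repeat split; intros.
  - rewrite G1, H1; auto.
  - rewrite G2, H2; auto.
  - rewrite G3, H3; auto.
Qed.

Lemma exec_same L V s st st' : exec L V s st st' -> same s st st'.
Proof.
  induction 1; unfold same in *; cbn in *;
    repeat match goal with H : _ /\ _ |- _ => destruct H end;
    repeat split; intros;
    repeat match goal with H : (_ || _)%bool = false |- _ =>
      apply Bool.orb_false_iff in H as [? ?] end; auto; try discriminate;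
    try (repeat match goal with
      | H : forall x, _ -> var ?s x = _ |- context [var ?s _] => rewrite H by auto
      | H : forall x, _ -> arr ?s x = _ |- context [arr ?s _] => rewrite H by auto
      | H : _ -> outp ?s = _ |- context [outp ?s] => rewrite H by auto
      end; reflexivity).
  - unfold updn; match goal with H : Nat.eqb _ _ = false |- _ => rewrite H end; reflexivity.
  - unfold upd2; match goal with H : Nat.eqb _ _ = false |- _ => rewrite H end; reflexivity.
Qed.

(** Total correctness: a terminating execution is asserted. [bounded] is passed along inside [wp],
    so that assertions about programs need not carry it. *)
Definition wp (L V : Z) (s : stmt) (Q : state -> Prop) (st : state) : Prop :=
  bounded V st -> exists st', exec L V s st st' /\ bounded V st' /\ Q st'.

Section Rules.
Variables (L V : Z).

Lemma wp_mono s (Q Q' : state -> Prop) st :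
  wp L V s Q st -> (forall st', bounded V st' -> same s st st' -> Q st' -> Q' st') ->
  wp L V s Q' st.
Proof.
  intros H HQ Hb; destruct (H Hb) as (st' & X & Hb' & Hq).
  exists st'; split; [|split]; auto; apply HQ; auto; eapply exec_same; eauto.
Qed.

Lemma wp_skip (Q : state -> Prop) st : Q st -> wp L V Skip Q st.
Proof. intros H Hb; exists st; split; [|split]; auto; constructor. Qed.

Lemma wp_assign x e (Q : state -> Prop) v a o t :
  let st := State v a o t in
  eidx L e st -> Z.abs (eval e st) <= V ->
  Q (State (updn v x (eval e st)) a o (t + (ecost e + 1))) ->
  wp L V (Assign x e) Q st.
Proof.
  intros st H1 H2 H Hb.
  exists (tick (ecost e + 1) (setv st x (eval e st))); split; [|split].
  - constructor; auto.
  - apply bounded_setv; auto.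
  - exact H.
Qed.

Lemma wp_store b e1 e2 (Q : state -> Prop) v a o t :
  let st := State v a o t in
  eidx L e1 st -> eidx L e2 st -> 0 <= eval e1 st < L -> Z.abs (eval e2 st) <= V ->
  Q (State v (upd2 a b (eval e1 st) (eval e2 st)) o (t + (ecost e1 + ecost e2 + 2))) ->
  wp L V (Store b e1 e2) Q st.
Proof.
  intros st H1 H2 H3 H4 H Hb.
  exists (tick (ecost e1 + ecost e2 + 2) (seta st b (eval e1 st) (eval e2 st)));
    split; [|split].
  - constructor; auto.
  - apply bounded_seta; auto.
  - exact H.
Qed.

Lemma wp_out e1 e2 e3 (Q : state -> Prop) v a o t :
  let st := State v a o t in
  eidx L e1 st -> eidx L e2 st -> eidx L e3 st ->
  Q (State v a (o ++ [(eval e1 st, eval e2 st, eval e3 st)])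
       (t + (ecost e1 + ecost e2 + ecost e3 + 1))) ->
  wp L V (Out e1 e2 e3) Q st.
Proof.
  intros st H1 H2 H3 H Hb.
  exists (tick (ecost e1 + ecost e2 + ecost e3 + 1)
            (emit st (eval e1 st, eval e2 st, eval e3 st))); split; [|split].
  - constructor; auto.
  - exact Hb.
  - exact H.
Qed.

Lemma wp_seq s1 s2 Q st : wp L V s1 (wp L V s2 Q) st -> wp L V (Seq s1 s2) Q st.
Proof.
  intros H Hb; destruct (H Hb) as (st1 & X1 & Hb1 & H1).
  destruct (H1 Hb1) as (st2 & X2 & Hb2 & H2).
  exists st2; split; [|split]; auto; econstructor; eauto.
Qed.

Lemma wp_if e1 e2 s1 s2 Q v a o t :
  let st := State v a o t in
  eidx L e1 st -> eidx L e2 st ->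
  (eval e1 st < eval e2 st -> wp L V s1 Q (State v a o (t + (ecost e1 + ecost e2 + 1)))) ->
  (eval e2 st <= eval e1 st ->
   wp L V s2 (fun st' => Q (State (var st') (arr st') (outp st') (time st' + 2)))
     (State v a o (t + (ecost e1 + ecost e2 + 1)))) ->
  wp L V (If e1 e2 s1 s2) Q st.
Proof.
  intros st H1 H2 G1 G2 Hb; destruct (Z_lt_le_dec (eval e1 st) (eval e2 st)) as [C|C].
  - destruct (G1 C Hb) as (st' & X & Hb' & Hq).
    exists st'; split; [|split]; auto; apply exec_if_then; auto.
  - destruct (G2 C Hb) as (st' & X & Hb' & Hq).
    exists (tick 2 st'); split; [|split]; auto; apply exec_if_else; auto.
Qed.

(** By [same], whatever the body does not modify still has its value from before the loop, so an
    invariant only speaks of what changes. It also sees the time; [+ 2] is the jump back. *)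
Lemma wp_while (Inv : (nat -> Z) -> (nat -> Z -> Z) -> list (Z * Z * Z) -> Z -> Prop)
    (mu : (nat -> Z) -> (nat -> Z -> Z) -> Z) e1 e2 s (Q : state -> Prop) st :
  Inv (var st) (arr st) (outp st) (time st) ->
  (forall v a o t,
     let st1 := State v a o t in
     same s st st1 -> bounded V st1 -> Inv v a o t ->
     eidx L e1 st1 /\ eidx L e2 st1 /\
     (eval e1 st1 < eval e2 st1 ->
      0 <= mu v a /\
      wp L V s (fun st2 => Inv (var st2) (arr st2) (outp st2) (time st2 + 2) /\
                           mu (var st2) (arr st2) < mu v a)
        (State v a o (t + (ecost e1 + ecost e2 + 1)))) /\
     (eval e2 st1 <= eval e1 st1 -> Q (State v a o (t + (ecost e1 + ecost e2 + 3))))) ->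
  wp L V (While e1 e2 s) Q st.
Proof.
  intros H0 H.
  (* The measure must be nonnegative only when the body is entered and may then fall below 0; adding
     1 before truncation makes this last step a decrease too. *)
  assert (G : forall k st1, Z.to_nat (mu (var st1) (arr st1) + 1) = k ->
    same s st st1 -> Inv (var st1) (arr st1) (outp st1) (time st1) ->
    wp L V (While e1 e2 s) Q st1).
  { intros k; induction k as [k IH] using (well_founded_induction lt_wf).
    intros [v a o t] Hk Hs Hi Hb; cbn [var arr outp time] in *.
    destruct (H v a o t Hs Hb Hi) as (H1 & H2 & H3 & H4).
    destruct (Z_lt_le_dec (eval e1 (State v a o t)) (eval e2 (State v a o t))) as [C|C].
    - destruct (H3 C) as [Hmu Hw].
      destruct (Hw Hb) as (st2 & X & Hb2 & Hi2 & Hm2).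
      destruct (IH (Z.to_nat (mu (var st2) (arr st2) + 1)) ltac:(lia) (tick 2 st2))
        as (st3 & X3 & Hb3 & Hq); auto.
      { eapply same_trans; [exact Hs|]; exact (exec_same _ _ _ _ _ X). }
      exists st3; split; [|split]; auto.
      eapply exec_while_loop; eauto.
    - exists (tick (ecost e1 + ecost e2 + 3) (State v a o t)); split; [|split].
      + apply exec_while_stop; auto.
      + exact Hb.
      + exact (H4 C). }
  eapply G; eauto; apply same_refl.
Qed.

Definition For (i hi : nat) (s : stmt) : stmt :=
  While (EVar i) (EVar hi) (Seq s (Assign i (EAdd (EVar i) (EConst 1)))).

(** The constants are the test (3), the increment with the jump back (4 + 2) and the failing test
    with the exit jump (5). As the invariant sees the time, it can express amortized bounds. *)
Lemma wp_for_time (Inv : Z -> (nat -> Z) -> (nat -> Z -> Z) -> list (Z * Z * Z) -> Z -> Prop)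
    i hi s (Q : state -> Prop) st N :
  var st hi = N -> modv s hi = false -> modv s i = false -> Nat.eqb hi i = false ->
  var st i <= N ->
  Inv (var st i) (var st) (arr st) (outp st) (time st) ->
  (forall k v a o t,
     same (For i hi s) st (State v a o t) -> bounded V (State v a o t) ->
     var st i <= k < N -> v i = k -> v hi = N -> Inv k v a o t ->
     wp L V s (fun st2 => Inv (k + 1) (updn (var st2) i (k + 1)) (arr st2) (outp st2)
                            (time st2 + 6)) (State v a o (t + 3))) ->
  (forall v a o t,
     same (For i hi s) st (State v a o t) -> bounded V (State v a o t) ->
     v i = N -> v hi = N -> Inv N v a o t -> Q (State v a o (t + 5))) ->
  wp L V (For i hi s) Q st.
Proof.
  intros HN Hhi Hi Hne Hle H0 Hbody Hend.
  apply (wp_while (fun v a o t => var st i <= v i <= N /\ v hi = N /\ Inv (v i) v a o t)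
           (fun v a => N - v i)); [repeat split; auto; lia|].
  intros v a o t st1 Hs Hb (Hk & Hh & HI); cbn [eidx eval ecost var]; unfold st1; cbn [var].
  split; [exact I|split; [exact I|split]]; intros C.
  - split; [lia|]; apply wp_seq.
    eapply wp_mono; [apply (Hbody (v i)); auto; lia|].
    intros [v2 a2 o2 t2] Hb2 (Hs2 & _) HI2; cbn [var arr outp time] in *.
    rewrite <- (Hs2 i Hi) in C, HI2 at 1; rewrite <- (Hs2 i Hi) in Hk, HI2.
    rewrite Hh in C.
    apply wp_assign; cbn [eidx eval ecost var arr outp time]; auto.
    + pose proof (proj1 Hb hi); cbn in *; rewrite (Hs2 i Hi) in *.
      pose proof (proj1 Hb i); cbn in *; lia.
    + assert (E : updn v2 i (v2 i + 1) i = v2 i + 1) by apply updn_same.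
      assert (E' : updn v2 i (v2 i + 1) hi = v2 hi) by (unfold updn; rewrite Hne; reflexivity).
      rewrite E, E', (Hs2 hi Hhi); repeat split; try lia.
      * replace (t2 + (1 + 1 + 1 + 1) + 2) with (t2 + 6) by lia; exact HI2.
      * rewrite <- (Hs2 i Hi); lia.
  - change (1 + 1 + 3) with 5.
    assert (E : v i = N) by lia.
    apply Hend; auto; rewrite <- E at 1; exact HI.
Qed.

(** The version for bodies with a uniform bound [T]; the 9 is the overhead 3 + 6 of an iteration. *)
Lemma wp_for (Inv : Z -> (nat -> Z) -> (nat -> Z -> Z) -> list (Z * Z * Z) -> Prop) T
    i hi s (Q : state -> Prop) st N :
  var st hi = N -> modv s hi = false -> modv s i = false -> Nat.eqb hi i = false ->
  var st i <= N ->
  Inv (var st i) (var st) (arr st) (outp st) ->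
  (forall k v a o t,
     same (For i hi s) st (State v a o t) -> bounded V (State v a o t) ->
     var st i <= k < N -> v i = k -> v hi = N -> Inv k v a o ->
     wp L V s (fun st2 => Inv (k + 1) (updn (var st2) i (k + 1)) (arr st2) (outp st2) /\
                          time st2 <= t + T) (State v a o t)) ->
  (forall v a o t,
     same (For i hi s) st (State v a o t) -> bounded V (State v a o t) ->
     v i = N -> v hi = N -> Inv N v a o ->
     t <= time st + (N - var st i) * (T + 9) + 5 -> Q (State v a o t)) ->
  wp L V (For i hi s) Q st.
Proof.
  intros HN Hhi Hi Hne Hle H0 Hbody Hend.
  apply (wp_for_time (fun k v a o t => Inv k v a o /\
    t <= time st + (k - var st i) * (T + 9)) i hi s Q st N); auto.
  - split; auto; lia.
  - intros k v a o t Hs Hb Hk Ei Eh [HI Ht].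
    eapply wp_mono; [apply (Hbody k v a o (t + 3)); auto|].
    intros [v2 a2 o2 t2] Hb2 Hs2 [HI2 Ht2]; cbn [var arr outp time] in *; split; auto; lia.
  - intros v a o t Hs Hb Ei Eh [HI Ht]; apply Hend; auto; lia.
Qed.

End Rules.

Arguments For : simpl never.

(** * Notations and symbolic execution *)

Local Coercion EVar : nat >-> expr.
Local Notation "# c" := (EConst c) (at level 5, c at level 1).
Local Notation "e1 +! e2" := (EAdd e1 e2) (at level 50, left associativity).
Local Notation "e1 -! e2" := (ESub e1 e2) (at level 50, left associativity).
Local Notation "a @@ e" := (ELoad a e) (at level 40, no associativity).
Local Notation "x ::= e" := (Assign x e) (at level 70).
Local Notation "s1 ;; s2" := (Seq s1 s2) (at level 75, right associativity).

Local Notation vN := 0%nat (only parsing).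
Local Notation vM := 1%nat (only parsing).
Local Notation vS := 2%nat (only parsing).
Local Notation vB := 3%nat (only parsing).
Local Notation vlo := 4%nat (only parsing).
Local Notation vhi := 5%nat (only parsing).
Local Notation vd := 6%nat (only parsing).
Local Notation vi := 7%nat (only parsing).
Local Notation vr := 8%nat (only parsing).
Local Notation vm := 9%nat (only parsing).
Local Notation vb := 10%nat (only parsing).
Local Notation vk := 11%nat (only parsing).
Local Notation vc := 12%nat (only parsing).
Local Notation vp := 13%nat (only parsing).
Local Notation vq := 14%nat (only parsing).
Local Notation vt := 15%nat (only parsing).
Local Notation vu := 16%nat (only parsing).

(** [aKA] and [aKB] hold the primary and secondary sort keys, [aA0] the points not yet
    extracted by the sort, [aA1] the minimum of each block and [aBS] the start of the
    block of each point.  The value 0 stands for no point. *)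
Local Notation aIN := 0%nat (only parsing).
Local Notation aKA := 1%nat (only parsing).
Local Notation aKB := 2%nat (only parsing).
Local Notation aPO := 3%nat (only parsing).
Local Notation aX := 4%nat (only parsing).
Local Notation aY := 5%nat (only parsing).
Local Notation aC := 6%nat (only parsing).
Local Notation aRS := 7%nat (only parsing).
Local Notation aHR := 8%nat (only parsing).
Local Notation aMK := 9%nat (only parsing).
Local Notation aST := 10%nat (only parsing).
Local Notation aCU := 11%nat (only parsing).
Local Notation aLA := 12%nat (only parsing).
Local Notation aNX := 13%nat (only parsing).
Local Notation aA0 := 14%nat (only parsing).
Local Notation aA1 := 15%nat (only parsing).
Local Notation aBS := 16%nat (only parsing).

Arguments updn f i v j / : simpl nomatch.
Arguments upd2 f a i v b / : simpl nomatch.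

Ltac ev := cbn [eval eidx ecost var arr outp time updn upd2 Nat.eqb].
Ltac ev_in H := cbn [eval eidx ecost var arr outp time updn upd2 Nat.eqb] in H.
Ltac side := try (repeat split; solve [auto | lia]).
Ltac splits := repeat match goal with |- _ /\ _ => split end.
Ltac wp1 :=
  lazymatch goal with
  | |- wp _ _ (Seq _ _) _ _ => apply wp_seq
  | |- wp _ _ Skip _ _ => apply wp_skip; ev
  | |- wp _ _ (Assign _ _) _ _ => apply wp_assign; ev; [side | side | ]
  | |- wp _ _ (Store _ _ _) _ _ => apply wp_store; ev; [side | side | side | side | ]
  | |- wp _ _ (Out _ _ _) _ _ => apply wp_out; ev; [side | side | side | ]
  | |- wp _ _ (If _ _ _ _) _ _ =>
      apply wp_if; ev; [side | side | intro | intro ]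
  end.

Lemma updz_same f i v : updz f i v i = v.
Proof. unfold updz; rewrite Z.eqb_refl; reflexivity. Qed.

Lemma updz_other f i v j : j <> i -> updz f i v j = f j.
Proof. intros H; unfold updz; destruct (Z.eqb_spec j i); congruence. Qed.

(** * Sorting *)

Definition klt (K1 K2 : Z -> Z) (i j : Z) : Prop :=
  K1 i < K1 j \/ (K1 i = K1 j /\ K2 i < K2 j).

Definition is_min (K1 K2 A : Z -> Z) (D : Z -> Prop) (r : Z) : Prop :=
  (r = 0 /\ forall i, D i -> A i = 0) \/
  (0 < r /\ (exists i, D i /\ A i = r) /\ forall i, D i -> A i <> 0 -> ~ klt K1 K2 (A i) r).

(** The stride [vd] lets one loop serve both levels of the sort: 1 within a block of [aA0], and the
    block length across [aA1], where the minimum of a block is stored at the first index of the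
    block. *)
Definition argmin (a : nat) : stmt :=
  vr ::= #0 ;;
  vi ::= vlo ;;
  While vi vhi (
    vm ::= a @@ vi ;;
    If #0 vm
      (If #0 vr
        (If (aKA @@ vm) (aKA @@ vr) (vr ::= vm)
          (If (aKA @@ vr) (aKA @@ vm) Skip
            (If (aKB @@ vm) (aKB @@ vr) (vr ::= vm) Skip)))
        (vr ::= vm))
      Skip ;;
    vi ::= vi +! vd).

Lemma argmin_spec a n L V lo hi d cnt st (Q : state -> Prop) :
  0 <= n -> n < L -> L <= 2 * n + 2 -> 4 * n + 8 <= V ->
  var st vlo = lo -> var st vhi = hi -> var st vd = d ->
  0 <= lo -> hi <= L -> 0 < d <= n + 1 -> 0 <= cnt -> hi <= lo + cnt * d -> lo <= L ->
  (forall i, 0 <= i < L -> 0 <= arr st a i <= n) ->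
  (forall st', same (argmin a) st st' -> bounded V st' ->
     is_min (arr st aKA) (arr st aKB) (arr st a)
       (fun i => lo <= i < hi /\ exists j, i = lo + j * d) (var st' vr) ->
     0 <= var st' vr <= n ->
     time st' <= time st + 60 * cnt + 20 -> Q st') ->
  wp L V (argmin a) Q st.
Proof.
  intros Hn HnL HL HV Elo Ehi Ed Hlo Hhi Hd Hcnt Hc HloL HA HQ.
  cut (wp L V (argmin a) (fun st' => is_min (arr st aKA) (arr st aKB) (arr st a)
       (fun i => lo <= i < hi /\ exists j, i = lo + j * d) (var st' vr) /\
     0 <= var st' vr <= n /\ time st' <= time st + 60 * cnt + 20) st).
  { intros W; eapply wp_mono; [exact W|]; intros st' Hb Hs (H1 & H2 & H3); apply HQ; auto. }
  destruct st as [v0 a0 o0 t0]; cbn [var arr time] in *.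
  unfold argmin; wp1; wp1; wp1; wp1.
  set (K1 := a0 aKA) in *; set (K2 := a0 aKB) in *; set (A := a0 a) in *.
  (* [j] counts the cells read. The clause on [j - 1] says that the last of them lies below [hi], so
     that at exit the cells read are exactly those of the range. *)
  apply (wp_while _ _ (fun v b o t => exists j, 0 <= j <= cnt /\ v vi = lo + j * d /\
     0 <= v vr <= n /\ (j = 0 \/ lo + (j - 1) * d < hi) /\
     is_min K1 K2 A (fun i => lo <= i < v vi /\ exists j, i = lo + j * d) (v vr) /\
     t <= t0 + 60 * j + 5) (fun v b => hi - v vi)); ev.
  { exists 0; rewrite Elo; repeat split; try lia. left; split; auto; intros; lia. }
  intros v b o t (Sv & Sa & _) Hb (j & Hj & Ei & Hr & Hj' & Hm & Ht).
  cbn [var arr] in Sv, Sa.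
  assert (Ea : b a = A) by (apply Sa; reflexivity).
  assert (Ek1 : b aKA = K1) by (apply Sa; reflexivity).
  assert (Ek2 : b aKB = K2) by (apply Sa; reflexivity).
  assert (Ed' : v vd = d) by (rewrite Sv by reflexivity; ev; auto).
  assert (Eh' : v vhi = hi) by (rewrite Sv by reflexivity; ev; auto).
  clear Sv Sa.
  split; [exact I|split; [exact I|split]]; intros C.
  2: { rewrite Eh' in C; split; [|split; [lia|nia]].
       destruct Hm as [[E Hm]|(E & (i & Hi & Ei') & Hm)]; [left|right].
       - split; auto; intros i' [Hi' Hx]; apply Hm; split; auto; lia.
       - split; [auto|split].
         + exists i; split; auto; destruct Hi as [? [j' Hj2]]; split; [|eauto].
           assert (j' < j) by nia; destruct Hj' as [->|Hj']; [nia|].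
           assert (j' * d <= (j - 1) * d) by (apply Z.mul_le_mono_nonneg_r; lia); lia.
         + intros i' [Hi' Hx]; apply Hm; split; auto; lia. }
  rewrite Eh' in C.
  assert (HiL : 0 <= v vi < L) by nia.
  assert (HAi : 0 <= b a (v vi) <= n) by (rewrite Ea; auto).
  split; [lia|].
  assert (step : forall r', 0 <= r' <= n ->
    (is_min K1 K2 A (fun i => lo <= i < v vi /\ exists j, i = lo + j * d) (v vr) ->
     is_min K1 K2 A (fun i => (lo <= i < v vi /\ exists j, i = lo + j * d) \/ i = v vi) r') ->
    exists j0, 0 <= j0 <= cnt /\ v vi + v vd = lo + j0 * d /\ 0 <= r' <= n /\
     (j0 = 0 \/ lo + (j0 - 1) * d < hi) /\
     is_min K1 K2 A (fun i => lo <= i < v vi + v vd /\ exists j, i = lo + j * d) r' /\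
     j0 = j + 1).
  { intros r' Hr' H; exists (j + 1); specialize (H Hm).
    assert (Hd2 : forall i, (lo <= i < v vi + v vd /\ exists j, i = lo + j * d) <->
       ((lo <= i < v vi /\ exists j, i = lo + j * d) \/ i = v vi)).
    { intros i; rewrite Ei, Ed'; split.
      - intros [Hi [j' ->]]; assert (j' <= j) by nia.
        destruct (Z.eq_dec j' j) as [->|]; [right; lia|left]; split; [nia|eauto].
      - intros [[Hi [j' ->]]| ->]; (split; [nia|eauto]). }
    repeat split; try nia; auto.
    destruct H as [[E H]|(E & (i & Hi & Ei') & H)]; [left|right].
    - split; auto; intros i Hi; apply H, Hd2; auto.
    - split; [auto|split].
      + exists i; split; auto; apply Hd2; auto.
      + intros i' Hi'; apply H, Hd2; auto. }
  assert (fin : forall v' o' t' r', v' vi = v vi -> v' vd = v vd -> v' vr = r' -> 0 <= r' <= n ->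
    (is_min K1 K2 A (fun i => lo <= i < v vi /\ exists j, i = lo + j * d) (v vr) ->
     is_min K1 K2 A (fun i => (lo <= i < v vi /\ exists j, i = lo + j * d) \/ i = v vi) r') ->
     t' <= t + 50 ->
    wp L V (vi ::= vi +! vd) (fun st2 => (exists j0, 0 <= j0 <= cnt /\
      var st2 vi = lo + j0 * d /\ 0 <= var st2 vr <= n /\
      (j0 = 0 \/ lo + (j0 - 1) * d < hi) /\
      is_min K1 K2 A (fun i => lo <= i < var st2 vi /\ exists j, i = lo + j * d) (var st2 vr) /\
      time st2 + 2 <= t0 + 60 * j0 + 5) /\ hi - var st2 vi < hi - v vi) (State v' b o' t')).
  { intros v' o' t' r' E1 E2 E3 Hr' H Ht'; wp1.
    rewrite E1, E2, E3; split; [|lia].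
    destruct (step r' Hr' H) as (j0 & G1 & G2 & G3 & G4 & G5 & G6).
    exists j0; repeat split; try lia; auto. }
  wp1; wp1.
  wp1. 
  set (m := b a (v vi)) in *.
  assert (Em : A (v vi) = m) by (unfold m; rewrite Ea; reflexivity).
  assert (nochange : 0 < v vr -> ~ klt K1 K2 m (v vr) ->
     is_min K1 K2 A (fun i => lo <= i < v vi /\ exists j, i = lo + j * d) (v vr) ->
     is_min K1 K2 A (fun i => (lo <= i < v vi /\ exists j, i = lo + j * d) \/ i = v vi) (v vr)).
  { intros Hpos Hk [[E _]|(E & (i & Hi & Ei') & H)]; [lia|right].
    split; [auto|split]; [exists i; auto|].
    intros i' [Hi'| ->]; [auto|rewrite Em; auto]. }
  assert (change : 0 < m -> (v vr = 0 \/ klt K1 K2 m (v vr)) ->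
     is_min K1 K2 A (fun i => lo <= i < v vi /\ exists j, i = lo + j * d) (v vr) ->
     is_min K1 K2 A (fun i => (lo <= i < v vi /\ exists j, i = lo + j * d) \/ i = v vi) m).
  { intros Hpos Hk H; right; split; [auto|split]; [exists (v vi); auto|].
    intros i' [Hi'| ->]; [|rewrite Em; unfold klt; lia].
    intros Hne; destruct H as [[E H]|(E & (i & Hi & Ei') & H)].
    - exfalso; apply Hne, H; auto.
    - destruct Hk as [Hk|Hk]; [lia|]. specialize (H i' Hi' Hne).
      unfold klt in *; lia. }
  wp1.
  - wp1.
    + wp1; [rewrite Ek1 in *|rewrite Ek1 in *].
      * wp1; eapply fin; ev; try reflexivity; try lia. apply change; auto.
        right; left; assumption.
      * wp1; rewrite Ek1 in *.
        -- wp1; eapply fin; ev; try reflexivity; try lia. apply nochange; auto.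
           unfold klt; lia.
        -- wp1; rewrite Ek2 in *; wp1; eapply fin; ev; try reflexivity; try lia.
           ++ apply change; auto; right; right; lia.
           ++ apply nochange; auto; unfold klt; lia.
    + wp1; eapply fin; ev; try reflexivity; try lia. apply change; auto. left; lia.
  - wp1; eapply fin; ev; try reflexivity; try lia.
    intros [[E Hz]|(E & (i & Hi & Ei') & Hz)]; [left|right].
    + split; auto; intros i [Hi| ->]; auto; lia.
    + split; [auto|split]; [exists i; auto|]; intros i' [Hi'| ->] Hne; auto; lia.
Qed.

(** Used in the sort to see that a point is still left in each of the n rounds. *)
Lemma pigeonhole n k f :
  1 <= k -> (forall i, 1 <= i <= n -> exists j, 1 <= j < k /\ f j = i) -> n < k.
Proof.
  intros Hk H; destruct (Z_lt_le_dec n k) as [|C]; [auto|exfalso].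
  pose (l := map Z.of_nat (seq 1 (Z.to_nat n))).
  pose (l' := map (fun x => f (Z.of_nat x)) (seq 1 (Z.to_nat (k - 1)))).
  assert (Hl : (length l <= length l')%nat).
  { apply NoDup_incl_length.
    - apply Injective_map_NoDup; [intros x y; lia | apply seq_NoDup].
    - intros x Hx; apply in_map_iff in Hx as (y & <- & Hy); apply in_seq in Hy.
      destruct (H (Z.of_nat y)) as (j & Hj & E); [lia|].
      apply in_map_iff; exists (Z.to_nat j); rewrite Z2Nat.id by lia; split; auto.
      apply in_seq; lia. }
  unfold l, l' in Hl; rewrite !length_map, !length_seq in Hl; lia.
Qed.

(** Used in the sort to see that no point is left after n rounds. *)
Lemma pigeonhole_inj n k f :
  (forall j, 1 <= j < k -> 1 <= f j <= n) ->
  (forall j j', 1 <= j -> j < j' -> j' < k -> f j <> f j') -> k <= n + 1 \/ k <= 1.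
Proof.
  intros H1 H2; destruct (Z_lt_le_dec (n + 1) k) as [C|]; [|auto].
  destruct (Z_lt_le_dec 1 k) as [Hk|]; [exfalso|auto].
  pose (l := map Z.of_nat (seq 1 (Z.to_nat n))).
  pose (l' := map (fun x => f (Z.of_nat x)) (seq 1 (Z.to_nat (k - 1)))).
  assert (Hl : (length l' <= length l)%nat).
  { apply NoDup_incl_length.
    - apply NoDup_map_NoDup_ForallPairs; [|apply seq_NoDup].
      intros x y Hx Hy E; apply in_seq in Hx, Hy.
      destruct (Nat.lt_trichotomy x y) as [D|[D|D]]; auto; exfalso.
      + apply (H2 (Z.of_nat x) (Z.of_nat y)); auto; lia.
      + apply (H2 (Z.of_nat y) (Z.of_nat x)); auto; lia.
    - intros x Hx; apply in_map_iff in Hx as (y & <- & Hy); apply in_seq in Hy.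
      specialize (H1 (Z.of_nat y) ltac:(lia)).
      apply in_map_iff; exists (Z.to_nat (f (Z.of_nat y))); split; [lia|].
      apply in_seq; lia. }
  unfold l, l' in Hl; rewrite !length_map, !length_seq in Hl; lia.
Qed.

Lemma is_min_ext K1 K2 A A' D D' r :
  is_min K1 K2 A D r -> (forall i, D i <-> D' i) -> (forall i, D i -> A i = A' i) ->
  is_min K1 K2 A' D' r.
Proof.
  intros H HD HA; destruct H as [[E H]|(E & (i & Hi & Ei) & H)]; [left|right].
  - split; auto; intros i Hi; rewrite <- HA; [apply H|]; apply HD; auto.
  - split; [auto|split].
    + exists i; split; [apply HD; auto|]; rewrite <- HA; auto.
    + intros i' Hi'; apply HD in Hi'; rewrite <- HA by auto; apply H; auto.
Qed.

(** In the absence of division, the start of the block of each index is tabulated. An extraction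
    changes one block only, so it costs a scan of the block minima and a rescan of that block. Index
    0 belongs to the first block, where its value 0 makes it an empty cell. *)
Definition sort : stmt :=
  vb ::= #0 ;; vi ::= #0 ;;
  For vi vM (
    If vi (vb +! vB) Skip (vb ::= vb +! vB) ;;
    Store aBS vi vb ;;
    Store aA0 vi vi) ;;
  vd ::= #1 ;; vb ::= #0 ;;
  While vb vM (
    vlo ::= vb ;; vhi ::= vb +! vB ;; argmin aA0 ;;
    Store aA1 vb vr ;;
    vb ::= vb +! vB) ;;
  vk ::= #1 ;;
  For vk vM (
    vlo ::= #0 ;; vhi ::= vM ;; vd ::= vB ;; argmin aA1 ;;
    Store aPO vk vr ;;
    Store aA0 vr #0 ;;
    vb ::= aBS @@ vr ;;
    vlo ::= vb ;; vhi ::= vb +! vB ;; vd ::= #1 ;; argmin aA0 ;;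
    Store aA1 vb vr).

Definition sorted_perm (K1 K2 : Z -> Z) (n : Z) (p : Z -> Z) : Prop :=
  (forall k, 1 <= k <= n -> 1 <= p k <= n) /\
  (forall k k', 1 <= k -> k < k' -> k' <= n -> klt K1 K2 (p k) (p k')) /\
  (forall i, 1 <= i <= n -> exists k, 1 <= k <= n /\ p k = i).

(** The sort runs twice on the same arrays, so what it needs of their old contents must hold again
    at its end. The last block may reach past [n], and its cells there must be empty. *)
Definition blocks_ok (n L : Z) (a : nat -> Z -> Z) : Prop :=
  (forall i, n < i < L -> a aA0 i = 0) /\ (forall i, 0 <= i < L -> 0 <= a aA1 i <= n).

Lemma sort_spec n s L V st (Q : state -> Prop) :
  0 <= n -> 0 <= s -> s * s <= n < (s + 1) * (s + 1) -> L = 2 * n + 2 -> 4 * n + 8 <= V ->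
  var st vM = n + 1 -> var st vB = s + 1 -> blocks_ok n L (arr st) ->
  (forall i j, 1 <= i <= n -> 1 <= j <= n -> i <> j ->
     klt (arr st aKA) (arr st aKB) i j \/ klt (arr st aKA) (arr st aKB) j i) ->
  (forall st', same sort st st' -> bounded V st' ->
     sorted_perm (arr st aKA) (arr st aKB) n (arr st' aPO) -> blocks_ok n L (arr st') ->
     time st' <= time st + 1000 * ((n + 1) * (s + 1)) -> Q st') ->
  wp L V sort Q st.
Proof.
  intros Hn Hs Hsn HL HV EM EB HB0 Hdist HQ.
  cut (wp L V sort (fun st' => sorted_perm (arr st aKA) (arr st aKB) n (arr st' aPO) /\
    blocks_ok n L (arr st') /\ time st' <= time st + 1000 * ((n + 1) * (s + 1))) st).
  { intros W; eapply wp_mono; [exact W|]; intros st' Hb Hs' (H1 & H2 & H3); apply HQ; auto. }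
  clear HQ Q.
  set (B := s + 1) in *.
  assert (HBn : B <= n + 1) by nia.
  destruct st as [v0 a0 o0 t0]; cbn [var arr time] in *.
  set (K1 := a0 aKA) in *; set (K2 := a0 aKB) in *.
  destruct HB0 as [HB1 HB2].
  unfold sort; do 5 wp1.
  eapply (wp_for _ _ (fun k v a o =>
    (exists j, 0 <= j /\ v vb = j * B) /\ v vb <= k <= v vb + B /\
    (forall i, 0 <= i < k -> (exists j, 0 <= j /\ a aBS i = j * B) /\
        a aBS i <= i < a aBS i + B /\ a aA0 i = i) /\
    (forall i, k <= i -> a aA0 i = a0 aA0 i)) 40 _ _ _ _ _ (n + 1)); ev; auto; try reflexivity.
  { lia. }
  { splits; try lia; exists 0; lia. }
  { intros k v a o t (Sv & Sa & _) Hb Hk Ei Eh ((j & Hj & Eb) & Hb' & Hi & Ho).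
    assert (EBv : v vB = B) by (rewrite Sv by reflexivity; ev; auto).
    wp1. eapply (wp_mono _ _ _ (fun st' => exists v' t', st' = State v' a o t' /\ 
      (exists j, 0 <= j /\ v' vb = j * B) /\ v' vb <= k < v' vb + B /\ v' vi = k /\
        t' <= t + 15)).
    { wp1; wp1; ev.
      - eexists _, _; split; [reflexivity|]. rewrite EBv in *; split; [eauto|]. lia.
      - eexists _, _; split; [reflexivity|]; ev. rewrite EBv in *; split.
        + exists (j + 1); lia.
        + lia. }
    intros st' Hb2 _ (v' & t' & -> & Hj' & Hv' & Ei' & Ht'); cbn.
    do 3 wp1; try lia.
    rewrite Ei'; split; [|lia]. splits; auto; try lia.
    - intros i Hi'; destruct (Z.eq_dec i k) as [->|].
      + rewrite !updz_same; splits; auto; lia.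
      + rewrite !updz_other by auto; apply Hi; lia.
    - intros i Hi'; rewrite updz_other by lia; apply Ho; lia. }
  intros v a o t (Sv & Sa & _) Hb Ei Eh (_ & _ & HBS & Ho) Ht.
  cbn [time] in Ht; ev_in Ht.
  assert (EBv : v vB = B) by (rewrite Sv by reflexivity; ev; auto).
  assert (HK1 : a aKA = K1) by (apply Sa; reflexivity).
  assert (HK2 : a aKB = K2) by (apply Sa; reflexivity).
  assert (HA1 : a aA1 = a0 aA1) by (apply Sa; reflexivity).
  assert (HA0 : forall i, n < i < L -> a aA0 i = 0) by (intros; rewrite Ho by lia; auto).
  assert (HA0' : forall i, 0 <= i <= n -> a aA0 i = i) by (intros; apply HBS; lia).
  assert (HBS' : forall i, 0 <= i <= n -> (exists j, 0 <= j /\ a aBS i = j * B) /\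
     a aBS i <= i < a aBS i + B) by (intros i Hi; destruct (HBS i) as (? & ? & ?); auto; lia).
  clear HBS Ho Sv Sa. rewrite <- HA1 in HB2; clear HA1.
  do 5 wp1.
  eapply (wp_while _ _ (fun v1 a1 o1 t1 => exists j, 0 <= j /\ v1 vb = j * B /\
     (j = 0 \/ (j - 1) * B <= n) /\ (forall i, 0 <= i < L -> 0 <= a1 aA1 i <= n) /\
     (forall j', 0 <= j' < j ->
        is_min K1 K2 (a1 aA0) (fun i => j' * B <= i < j' * B + B) (a1 aA1 (j' * B))) /\
     t1 <= t + 4 + j * (60 * B + 60)) (fun v _ => n + 1 - v vb)); ev.
  { exists 0; splits; auto; try lia; apply HB2; lia. }
  intros v1 a1 o1 t1 (Sv & Sa & _) Hb1 (j & Hj & Eb & Hj' & HB2' & Hmin & Ht1).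
  cbn [var arr] in Sv, Sa.
  assert (E2 : v1 vB = B) by (rewrite Sv by reflexivity; ev; auto).
  assert (E3 : v1 vM = n + 1) by (rewrite Sv by reflexivity; ev; auto).
  assert (E4 : v1 vd = 1) by (rewrite Sv by reflexivity; ev; auto).
  assert (E5 : a1 aA0 = a aA0) by (rewrite Sa by reflexivity; ev; auto).
  assert (E6 : a1 aKA = K1) by (rewrite Sa by reflexivity; ev; auto).
  assert (E7 : a1 aKB = K2) by (rewrite Sa by reflexivity; ev; auto).
  assert (E8 : a1 aBS = a aBS) by (rewrite Sa by reflexivity; ev; auto).
  clear Sv Sa.
  split; [exact I|split; [exact I|split]]; intros C.
  { split; [lia|]. do 5 wp1. 
    eapply (argmin_spec aA0 n L V (v1 vb) (v1 vb + v1 vB) 1 B); ev; auto; try lia.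
    { rewrite E5; intros i Hi. destruct (Z_le_gt_dec i n); [rewrite HA0' by lia; lia|].
      rewrite HA0; lia. }
    intros [v2 a2 o2 t2] (Sv & Sa & _) Hb2 Hm Hr Ht2; cbn [var arr time] in *.
    ev_in Hm; rewrite E6, E7 in Hm.
    assert (F1 : v2 vb = v1 vb) by (rewrite Sv by reflexivity; reflexivity).
    assert (F2 : v2 vB = v1 vB) by (rewrite Sv by reflexivity; reflexivity).
    assert (F4 : a2 aA0 = a1 aA0 /\ a2 aA1 = a1 aA1) by (split; apply Sa; reflexivity).
    destruct F4 as [F4 F5]; clear Sv Sa.
    do 3 wp1. rewrite F1, F2, F4, F5; split; [|lia].
    exists (j + 1); splits; try lia.
    - intros i Hi; destruct (Z.eq_dec i (v1 vb)) as [->|];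
        [rewrite updz_same; lia | rewrite updz_other by auto; auto].
    - intros j' Hj2; destruct (Z.eq_dec j' j) as [->|].
      + rewrite Eb, updz_same. eapply is_min_ext; [exact Hm| |auto].
        intros i; rewrite Eb, E2; split; [tauto|]; intros; split; auto.
        exists (i - j * B); lia.
      + rewrite updz_other by nia; apply Hmin; lia. }
  assert (HjB : j <= B) by (destruct Hj' as [->|]; nia).
  assert (Hallj : forall j', 0 <= j' -> j' * B <= n -> j' < j) by (intros; nia).
  wp1; wp1.
  assert (HBB : B * B <= 3 * n + 1) by (unfold B; nia).
  assert (Ht1' : t1 <= t + 4 + B * (60 * B + 60)) by nia.
  clear Ht1.
  (* The cleared cells are the points extracted before round [k]. The last clause, that these
     precede all remaining points, keeps the output sorted. *)
  eapply (wp_for _ _ (fun k v2 a2 o2 =>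
    (forall i, 0 <= i <= n -> a2 aA0 i = 0 \/ a2 aA0 i = i) /\
    (forall i, n < i < L -> a2 aA0 i = 0) /\
    (forall i, 0 <= i < L -> 0 <= a2 aA1 i <= n) /\
    (forall j', 0 <= j' -> j' * B <= n ->
        is_min K1 K2 (a2 aA0) (fun i => j' * B <= i < j' * B + B) (a2 aA1 (j' * B))) /\
    (forall k', 1 <= k' < k -> 1 <= a2 aPO k' <= n /\ a2 aA0 (a2 aPO k') = 0) /\
    (forall k' k'', 1 <= k' -> k' < k'' -> k'' < k -> klt K1 K2 (a2 aPO k') (a2 aPO k'')) /\
    (forall i, 1 <= i <= n -> a2 aA0 i = 0 -> exists k', 1 <= k' < k /\ a2 aPO k' = i) /\
    (forall k' i, 1 <= k' < k -> 1 <= i <= n -> a2 aA0 i <> 0 -> klt K1 K2 (a2 aPO k') i))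
    (120 * B + 150) _ _ _ _ _ (n + 1)); ev; auto; try reflexivity.
  { lia. }
  { rewrite E5; splits; auto; try apply HB2'; try lia; auto.
    - rewrite <- E5; intros j' Hj1 Hj2; apply Hmin; split; auto.
    - intros i Hi; rewrite HA0' by lia; lia. }
  { intros k v2 a2 o2 t2 (Sv & Sa & _) Hb2 Hk Ek EM2 (I1 & I2 & I3 & I4 & I5 & I6 & I7 & I8).
    cbn [var arr] in Sv, Sa.
    assert (G2 : v2 vB = B) by (rewrite Sv by reflexivity; ev; auto).
    assert (G6 : a2 aKA = K1) by (rewrite Sa by reflexivity; ev; auto).
    assert (G7 : a2 aKB = K2) by (rewrite Sa by reflexivity; ev; auto).
    assert (G8 : a2 aBS = a aBS) by (rewrite Sa by reflexivity; ev; auto).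
    clear Sv Sa. do 7 wp1.
    eapply (argmin_spec aA1 n L V 0 (n + 1) B B); ev; auto; try lia.
    intros [v3 a3 o3 t3] (Sv & Sa & _) Hb3 Hm Hr Ht3; cbn [var arr time] in *.
    ev_in Hm; rewrite G6, G7 in Hm.
    assert (F1 : v3 vk = k) by (rewrite Sv by reflexivity; auto).
    assert (F2 : v3 vB = B) by (rewrite Sv by reflexivity; auto).
    assert (F3 : forall x, x <> aPO -> x <> aA0 -> x <> aA1 -> a3 x = a2 x)
      by (intros; apply Sa; reflexivity).
    assert (F4 : a3 aA0 = a2 aA0) by (apply Sa; reflexivity).
    assert (F5 : a3 aA1 = a2 aA1) by (apply Sa; reflexivity).
    assert (F6 : a3 aPO = a2 aPO) by (apply Sa; reflexivity).
    assert (F7 : a3 aBS = a aBS) by (rewrite <- G8; apply F3; discriminate).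
    assert (F8 : a3 aKA = K1) by (rewrite <- G6; apply F3; discriminate).
    assert (F9 : a3 aKB = K2) by (rewrite <- G7; apply F3; discriminate).
    clear Sv Sa F3.
    set (m := v3 vr) in *.
    (* If all cells were empty, the [k - 1 < n] earlier rounds would have extracted every point. *)
    assert (Hex : exists i0, 1 <= i0 <= n /\ a2 aA0 i0 <> 0).
    { destruct (Z_lt_le_dec 0 m) as [Hm0|Hm0].
      - destruct Hm as [[E _]|(_ & (i & (Hi & (jj & Ej)) & Ei') & _)]; [lia|].
        assert (Hjj : 0 <= jj) by nia.
        destruct (I4 jj) as [[E _]|(_ & (i' & Hi' & Ei2) & _)]; [lia|lia| |].
        + replace (jj * B) with i in E by lia; lia.
        + exists i'. replace (jj * B) with i in * by lia.
          assert (i' <= n) by (destruct (Z_le_gt_dec i' n); auto; rewrite I2 in Ei2; lia).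
          destruct (I1 i'); lia.
      - assert (m = 0) by lia. exfalso.
        assert (n < k); [|lia].
        apply (pigeonhole n k (a2 aPO)); [lia|]; intros i Hi; apply I7; auto.
        destruct (HBS' i ltac:(lia)) as [(jj & Hjj & Ejj) Hin].
        destruct (I4 jj Hjj ltac:(lia)) as [[_ Hz]|(Hp & _)]; [apply Hz; lia|].
        destruct Hm as [[_ Hz]|(Hp' & _)]; [|lia].
        rewrite Hz in Hp; [lia|]; split; [lia|exists jj; lia]. }
    (* A remaining point is compared with the minimum of its block, and that one with the minimum
       [m] of the minima. *)
    assert (Hmm : 1 <= m <= n /\ a2 aA0 m = m /\
       forall i, 1 <= i <= n -> a2 aA0 i <> 0 -> ~ klt K1 K2 i m).
    { destruct Hex as (i0 & Hi0 & Hz0).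
      assert (Hblk : forall i, 1 <= i <= n -> a2 aA0 i <> 0 -> 0 < m /\ ~ klt K1 K2 i m).
      { intros i Hi Hz. destruct (HBS' i ltac:(lia)) as [(jj & Hjj & Ejj) Hin].
        destruct (I1 i ltac:(lia)) as [|Ei']; [tauto|].
        destruct (I4 jj Hjj ltac:(lia)) as [[_ Hz']|(Hp & _ & Hmin2)].
        { exfalso; apply Hz, Hz'; lia. }
        specialize (Hmin2 i ltac:(lia) Hz); rewrite Ei' in Hmin2.
        destruct Hm as [[_ Hz']|(Hp' & _ & Hmin3)].
        - rewrite Hz' in Hp; [lia|]; split; [lia|exists jj; lia].
        - split; [lia|].
          specialize (Hmin3 (jj * B)); unfold klt in *; 
          assert (D : 0 <= jj * B < n + 1 /\ (exists j0 : Z, jj * B = 0 + j0 * B))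
            by (split; [lia|exists jj; lia]).
          specialize (Hmin3 D ltac:(lia)); lia. }
      destruct (Hblk i0 Hi0 Hz0) as [Hpos _].
      assert (1 <= m <= n /\ a2 aA0 m = m).
      { destruct Hm as [[E _]|(_ & (i & (Hi & (jj & Ej)) & Ei') & _)]; [lia|].
        assert (Hjj : 0 <= jj) by nia.
        replace i with (jj * B) in * by lia.
        destruct (I4 jj) as [[E _]|(_ & (i' & Hi' & Ei2) & _)]; [lia|lia|lia|].
        rewrite Ei' in Ei2.
        assert (i' <= n) by (destruct (Z_le_gt_dec i' n); auto; rewrite I2 in Ei2; lia).
        destruct (I1 i' ltac:(lia)) as [E|E]; [lia|].
        rewrite E in Ei2; split; [lia | rewrite <- Ei2; exact E]. }
      split; [tauto|split; [tauto|]]; intros i Hi Hz; apply Hblk; auto. }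
    clear Hex Hm; destruct Hmm as (Hm1 & Hm2 & Hm3); subst m.
    do 6 wp1.
    { apply (proj2 Hb3 aBS). }
    assert (HBm := HBS' (v3 vr) ltac:(lia)).
    rewrite F7; do 7 wp1.
    remember (v3 vr) as m eqn:Em. remember (a aBS m) as b eqn:Eb'.
    assert (Hb0 : 0 <= b <= n) by (destruct HBm as [(jb & ? & ?) ?]; nia).
    eapply (argmin_spec aA0 n L V b (b + B) 1 B); ev; rewrite ?F2; auto; try lia.
    { rewrite F4; intros i Hi. destruct (Z.eq_dec i m) as [->|];
        [rewrite updz_same; lia|rewrite updz_other by auto].
      destruct (Z_le_gt_dec i n); [destruct (I1 i); lia|]. rewrite I2; lia. }
    intros [v4 a4 o4 t4] (Sv & Sa & _) Hb4 Hm4 Hr4 Ht4; cbn [var arr time] in *.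
    ev_in Hm4; rewrite F8, F9, F4 in Hm4.
    assert (J1 : v4 vb = b) by (rewrite Sv by reflexivity; reflexivity).
    assert (J2 : a4 aA0 = updz (a2 aA0) m 0) by (rewrite <- F4; apply Sa; reflexivity).
    assert (J3 : a4 aA1 = a2 aA1) by (rewrite <- F5; apply Sa; reflexivity).
    assert (J4 : a4 aPO = updz (a2 aPO) k m)
      by (rewrite <- F6, <- F1; apply Sa; reflexivity).
    clear Sv Sa. wp1.
    rewrite J1, J2, J3, J4; split; [|lia].
    assert (U : forall i, updz (a2 aA0) m 0 i = if Z.eqb i m then 0 else a2 aA0 i)
      by reflexivity.
    splits.
    - intros i Hi; rewrite U; destruct (Z.eqb i m); auto.
    - intros i Hi; rewrite U; destruct (Z.eqb i m); auto.
    - intros i Hi; destruct (Z.eq_dec i b) as [->|];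
        [rewrite updz_same; lia | rewrite updz_other by auto; auto].
    - intros j' Hj1 Hj2. destruct HBm as [(jb & Hjb & Ejb) HBm].
      destruct (Z.eq_dec j' jb) as [->|Hjne].
      + rewrite <- Ejb, updz_same. eapply is_min_ext; [exact Hm4| |auto].
        intros i; split; [tauto|]; intros; split; auto. exists (i - b); lia.
      + rewrite updz_other by nia. eapply is_min_ext; [apply I4; auto|tauto|].
        intros i Hi; rewrite U; destruct (Z.eqb_spec i m); auto; subst; nia.
    - intros k' Hk'; rewrite U; destruct (Z.eq_dec k' k) as [->|].
      + rewrite updz_same, Z.eqb_refl; auto.
      + rewrite updz_other by auto; split; [apply I5; lia|].
        destruct (Z.eqb_spec (a2 aPO k') m); auto; apply I5; lia.
    - intros k' k'' Hk1 Hk2 Hk3; rewrite (updz_other _ _ _ k') by lia.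
      destruct (Z.eq_dec k'' k) as [->|]; [rewrite updz_same|rewrite updz_other by auto;
        apply I6; lia].
      apply I8; lia.
    - intros i Hi; rewrite U; destruct (Z.eqb_spec i m) as [->|]; intros Hz.
      + exists k; rewrite updz_same; split; auto; lia.
      + destruct (I7 i Hi Hz) as (k' & Hk' & E); exists k'; rewrite updz_other by lia; split;
        auto; lia.
    - intros k' i Hk' Hi; rewrite U; destruct (Z.eqb_spec i m) as [->|Him]; [tauto|]; intros Hz.
      destruct (Z.eq_dec k' k) as [->|]; [rewrite updz_same|rewrite updz_other by auto;
        apply I8; auto; lia].
      (* The keys are distinct, so a point that no remaining point precedes itself precedes all the
         others. *)
      destruct (Hdist i m) as [X|X]; auto; try lia. exfalso; exact (Hm3 i Hi Hz X). }
  intros v2 a2 o2 t2 _ Hb2 _ _ (I1 & I2 & I3 & I4 & I5 & I6 & I7 & I8) Ht2; cbn [time] in Ht2.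
  ev_in Ht2.
  assert (Hall : forall i, 1 <= i <= n -> a2 aA0 i = 0).
  { intros i Hi; destruct (Z.eq_dec (a2 aA0 i) 0) as [|Hz]; auto; exfalso.
    (* Together with the [n] extracted points, a remaining one would give [n + 1] distinct numbers
       between 1 and [n]. *)
    enough (H : n + 2 <= n + 1 \/ n + 2 <= 1) by lia.
    apply (pigeonhole_inj n (n + 2) (fun k => if Z.eqb k (n + 1) then i else a2 aPO k)).
    - intros x Hx; destruct (Z.eqb_spec x (n + 1)); [lia|]; apply I5; lia.
    - intros x y H1 H2 H3; destruct (Z.eqb_spec x (n + 1)); [lia|].
      destruct (Z.eqb_spec y (n + 1)) as [->|].
      + intros <-; apply Hz, I5; lia.
      + specialize (I6 x y ltac:(lia) ltac:(lia) ltac:(lia)); intros E; rewrite E in I6.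
        unfold klt in I6; lia. }
  split; [|split].
  - unfold sorted_perm; splits.
    + intros; apply I5; lia.
    + intros; apply I6; lia.
    + intros i Hi; destruct (I7 i Hi (Hall i Hi)) as (k & Hk & E); exists k; split; auto; lia.
  - split; auto.
  - assert (n * B <= (n + 1) * B) by nia. assert (B <= (n + 1) * B) by nia.
    assert (n + 1 <= (n + 1) * B) by nia. nia.
Qed.

(** * Columns, rows and the preparation of the tables *)

(** A column is named by the position of its first point in [aPO], a number between 1 and n that can
    index arrays whatever the abscissas are. The initial 0 in [vt] compares arbitrarily with the
    first abscissa, but both outcomes leave [vc = 1]. *)
Definition columns : stmt :=
  vc ::= #1 ;; vt ::= #0 ;; vk ::= #1 ;;
  For vk vM (
    vp ::= aPO @@ vk ;;
    If vt (aX @@ vp) (vc ::= vk) Skip ;;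
    vt ::= aX @@ vp ;;
    Store aC vp vc).

Definition columns_ok (n : Z) (a : nat -> Z -> Z) : Prop :=
  (forall i, 1 <= i <= n -> 1 <= a aC i <= n) /\
  (forall i j, 1 <= i <= n -> 1 <= j <= n -> (a aC i = a aC j <-> a aX i = a aX j)).

Lemma columns_spec n L V st (Q : state -> Prop) :
  0 <= n -> L = 2 * n + 2 -> 4 * n + 8 <= V -> var st vM = n + 1 ->
  sorted_perm (arr st aX) (arr st aY) n (arr st aPO) ->
  (forall st', same columns st st' -> bounded V st' -> columns_ok n (arr st') ->
     time st' <= time st + 60 * n + 20 -> Q st') ->
  wp L V columns Q st.
Proof.
  intros Hn HL HV EM (P1 & P2 & P3) HQ.
  cut (wp L V columns (fun st' => columns_ok n (arr st') /\
         time st' <= time st + 60 * n + 20) st).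
  { intros W; eapply wp_mono; [exact W|]; intros st' Hb Hs' (H1 & H2); apply HQ; auto. }
  clear HQ Q.
  destruct st as [v0 a0 o0 t0]; cbn [var arr time] in *.
  set (X := a0 aX) in *; set (Y := a0 aY) in *; set (PO := a0 aPO) in *.
  unfold columns; do 6 wp1.
  eapply (wp_for _ _ (fun k v a o =>
    (k = 1 -> v vc = 1) /\
    (1 < k -> v vt = X (PO (k - 1)) /\ v vc = a aC (PO (k - 1))) /\
    (forall j, 1 <= j < k -> 1 <= a aC (PO j) <= j /\ X (PO (a aC (PO j))) = X (PO j) /\
       forall i, 1 <= i < k -> X (PO i) = X (PO j) -> a aC (PO i) = a aC (PO j)))
    40 _ _ _ _ _ (n + 1)); ev; auto; try reflexivity; try lia.
  { splits; intros; try lia. }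
  { intros k v a o t (Sv & Sa & _) Hb Hk Ek Eh (I1 & I2 & I3); cbn [var arr] in Sv, Sa.
    assert (EX : a aX = X) by (apply Sa; reflexivity).
    assert (EP : a aPO = PO) by (apply Sa; reflexivity).
    specialize (P1 k ltac:(lia)) as Pk.
    wp1; wp1; try apply (proj2 Hb aPO).
    rewrite Ek, EP. wp1.
    eapply (wp_mono _ _ _ (fun st' => exists v' t', st' = State v' a o t' /\ v' vk = k /\
       v' vp = PO k /\ t' <= t + 20 /\
       (v vt < X (PO k) /\ v' vc = k \/ X (PO k) <= v vt /\ v' vc = v vc))).
    { wp1; rewrite EX in *; wp1; try lia; eexists _, _;
        (split; [reflexivity|]); ev; splits; auto; lia. }
    intros st' Hb' _ (v' & t' & -> & E1 & E2 & Ht' & D).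
    wp1; wp1; try lia; try (rewrite E2; apply (proj2 Hb aX)).
    wp1; try lia; try rewrite E2.
    { destruct D as [[_ ->]|[_ ->]]; [lia|].
      destruct (Z.eq_dec k 1) as [->|]; [rewrite I1; lia|].
      destruct (I2 ltac:(lia)) as [_ ->]; specialize (I3 (k - 1) ltac:(lia)); lia. }
    assert (Hne : forall j, 1 <= j < k -> PO j <> PO k).
    { intros j Hj E; specialize (P2 j k ltac:(lia) ltac:(lia) ltac:(lia)); rewrite E in P2.
      unfold klt in P2; lia. }
    split; [splits|lia].
    - lia.
    - intros _; replace (k + 1 - 1) with k by lia; rewrite EX, updz_same; auto.
    - assert (HC : 1 <= v' vc <= k /\ X (PO (v' vc)) = X (PO k) /\
                forall i, 1 <= i < k -> X (PO i) = X (PO k) -> a aC (PO i) = v' vc).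
      { destruct (Z_lt_le_dec 1 k) as [Hk1|].
        - destruct (I2 Hk1) as [Ev Ec]; destruct D as [[Hlt ->]|[Hge ->]].
          + splits; auto; try lia.
            intros i Hi Ei. exfalso.
            assert (X (PO i) <= X (PO (k - 1))); [|lia].
            destruct (Z.eq_dec i (k - 1)) as [->|]; [lia|].
            destruct (P2 i (k - 1)) as [|[]]; lia.
          + assert (Eq : X (PO (k - 1)) = X (PO k)) by (destruct (P2 (k - 1) k) as [|[]]; lia).
            destruct (I3 (k - 1) ltac:(lia)) as (J1 & J2 & J3).
            rewrite Ec; splits; try lia. intros i Hi Ei; apply J3; lia.
        - assert (k = 1) by lia; destruct D as [[_ ->]|[_ ->]];
            rewrite ?I1 by auto; splits; try lia; do 2 f_equal; lia. }
      destruct HC as (C1 & C2 & C3).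
      intros j Hj; destruct (Z.eq_dec j k) as [->|Hjk].
      + rewrite updz_same; splits; try lia.
        intros i Hi Ei; destruct (Z.eq_dec i k) as [->|]; [apply updz_same|].
        rewrite updz_other by (apply Hne; lia); apply C3; auto; lia.
      + rewrite updz_other by (apply Hne; lia); destruct (I3 j ltac:(lia)) as (J1 & J2 & J3).
        splits; try lia.
        intros i Hi Ei; destruct (Z.eq_dec i k) as [->|].
        * rewrite updz_same; symmetry; apply C3; auto; lia.
        * rewrite updz_other by (apply Hne; lia); apply J3; auto; lia. }
  intros v a o t (Sv & Sa & _) Hb _ _ (I1 & I2 & I3) Ht; cbn [time] in Ht; ev_in Ht.
  cbn [arr] in Sa.
  split; [split|lia].
  - intros i Hi; destruct (P3 i Hi) as (k & Hk & <-); specialize (I3 k); lia.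
  - assert (EX : a aX = X) by (apply Sa; reflexivity); cbn [arr]; rewrite EX.
    intros i j Hi Hj; destruct (P3 i Hi) as (k & Hk & <-), (P3 j Hj) as (k' & Hk' & <-).
    destruct (I3 k ltac:(lia)) as (J1 & J2 & J3), (I3 k' ltac:(lia)) as (J1' & J2' & J3').
    split; intros E.
    + rewrite <- J2, <- J2', E; reflexivity.
    + apply J3'; auto; lia.
Qed.

(** A row has more than s points exactly when one of its points has rank s, counted from 0. The
    equality of rank and s is tested by two strict comparisons. *)
Definition rows : stmt :=
  vr ::= #1 ;; vt ::= #0 ;; vk ::= #1 ;;
  For vk vM (
    If vt (aY @@ vk) (vr ::= vk) Skip ;;
    vt ::= aY @@ vk ;;
    Store aRS vk vr ;;
    If (vk -! vr) vS Skip (If vS (vk -! vr) Skip (Store aHR vr #1))).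

Definition rows_ok (n s : Z) (a : nat -> Z -> Z) : Prop :=
  (forall j, 1 <= j <= n -> 1 <= a aRS j <= j /\ a aY (a aRS j) = a aY j /\
     forall i, 1 <= i <= n -> a aY i = a aY j -> a aRS j <= i) /\
  (forall j, 1 <= j <= n ->
     (0 < a aHR (a aRS j) <-> exists i, 1 <= i <= n /\ a aY i = a aY j /\ i - a aRS i = s)).

Lemma rows_spec n s L V st (Q : state -> Prop) :
  0 <= n -> 0 <= s <= n -> L = 2 * n + 2 -> 4 * n + 8 <= V ->
  var st vM = n + 1 -> var st vS = s ->
  (forall i j, 1 <= i -> i < j -> j <= n -> klt (arr st aY) (arr st aX) i j) ->
  (forall i, arr st aHR i = 0) ->
  (forall st', same rows st st' -> bounded V st' -> rows_ok n s (arr st') ->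
     time st' <= time st + 80 * n + 20 -> Q st') ->
  wp L V rows Q st.
Proof.
  intros Hn Hs HL HV EM ES PS HH HQ.
  cut (wp L V rows (fun st' => rows_ok n s (arr st') /\
         time st' <= time st + 80 * n + 20) st).
  { intros W; eapply wp_mono; [exact W|]; intros st' Hb Hs' (H1 & H2); apply HQ; auto. }
  clear HQ Q.
  destruct st as [v0 a0 o0 t0]; cbn [var arr time] in *.
  set (X := a0 aX) in *; set (Y := a0 aY) in *.
  unfold rows; do 6 wp1.
  eapply (wp_for _ _ (fun k v a o =>
    (k = 1 -> v vr = 1) /\
    (1 < k -> v vt = Y (k - 1) /\ v vr = a aRS (k - 1)) /\
    (forall j, 1 <= j < k -> 1 <= a aRS j <= j /\ Y (a aRS j) = Y j /\
       forall i, 1 <= i <= n -> Y i = Y j -> a aRS j <= i) /\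
    (forall r, 0 < a aHR r <-> exists i, 1 <= i < k /\ a aRS i = r /\ i - r = s))
    60 _ _ _ _ _ (n + 1)); ev; auto; try reflexivity; try lia.
  { splits; intros; try lia. rewrite HH; split; [lia|intros (i & Hi & _); lia]. }
  { intros k v a o t (Sv & Sa & _) Hb Hk Ek Eh (I1 & I2 & I3 & I4); cbn [var arr] in Sv, Sa.
    assert (EY : a aY = Y) by (apply Sa; reflexivity).
    assert (ESv : v vS = s) by (rewrite Sv by reflexivity; ev; auto).
    wp1.
    eapply (wp_mono _ _ _ (fun st' => exists v' t', st' = State v' a o t' /\ v' vk = k /\
       v' vS = s /\ t' <= t + 15 /\
       1 <= v' vr <= k /\ Y (v' vr) = Y k /\ (forall i, 1 <= i <= n -> Y i = Y k -> v' vr <= i))).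
    { wp1; rewrite EY, Ek in *.
      - wp1; try lia. eexists _, _; split; [reflexivity|]; ev. splits; rewrite ?Ek; auto; try lia.
        intros i Hi Ei. destruct (Z_lt_le_dec i k) as [C|]; [exfalso|auto].
        destruct (I2 ltac:(lia)) as [E _].
        assert (Y i <= Y (k - 1)); [|lia].
        destruct (Z.eq_dec i (k - 1)) as [->|]; [lia|].
        destruct (PS i (k - 1)) as [|[]]; lia.
      - wp1. eexists _, _; split; [reflexivity|]; ev. splits; auto; try lia.
        + destruct (Z.eq_dec k 1) as [->|]; [rewrite I1; lia|].
          destruct (I2 ltac:(lia)) as [_ ->]; specialize (I3 (k - 1)); lia.
        + destruct (Z.eq_dec k 1) as [->|]; [rewrite I1; lia|].
          destruct (I2 ltac:(lia)) as [_ ->]; specialize (I3 (k - 1)); lia.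
        + destruct (Z.eq_dec k 1) as [->|]; [rewrite I1; auto|].
          destruct (I2 ltac:(lia)) as [E ->]; destruct (I3 (k - 1)) as (_ & -> & _); [lia|].
          destruct (PS (k - 1) k) as [|[]]; lia.
        + intros i Hi Ei. destruct (Z.eq_dec k 1) as [->|]; [rewrite I1; lia|].
          destruct (I2 ltac:(lia)) as [E ->]; apply (I3 (k - 1)); auto; [lia|].
          destruct (PS (k - 1) k) as [|[]]; lia. }
    intros st' Hb' _ (v' & t' & -> & E1 & E2 & Ht' & R1 & R2 & R3).
    wp1; wp1; try lia; try apply (proj2 Hb aY).
    wp1; wp1; try lia.
    assert (HR : forall j, 1 <= j < k + 1 -> let R := updz (a aRS) k (v' vr) in
       1 <= R j <= j /\ Y (R j) = Y j /\ forall i, 1 <= i <= n -> Y i = Y j -> R j <= i).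
    { intros j Hj R; unfold R; destruct (Z.eq_dec j k) as [->|];
      [rewrite updz_same|rewrite updz_other by auto; apply I3; lia].
      splits; auto; lia. }
    cbv zeta in HR. rewrite E1.
    assert (HH' : forall f, (forall r, 0 < f r <-> 0 < a aHR r \/ (r = v' vr /\ k - r = s)) ->
       forall r, 0 < f r <-> exists i, 1 <= i < k + 1 /\ updz (a aRS) k (v' vr) i = r /\
         i - r = s).
    { intros f Hf r; rewrite Hf, I4; split.
      - intros [(i & Hi & Ei & Di)|[-> Dk]].
        + exists i; rewrite updz_other by lia; splits; auto; lia.
        + exists k; rewrite updz_same; splits; auto; lia.
      - intros (i & Hi & Ei & Di); destruct (Z.eq_dec i k) as [->|].
        + rewrite updz_same in Ei; auto.
        + rewrite updz_other in Ei by auto; left; exists i; splits; auto; lia. }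
    assert (Fin : forall f y r0, y = Y k -> r0 = v' vr ->
      (forall r, 0 < f r <-> 0 < a aHR r \/ (r = v' vr /\ k - r = s)) ->
      (k + 1 = 1 -> r0 = 1) /\
      (1 < k + 1 -> y = Y (k + 1 - 1) /\ r0 = updz (a aRS) k (v' vr) (k + 1 - 1)) /\
      (forall j, 1 <= j < k + 1 -> 1 <= updz (a aRS) k (v' vr) j <= j /\
        Y (updz (a aRS) k (v' vr) j) = Y j /\
       forall i, 1 <= i <= n -> Y i = Y j -> updz (a aRS) k (v' vr) j <= i) /\
      (forall r, 0 < f r <-> exists i, 1 <= i < k + 1 /\ updz (a aRS) k (v' vr) i = r /\
        i - r = s)).
    { intros f y r0 F1 F2 F3. splits; auto; try lia.
      intros _; replace (k + 1 - 1) with k by lia; rewrite updz_same; split; congruence. }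
    wp1; rewrite E1, E2 in *.
    - wp1. split; [|lia]. apply Fin; ev; rewrite ?EY, ?E1; auto.
      intros r; intuition lia.
    - wp1; rewrite E1, E2 in *.
      + wp1. split; [|lia]. apply Fin; ev; rewrite ?EY, ?E1; auto.
        intros r; intuition lia.
      + wp1; try lia. split; [|lia]. apply Fin; ev; rewrite ?EY, ?E1; auto.
        intros r; unfold updz; destruct (Z.eqb_spec r (v' vr)); subst; intuition lia. }
  intros v a o t (Sv & Sa & _) Hb _ _ (I1 & I2 & I3 & I4) Ht; cbn [time] in Ht; ev_in Ht.
  cbn [arr] in Sa.
  assert (EY : a aY = Y) by (apply Sa; reflexivity).
  split; [split|lia]; cbn [arr]; rewrite EY.
  - intros j Hj; apply I3; lia.
  - intros j Hj; rewrite I4; split; intros (i & Hi & Ei & Di); exists i.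
    + splits; try lia. destruct (I3 i ltac:(lia)) as (_ & <- & _), (I3 j ltac:(lia)) as (_ & <- &
      _).
      congruence.
    + destruct (I3 i ltac:(lia)) as (K1 & K2 & K3), (I3 j ltac:(lia)) as (J1 & J2 & J3).
      assert (a aRS i = a aRS j).
      { apply Z.le_antisymm; [apply K3|apply J3]; congruence || lia. }
      splits; lia.
Qed.

(** [vq] is the square of [vS + 1], updated by adding odd numbers in place of a multiplication. *)
Definition isqrt : stmt :=
  vS ::= #0 ;; vq ::= #1 ;;
  While vq vM (
    vS ::= vS +! #1 ;;
    vq ::= vq +! vS +! vS +! #1) ;;
  vB ::= vS +! #1.

Lemma isqrt_spec n L V st (Q : state -> Prop) :
  0 <= n -> 4 * n + 8 <= V -> var st vM = n + 1 ->
  (forall st', same isqrt st st' -> bounded V st' ->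
     var st' vS = Z.sqrt n -> var st' vB = Z.sqrt n + 1 ->
     time st' <= time st + 40 * n + 20 -> Q st') ->
  wp L V isqrt Q st.
Proof.
  intros Hn HV EM HQ.
  cut (wp L V isqrt (fun st' => var st' vS = Z.sqrt n /\ var st' vB = Z.sqrt n + 1 /\
         time st' <= time st + 40 * n + 20) st).
  { intros W; eapply wp_mono; [exact W|]; intros st' Hb Hs' (H1 & H2 & H3); apply HQ; auto. }
  clear HQ Q.
  destruct st as [v0 a0 o0 t0]; cbn [var arr time] in *.
  unfold isqrt; do 5 wp1.
  apply (wp_while _ _ (fun v a o t => 0 <= v vS /\ v vS * v vS <= n /\
    v vq = (v vS + 1) * (v vS + 1) /\ t <= t0 + 4 + 40 * v vS) (fun v a => n - v vS)); ev.
  { splits; lia. }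
  intros v a o t (Sv & _) Hb (H1 & H2 & H3 & H4).
  assert (EM' : v vM = n + 1) by (rewrite Sv by reflexivity; ev; auto).
  clear Sv; split; [exact I|split; [exact I|split]]; rewrite EM'; intros C.
  - assert (v vS <= n) by nia. split; [lia|]. wp1; wp1. wp1.
    splits; try lia; rewrite ?H3; nia.
  - assert (v vS <= n) by nia. wp1; ev.
    assert (E : Z.sqrt n = v vS) by (apply Z.sqrt_unique; lia).
    rewrite E; splits; lia.
Qed.

Definition prepare : stmt :=
  vN ::= aIN @@ #0 ;; vM ::= vN +! #1 ;;
  isqrt ;;
  vk ::= #1 ;;
  For vk vM (
    Store aKB vk (aIN @@ (vk +! vk -! #1)) ;;
    Store aKA vk (aIN @@ (vk +! vk))) ;;
  sort ;;
  vk ::= #1 ;;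
  For vk vM (
    vp ::= aPO @@ vk ;;
    Store aX vk (aKB @@ vp) ;;
    Store aY vk (aKA @@ vp)) ;;
  vk ::= #1 ;;
  For vk vM (
    Store aKA vk (aX @@ vk) ;;
    Store aKB vk (aY @@ vk)) ;;
  sort ;; columns ;; rows.

(** Points are indexed from [1] in the order of increasing [(y, x)]; [aPO] enumerates
    these indices in the order of increasing [(x, y)].  [aC] names columns, [aRS] gives
    the first point of the row of a point, and [aHR] marks the first points of heavy rows. *)
Record prepared (P : list (Z * Z)) (n s : Z) (a : nat -> Z -> Z) : Prop := {
  prep_sorted : forall i j, 1 <= i -> i < j -> j <= n -> klt (a aY) (a aX) i j;
  prep_points : forall x y, In (x, y) P <-> exists j, 1 <= j <= n /\ a aX j = x /\ a aY j = y;
  prep_perm : sorted_perm (a aX) (a aY) n (a aPO);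
  prep_columns : columns_ok n a;
  prep_rows : rows_ok n s a
}.

Lemma input_mem_point P i x y :
  nth_error P i = Some (x, y) ->
  input_mem P (2 * Z.of_nat i + 1) = x /\ input_mem P (2 * Z.of_nat i + 2) = y.
Proof.
  intros H; unfold input_mem; split.
  - destruct (Z.eqb_spec (2 * Z.of_nat i + 1) 0); [lia|].
    destruct (Z.ltb_spec (2 * Z.of_nat i + 1) 1); [lia|].
    replace (Z.to_nat (2 * Z.of_nat i + 1 - 1)) with (2 * i)%nat by lia.
    replace (Nat.div (2 * i) 2) with i by (symmetry; rewrite Nat.mul_comm; apply Nat.div_mul;
      lia).
    rewrite H, Nat.even_even; reflexivity.
  - destruct (Z.eqb_spec (2 * Z.of_nat i + 2) 0); [lia|].
    destruct (Z.ltb_spec (2 * Z.of_nat i + 2) 1); [lia|].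
    replace (Z.to_nat (2 * Z.of_nat i + 2 - 1)) with (1 + i * 2)%nat by lia.
    rewrite Nat.div_add by lia; cbn [Nat.div Nat.divmod fst Nat.sub Nat.add].
    change (1 / 2)%nat with O; cbn [Nat.add]; rewrite H.
    replace (S (i * 2)) with (2 * i + 1)%nat by lia; rewrite Nat.even_odd; reflexivity.
Qed.

Lemma sorted_perm_ext K1 K2 K1' K2' n p :
  sorted_perm K1 K2 n p ->
  (forall i, 1 <= i <= n -> K1 i = K1' i /\ K2 i = K2' i) -> sorted_perm K1' K2' n p.
Proof.
  intros (H1 & H2 & H3) E; unfold sorted_perm; splits; auto.
  intros k k' Hk Hk' Hn; unfold klt.
  destruct (E (p k)) as [<- <-]; [apply H1; lia|].
  destruct (E (p k')) as [<- <-]; [apply H1; lia|]. apply H2; auto.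
Qed.

(** The two sorts account for [1000 * ((n + 1) * (s + 1))] each; everything else is linear in
    [n]. *)
Lemma prepare_spec P L V (Q : state -> Prop) :
  let n := Z.of_nat (length P) in
  let s := Z.sqrt n in
  NoDup P -> L = 2 * n + 2 -> 4 * n + 8 <= V ->
  (forall st', same prepare (init_state P) st' -> bounded V st' ->
     var st' vM = n + 1 -> var st' vS = s -> prepared P n s (arr st') ->
     time st' <= 4000 * ((n + 1) * (s + 1)) -> Q st') ->
  wp L V prepare Q (init_state P).
Proof.
  intros n s Hnd HL HV HQ.
  cut (wp L V prepare (fun st' => var st' vM = n + 1 /\ var st' vS = s /\
    prepared P n s (arr st') /\ time st' <= 4000 * ((n + 1) * (s + 1))) (init_state P)).
  { intros W; eapply wp_mono; [exact W|].
    intros st' Hb Hs' (H1 & H2 & H3 & H4); apply HQ; auto. }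
  clear HQ Q.
  assert (Hn : 0 <= n) by (unfold n; lia).
  assert (Hs2 : s * s <= n < (s + 1) * (s + 1)) by exact (Z.sqrt_spec n Hn).
  pose proof (Z.sqrt_nonneg n) as Hs0; fold s in Hs0.
  unfold prepare, init_state; wp1; wp1; [change (Z.abs n <= V); lia|].
  change (input_mem P 0) with n; wp1; wp1.
  assert (Hsn : s <= n) by nia.
  set (a0 := fun (a : nat) (i : Z) => if Nat.eqb a 0 then input_mem P i else 0).
  assert (Ha0 : forall a, a <> aIN -> a0 a = fun _ => 0).
  { intros a Ha; unfold a0; destruct (Nat.eqb_spec a 0); [lia|reflexivity]. }
  assert (Hin : a0 aIN = input_mem P) by reflexivity.
  clearbody a0.
  wp1. eapply (isqrt_spec n); ev; auto.
  intros [v1 a1 o1 t1] (Sv & Sa & _) Hb1 ES EB Ht1; cbn [var arr time] in *; ev_in Ht1.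
  fold s in ES, EB.
  assert (EM : v1 vM = n + 1) by (rewrite Sv by reflexivity; reflexivity).
  assert (Ea1 : forall a, a1 a = a0 a) by (intros; apply Sa; reflexivity); clear Sv Sa.
  pose (pt := fun i => nth (Z.to_nat (i - 1)) P (0, 0)).
  assert (Hpt : forall i, 1 <= i <= n -> nth_error P (Z.to_nat (i - 1)) = Some (pt i)).
  { intros i Hi; apply nth_error_nth'; unfold n in Hi; lia. }
  assert (Hinp : forall i, 1 <= i <= n ->
     input_mem P (2 * i - 1) = fst (pt i) /\ input_mem P (2 * i) = snd (pt i)).
  { intros i Hi; specialize (Hpt i Hi); destruct (pt i) as [x y].
    apply input_mem_point in Hpt as [E1 E2].
    replace (2 * Z.of_nat (Z.to_nat (i - 1)) + 1) with (2 * i - 1) in E1 by lia.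
    replace (2 * Z.of_nat (Z.to_nat (i - 1)) + 2) with (2 * i) in E2 by lia; auto. }
  (* [NoDup P] is what makes the lexicographic order total on indices, as the sort requires. *)
  assert (Hptinj : forall i j, 1 <= i <= n -> 1 <= j <= n -> pt i = pt j -> i = j).
  { intros i j Hi Hj E.
    assert (Z.to_nat (i - 1) = Z.to_nat (j - 1)); [|lia].
    apply (proj1 (NoDup_nth P (0, 0)) Hnd); auto; unfold n in *; lia. }
  assert (HptIn : forall x y, In (x, y) P <-> exists i, 1 <= i <= n /\ pt i = (x, y)).
  { intros x y; split.
    - intros H; apply (In_nth _ _ (0, 0)) in H as (k & Hk & E).
      exists (Z.of_nat k + 1); split; [unfold n; lia|].
      unfold pt; replace (Z.to_nat (Z.of_nat k + 1 - 1)) with k by lia; exact E.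
    - intros (i & Hi & E); apply Hpt in Hi; rewrite E in Hi; eapply nth_error_In; eauto. }
  clear Hpt; clearbody pt.
  do 3 wp1.
  eapply (wp_for _ _ (fun k v a o => forall i, 1 <= i < k ->
     a aKB i = fst (pt i) /\ a aKA i = snd (pt i)) 40 _ _ _ _ _ (n + 1));
    ev; auto; try reflexivity; try lia.
  { intros k v a o t (Sv & Sa & _) Hb Hk Ek Eh I1; cbn [var arr] in Sv, Sa.
    assert (EI : a aIN = input_mem P) by (rewrite Sa, Ea1, Hin by reflexivity; auto).
    destruct (Hinp k) as [E1 E2]; [lia|].
    wp1; wp1; [apply (proj2 Hb aIN)|]. wp1; [apply (proj2 Hb aIN)|].
    rewrite Ek, EI. replace (k + k - 1) with (2 * k - 1) by lia.
    replace (k + k) with (2 * k) by lia. rewrite E1, E2; split; [|lia].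
    intros i Hi; destruct (Z.eq_dec i k) as [->|];
      [rewrite !updz_same|rewrite !updz_other by auto];
      auto; apply I1; lia. }
  intros v2 a2 o2 t2 (Sv & Sa & _) Hb2 _ EM2 I2 Ht2; cbn [var arr time] in *; ev_in Ht2.
  assert (ES2 : v2 vS = s) by (rewrite Sv by reflexivity; auto).
  assert (EB2 : v2 vB = s + 1) by (rewrite Sv by reflexivity; auto).
  assert (Ea2 : forall a, a <> aKA -> a <> aKB -> a2 a = a0 a).
  { intros a N1 N2; rewrite <- Ea1; apply Sa; unfold For; cbn [moda].
    rewrite (proj2 (Nat.eqb_neq a aKB)), (proj2 (Nat.eqb_neq a aKA)) by auto; reflexivity. }
  clear Sv Sa.
  wp1; eapply (sort_spec n s); ev; auto; try lia.
  { split; intros i Hi; rewrite Ea2, Ha0 by discriminate; lia. }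
  { intros i j Hi Hj Hne.
    destruct (I2 i) as [E1 E2]; [lia|]; destruct (I2 j) as [E3 E4]; [lia|].
    unfold klt; rewrite E1, E2, E3, E4.
    destruct (Z.eq_dec (snd (pt i)) (snd (pt j))), (Z.eq_dec (fst (pt i)) (fst (pt j))); try lia.
    exfalso; apply Hne, Hptinj; auto; destruct (pt i), (pt j); cbn in *; congruence. }
  intros [v3 a3 o3 t3] (Sv & Sa & _) Hb3 Hperm Hblk3 Ht3; cbn [var arr time] in *.
  assert (ES3 : v3 vS = s) by (rewrite Sv by reflexivity; auto).
  assert (EM3 : v3 vM = n + 1) by (rewrite Sv by reflexivity; auto).
  assert (EB3 : v3 vB = s + 1) by (rewrite Sv by reflexivity; auto).
  assert (EA3 : a3 aKA = a2 aKA) by (apply Sa; reflexivity).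
  assert (EB3' : a3 aKB = a2 aKB) by (apply Sa; reflexivity).
  assert (EH3 : a3 aHR = fun _ => 0) by (rewrite Sa, Ea2, Ha0 by (reflexivity || discriminate);
    auto).
  clear Sv Sa.
  assert (I3 : forall i, 1 <= i <= n -> a3 aKB i = fst (pt i) /\ a3 aKA i = snd (pt i)).
  { intros i Hi; rewrite EA3, EB3'; apply I2; lia. }
  rewrite <- EA3, <- EB3' in Hperm; clear EA3 EB3' I2.
  destruct Hperm as (P1 & P2 & P3).
  do 3 wp1.
  eapply (wp_for _ _ (fun k v a o => forall i, 1 <= i < k ->
     a aX i = a aKB (a aPO i) /\ a aY i = a aKA (a aPO i)) 40 _ _ _ _ _ (n + 1));
    ev; auto; try reflexivity; try lia.
  { intros k v a o t (Sv & Sa & _) Hb Hk Ek Eh I1; cbn [var arr] in Sv, Sa.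
    assert (EP : a aPO = a3 aPO) by (apply Sa; reflexivity).
    assert (Hp : 1 <= a aPO k <= n) by (rewrite EP; apply P1; lia).
    wp1; wp1; try apply (proj2 Hb aPO). wp1; wp1; rewrite ?Ek; try lia; try apply (proj2 Hb aKB).
    wp1; rewrite ?Ek; try lia; try apply (proj2 Hb aKA).
    split; [|lia].
    intros i Hi; destruct (Z.eq_dec i k) as [->|];
      [rewrite !updz_same|rewrite !updz_other by auto];
      auto; apply I1; lia. }
  intros v4 a4 o4 t4 (Sv & Sa & _) Hb4 _ EM4 I4 Ht4; cbn [var arr time] in *; ev_in Ht4.
  assert (ES4 : v4 vS = s) by (rewrite Sv by reflexivity; auto).
  assert (EB4 : v4 vB = s + 1) by (rewrite Sv by reflexivity; auto).
  assert (EP4 : a4 aPO = a3 aPO) by (apply Sa; reflexivity).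
  assert (EA4 : a4 aKA = a3 aKA) by (apply Sa; reflexivity).
  assert (EB4' : a4 aKB = a3 aKB) by (apply Sa; reflexivity).
  assert (EA0 : a4 aA0 = a3 aA0) by (apply Sa; reflexivity).
  assert (EA1 : a4 aA1 = a3 aA1) by (apply Sa; reflexivity).
  assert (EH4 : a4 aHR = fun _ => 0) by (rewrite Sa by reflexivity; auto).
  clear Sv Sa.
  assert (Hblk4 : blocks_ok n L a4).
  { unfold blocks_ok; rewrite EA0, EA1; exact Hblk3. }
  assert (HXY : forall j, 1 <= j <= n -> a4 aX j = fst (pt (a3 aPO j)) /\
    a4 aY j = snd (pt (a3 aPO j))).
  { intros j Hj; destruct (I4 j) as [-> ->]; [lia|]; rewrite EP4, EA4, EB4'.
    apply I3, P1; auto. }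
  assert (Hsort : forall i j, 1 <= i -> i < j -> j <= n -> klt (a4 aY) (a4 aX) i j).
  { intros i j Hi Hij Hj; specialize (P2 i j Hi Hij Hj); unfold klt in *.
    destruct (HXY i) as [-> ->]; [lia|]; destruct (HXY j) as [-> ->]; [lia|].
    destruct (I3 (a3 aPO i)) as [E1 E2]; [apply P1; lia|].
    destruct (I3 (a3 aPO j)) as [E3 E4]; [apply P1; lia|]. lia. }
  assert (Hpoints : forall x y, In (x, y) P <-> exists j, 1 <= j <= n /\ a4 aX j = x /\
    a4 aY j = y).
  { intros x y; rewrite HptIn; split.
    - intros (i & Hi & E); destruct (P3 i Hi) as (j & Hj & Ej); exists j.
      destruct (HXY j Hj) as [-> ->]; rewrite Ej, E; auto.
    - intros (j & Hj & E1 & E2); exists (a3 aPO j); destruct (HXY j Hj) as [F1 F2].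
      split; [apply P1; auto|]; destruct (pt (a3 aPO j)); cbn in *; congruence. }
  clear HXY I4 I3 P1 P2 P3 EP4 EA4 EB4' EA0 EA1 Hblk3 HptIn Hptinj Hinp.
  do 3 wp1.
  eapply (wp_for _ _ (fun k v a o => forall i, 1 <= i < k ->
     a aKA i = a aX i /\ a aKB i = a aY i) 40 _ _ _ _ _ (n + 1));
    ev; auto; try reflexivity; try lia.
  { intros k v a o t (Sv & Sa & _) Hb Hk Ek Eh I1; cbn [var arr] in Sv, Sa.
    wp1; wp1; rewrite ?Ek; try apply (proj2 Hb aX).
    wp1; rewrite ?Ek; try apply (proj2 Hb aY).
    split; [|lia].
    intros i Hi; destruct (Z.eq_dec i k) as [->|];
      [rewrite !updz_same|rewrite !updz_other by auto];
      auto; apply I1; lia. }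
  intros v5 a5 o5 t5 (Sv & Sa & _) Hb5 _ EM5 I5 Ht5; cbn [var arr time] in *; ev_in Ht5.
  assert (ES5 : v5 vS = s) by (rewrite Sv by reflexivity; auto).
  assert (EB5 : v5 vB = s + 1) by (rewrite Sv by reflexivity; auto).
  assert (EX5 : a5 aX = a4 aX) by (apply Sa; reflexivity).
  assert (EY5 : a5 aY = a4 aY) by (apply Sa; reflexivity).
  assert (Hblk5 : blocks_ok n L a5).
  { unfold blocks_ok; rewrite !Sa by reflexivity; exact Hblk4. }
  assert (EH5 : a5 aHR = fun _ => 0) by (rewrite Sa by reflexivity; auto).
  clear Sv Sa.
  rewrite <- EX5 in Hsort, Hpoints; rewrite <- EY5 in Hsort, Hpoints.
  wp1; eapply (sort_spec n s); ev; auto; try lia.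
  { intros i j Hi Hj Hne; unfold klt.
    destruct (I5 i) as [-> ->]; [lia|]; destruct (I5 j) as [-> ->]; [lia|].
    destruct (Z_lt_le_dec i j).
    - specialize (Hsort i j); unfold klt in Hsort; lia.
    - specialize (Hsort j i); unfold klt in Hsort; lia. }
  intros [v6 a6 o6 t6] (Sv & Sa & _) Hb6 Hperm _ Ht6; cbn [var arr time] in *.
  assert (ES6 : v6 vS = s) by (rewrite Sv by reflexivity; auto).
  assert (EM6 : v6 vM = n + 1) by (rewrite Sv by reflexivity; auto).
  assert (EX6 : a6 aX = a5 aX) by (apply Sa; reflexivity).
  assert (EY6 : a6 aY = a5 aY) by (apply Sa; reflexivity).
  assert (EH6 : a6 aHR = fun _ => 0) by (rewrite Sa by reflexivity; auto).
  clear Sv Sa.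
  assert (Hperm6 : sorted_perm (a6 aX) (a6 aY) n (a6 aPO)).
  { eapply sorted_perm_ext; [exact Hperm|].
    rewrite EX6, EY6; intros i Hi; apply I5; lia. }
  rewrite <- EX6 in Hsort, Hpoints; rewrite <- EY6 in Hsort, Hpoints.
  clear Hperm I5.
  wp1; eapply (columns_spec n); ev; auto.
  intros [v7 a7 o7 t7] (Sv & Sa & _) Hb7 Hcol Ht7; cbn [var arr time] in *.
  assert (ES7 : v7 vS = s) by (rewrite Sv by reflexivity; auto).
  assert (EM7 : v7 vM = n + 1) by (rewrite Sv by reflexivity; auto).
  assert (EX7 : a7 aX = a6 aX) by (apply Sa; reflexivity).
  assert (EY7 : a7 aY = a6 aY) by (apply Sa; reflexivity).
  assert (EP7 : a7 aPO = a6 aPO) by (apply Sa; reflexivity).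
  assert (EH7 : a7 aHR = fun _ => 0) by (rewrite Sa by reflexivity; auto).
  clear Sv Sa.
  rewrite <- EX7 in Hsort, Hpoints, Hperm6; rewrite <- EY7 in Hsort, Hpoints, Hperm6.
  rewrite <- EP7 in Hperm6.
  eapply (rows_spec n s); ev; auto; try lia.
  { rewrite EH7; reflexivity. }
  intros [v8 a8 o8 t8] (Sv & Sa & _) Hb8 Hrows Ht8; cbn [var arr time] in *.
  rewrite !Sv by reflexivity.
  assert (EX8 : a8 aX = a7 aX) by (apply Sa; reflexivity).
  assert (EY8 : a8 aY = a7 aY) by (apply Sa; reflexivity).
  assert (EP8 : a8 aPO = a7 aPO) by (apply Sa; reflexivity).
  assert (EC8 : a8 aC = a7 aC) by (apply Sa; reflexivity).
  splits; auto.
  - constructor; auto; rewrite ?EX8, ?EY8, ?EP8; auto.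
    unfold columns_ok; rewrite EX8, EC8; exact Hcol.
  - assert (n + 1 <= (n + 1) * (s + 1)) by nia. lia.
Qed.

(** * Squares with a heavy row *)

Definition listed (o : list (Z * Z * Z)) (D : Z * Z * Z -> Prop) : Prop :=
  NoDup o /\ forall s, In s o <-> D s.

Lemma listed_ext o D D' : listed o D -> (forall s, D s <-> D' s) -> listed o D'.
Proof. intros [H1 H2] H; split; auto; intros s; rewrite H2; auto. Qed.

Lemma listed_snoc o D D' s :
  listed o D -> ~ D s -> (forall s', D' s' <-> D s' \/ s' = s) -> listed (o ++ [s]) D'.
Proof.
  intros [H1 H2] Hs H; split.
  - apply NoDup_app; auto.
    + constructor; [intros [] | constructor].
    + intros x Hx [<-|[]]; apply Hs, H2; auto.
  - intros s'; rewrite in_app_iff, H2, H; cbn; intuition.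
Qed.

Section Points.
Variables (P : list (Z * Z)) (n s : Z) (a : nat -> Z -> Z).
Hypothesis HP : prepared P n s a.

(** Having a point with exactly [s] points to its left is the testable form of having more than [s]
    points. *)
Definition heavy_row (y : Z) : Prop :=
  exists i, 1 <= i <= n /\ a aY i = y /\ i - a aRS i = s.

Lemma point_inj i j :
  1 <= i <= n -> 1 <= j <= n -> a aX i = a aX j -> a aY i = a aY j -> i = j.
Proof.
  intros Hi Hj E1 E2; destruct (Z.lt_trichotomy i j) as [H|[H|H]]; auto; exfalso.
  - destruct (prep_sorted _ _ _ _ HP i j); lia.
  - destruct (prep_sorted _ _ _ _ HP j i); lia.
Qed.

Lemma Y_mono i j : 1 <= i -> i <= j -> j <= n -> a aY i <= a aY j.
Proof.
  intros Hi Hij Hj; destruct (Z.eq_dec i j) as [->|]; [lia|].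
  destruct (prep_sorted _ _ _ _ HP i j); lia.
Qed.

Lemma X_mono i j :
  1 <= i -> i < j -> j <= n -> a aY i = a aY j -> a aX i < a aX j.
Proof. intros Hi Hij Hj E; destruct (prep_sorted _ _ _ _ HP i j); lia. Qed.

Lemma RS_spec j : 1 <= j <= n -> 1 <= a aRS j <= j /\ a aY (a aRS j) = a aY j.
Proof. intros Hj; destruct (proj1 (prep_rows _ _ _ _ HP) j Hj) as (H1 & H2 & _); auto. Qed.

Lemma RS_min i j : 1 <= i <= n -> 1 <= j <= n -> a aY i = a aY j -> a aRS j <= i.
Proof. intros Hi Hj E; destruct (proj1 (prep_rows _ _ _ _ HP) j Hj) as (_ & _ & H); auto. Qed.

Lemma RS_eq i j : 1 <= i <= n -> 1 <= j <= n -> a aY i = a aY j -> a aRS i = a aRS j.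
Proof.
  intros Hi Hj E; destruct (RS_spec i Hi), (RS_spec j Hj).
  apply Z.le_antisymm; apply RS_min; lia.
Qed.

(** Ordinates are monotone in the index, so a row is an interval of indices. *)
Lemma row_between i l : 1 <= i <= n -> a aRS i <= l <= i -> a aY l = a aY i.
Proof.
  intros Hi Hl; destruct (RS_spec i Hi) as [H1 H2].
  apply Z.le_antisymm; [|rewrite <- H2]; apply Y_mono; lia.
Qed.

Lemma HR_spec j : 1 <= j <= n -> (0 < a aHR (a aRS j) <-> heavy_row (a aY j)).
Proof. intros Hj; apply (proj2 (prep_rows _ _ _ _ HP) j Hj). Qed.

Lemma C_range j : 1 <= j <= n -> 1 <= a aC j <= n.
Proof. apply (prep_columns _ _ _ _ HP). Qed.

Lemma C_eq i j : 1 <= i <= n -> 1 <= j <= n -> (a aC i = a aC j <-> a aX i = a aX j).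
Proof. intros; apply (proj2 (prep_columns _ _ _ _ HP)); auto. Qed.

Lemma point_In x y : In (x, y) P <-> exists j, 1 <= j <= n /\ a aX j = x /\ a aY j = y.
Proof. apply (prep_points _ _ _ _ HP). Qed.

Lemma coord_bound j :
  1 <= j <= n -> Z.abs (a aX j) <= maxcoord P /\ Z.abs (a aY j) <= maxcoord P.
Proof. intros Hj; apply maxcoord_In, point_In; eauto. Qed.

End Points.

(** Marks are time stamps: [vk] grows from one heavy row to the next, so older marks expire without
    being cleared. *)
Definition mark : stmt :=
  vi ::= #1 ;;
  For vi vM (
    If (aY @@ vi) vu Skip (If vu (aY @@ vi) Skip (Store aMK (aC @@ vi) vk))).

Lemma mark_spec P n s L V a0 k st (Q : state -> Prop) :
  0 <= n -> L = 2 * n + 2 -> 4 * n + 8 <= V -> (forall x, x <> aMK -> arr st x = a0 x) ->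
  prepared P n s a0 ->
  var st vM = n + 1 -> var st vk = k -> 1 <= k <= n -> var st vu = a0 aY k ->
  (forall c, arr st aMK c < k) ->
  (forall st', same mark st st' -> bounded V st' ->
     (forall c, arr st' aMK c <= k) ->
     (forall c, arr st' aMK c = k <->
        exists t, 1 <= t <= n /\ a0 aY t = a0 aY k /\ a0 aC t = c) ->
     time st' <= time st + 60 * n + 20 -> Q st') ->
  wp L V mark Q st.
Proof.
  intros Hn HL HV Hb0 HP EM Ek Hk Eu HM HQ.
  cut (wp L V mark (fun st' => (forall c, arr st' aMK c <= k) /\
     (forall c, arr st' aMK c = k <->
        exists t, 1 <= t <= n /\ a0 aY t = a0 aY k /\ a0 aC t = c) /\
     time st' <= time st + 60 * n + 20) st).
  { intros W; eapply wp_mono; [exact W|]; intros st' Hb Hs' (H1 & H2 & H3); apply HQ; auto. }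
  clear HQ Q.
  destruct st as [v0 b0 o0 t0]; cbn [var arr time] in *.
  unfold mark; do 2 wp1.
  eapply (wp_for _ _ (fun i v a o => (forall c, a aMK c <= k) /\
     (forall c, a aMK c = k <-> exists t, 1 <= t < i /\ a0 aY t = a0 aY k /\ a0 aC t = c))
    50 _ _ _ _ _ (n + 1)); ev; auto; try reflexivity; try lia.
  { split; intros c; specialize (HM c); [lia|split; [lia|intros (t & Ht & _); lia]]. }
  { intros i v a o t (Sv & Sa & _) Hb Hi Ei Eh (I1 & I2); cbn [var arr] in Sv, Sa.
    assert (EY : a aY = a0 aY) by (rewrite Sa by reflexivity; apply Hb0; discriminate).
    assert (EC : a aC = a0 aC) by (rewrite Sa by reflexivity; apply Hb0; discriminate).
    assert (Ek' : v vk = k) by (rewrite Sv by reflexivity; auto).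
    assert (Eu' : v vu = a0 aY k) by (rewrite Sv by reflexivity; auto).
    clear Sv Sa.
    pose proof (C_range _ _ _ _ HP i ltac:(lia)) as HC.
    assert (Hno : a0 aY i <> a0 aY k -> forall c, a aMK c = k <->
      exists t, 1 <= t < i + 1 /\ a0 aY t = a0 aY k /\ a0 aC t = c).
    { intros Hne c; rewrite I2; split; intros (t' & Ht' & E1 & E2); exists t'; splits; auto;
      try lia.
      destruct (Z.eq_dec t' i) as [->|]; [tauto|lia]. }
    wp1; rewrite EY, Ei, Eu' in *.
    - wp1. splits; auto; try lia. apply Hno; lia.
    - wp1; rewrite EY, Ei, Eu' in *.
      + wp1. splits; auto; try lia. apply Hno; lia.
      + wp1; rewrite ?EC, ?Ei, ?Ek'; try lia.
        splits; try lia; intros c; destruct (Z.eq_dec c (a0 aC i)) as [->|].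
        * rewrite updz_same; lia.
        * rewrite updz_other by auto; auto.
        * rewrite updz_same; split; auto; intros _; exists i; splits; auto; lia.
        * rewrite updz_other by auto; rewrite I2; split; intros (t' & Ht' & E1 & E2);
            exists t'; splits; auto; try lia.
          destruct (Z.eq_dec t' i) as [->|]; [congruence|lia]. }
  intros v a o t (Sv & Sa & _) Hb _ _ (I1 & I2) Ht; cbn [time] in Ht; ev_in Ht.
  splits; auto; [|cbn [time]; lia].
  intros c; cbn [arr]; rewrite I2; split; intros (t' & ? & ? & ?); exists t'; splits; auto; lia.
Qed.

(** Within a row the distance is constant, so the abscissa [vq] of the left corner grows with the
    right corner [vi] and the pointer [vlo] never moves back. It jumps to the start of each new row
    and stops at [vi] at the latest, since the distance is nonnegative. *)
Definition scan : stmt :=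
  vlo ::= #1 ;; vi ::= #1 ;;
  For vi vM (
    vd ::= (aY @@ vi) -! vu ;;
    If vd #0 (vd ::= #0 -! vd) Skip ;;
    If vlo (aRS @@ vi) (vlo ::= aRS @@ vi) Skip ;;
    vq ::= (aX @@ vi) -! vd ;;
    While (aX @@ vlo) vq (vlo ::= vlo +! #1) ;;
    If vq (aX @@ vlo) Skip (
    If (aMK @@ (aC @@ vlo)) vk Skip (
    If (aMK @@ (aC @@ vi)) vk Skip (
    If vu (aY @@ vi) (Out vq vu vd) (
    If (aY @@ vi) vu (
      If #0 (aHR @@ (aRS @@ vi)) Skip (Out vq (aY @@ vi) vd))
      Skip))))).

Section Scan.
Variables (P : list (Z * Z)) (n s : Z) (a : nat -> Z -> Z).
Hypothesis HP : prepared P n s a.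

(** The squares found when the right corner [r] of the side opposite to row [y1] is scanned.
    A square with two heavy rows is reported only for its lower one. *)
Definition scanned_at (y1 r : Z) (q : Z * Z * Z) : Prop :=
  let '(x, y, d) := q in
  is_square P q /\ a aX r = x + d /\
  ((y = y1 /\ a aY r = y + d) \/ (~ heavy_row n s a y /\ y + d = y1 /\ a aY r = y)).

Definition scanned (y1 r : Z) (q : Z * Z * Z) : Prop :=
  exists r', 1 <= r' < r /\ scanned_at y1 r' q.

Lemma scanned_succ y1 r q :
  1 <= r -> (scanned y1 (r + 1) q <-> scanned y1 r q \/ scanned_at y1 r q).
Proof.
  intros Hr; split.
  - intros (r' & Hr' & H); destruct (Z.eq_dec r' r) as [->|]; [auto|].
    left; exists r'; split; auto; lia.
  - intros [(r' & Hr' & H)|H]; [exists r'|exists r]; split; auto; lia.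
Qed.

(** A square cannot have both its lower and its upper side on row [y1], so it determines which of
    its right corners is scanned; hence a scan reports it only once. *)
Lemma scanned_at_inj y1 r r' q :
  1 <= r <= n -> 1 <= r' <= n -> heavy_row n s a y1 ->
  scanned_at y1 r q -> scanned_at y1 r' q -> r = r'.
Proof.
  destruct q as [[x y] d]; intros Hr Hr' Hh (Hs & E1 & H1) (_ & E2 & H2).
  apply (point_inj _ _ _ _ HP); auto; [lia|].
  destruct Hs as [Hd _].
  destruct H1 as [[-> H1]|(N1 & H1 & H1')], H2 as [[E H2]|(N2 & H2 & H2')]; subst; tauto || lia.
Qed.

End Scan.

Local Ltac rw EX EY EC EK EH ER F1 F2 F3 F4 F5 F6 El :=
  rewrite ?F1, ?F2, ?F3, ?F4, ?F5, ?F6, ?El, ?EX, ?EY, ?EC, ?EK, ?EH, ?ER in *.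

(** [D] describes the squares reported for earlier heavy rows; that it is disjoint from those found
    now excludes repetitions between scans. *)
Lemma scan_spec P n s L V M a0 k D st (Q : state -> Prop) :
  0 <= n -> L = 2 * n + 2 -> M = maxcoord P -> 4 * M + 4 * n + 8 <= V ->
  (forall x, x <> aMK -> arr st x = a0 x) -> prepared P n s a0 ->
  var st vM = n + 1 -> var st vk = k -> 1 <= k <= n -> var st vu = a0 aY k ->
  k - a0 aRS k = s ->
  (forall c, arr st aMK c <= k) ->
  (forall c, arr st aMK c = k <->
        exists t, 1 <= t <= n /\ a0 aY t = a0 aY k /\ a0 aC t = c) ->
  listed (outp st) D ->
  (forall q r, 1 <= r <= n -> D q -> ~ scanned_at P n s a0 (a0 aY k) r q) ->
  (forall st', same scan st st' -> bounded V st' ->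
     listed (outp st') (fun q => D q \/ scanned P n s a0 (a0 aY k) (n + 1) q) ->
     time st' <= time st + 300 * n + 300 -> Q st') ->
  wp L V scan Q st.
Proof.
  intros Hn HL HM HV Hb0 HP EM Ek Hk Eu Etrig HMK1 HMK2 HD Hdisj HQ.
  cut (wp L V scan (fun st' =>
     listed (outp st') (fun q => D q \/ scanned P n s a0 (a0 aY k) (n + 1) q) /\
     time st' <= time st + 300 * n + 300) st).
  { intros W; eapply wp_mono; [exact W|]; intros st' Hb Hs' (H1 & H2); apply HQ; auto. }
  clear HQ Q.
  destruct st as [v0 b0 o0 t0]; cbn [var arr outp time] in *.
  set (y1 := a0 aY k) in *.
  assert (Hy1 : heavy_row n s a0 y1) by (exists k; auto).
  set (dd := fun r => Z.abs (a0 aY r - y1)).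
  assert (HM0 : 0 <= M) by (subst M; apply maxcoord_nonneg).
  assert (Hcb : forall j, 1 <= j <= n -> Z.abs (a0 aX j) <= M /\ Z.abs (a0 aY j) <= M)
    by (intros j Hj; subst M; eapply coord_bound; eauto).
  unfold scan; do 4 wp1.
  (* The moves of the pointer are paid by the term [20 * v vlo], which never decreases and ends at
     most at [20 * (n + 1)]. *)
  eapply (wp_for_time _ _ (fun r v a o t => 1 <= v vlo <= r /\
    (r <= n -> forall i, 1 <= i < v vlo -> a0 aY i = a0 aY r -> a0 aX i < a0 aX r - dd r) /\
    listed o (fun q => D q \/ scanned P n s a0 y1 r q) /\
    t <= t0 + 200 * r + 20 * v vlo) _ _ _ _ _ (n + 1)); ev; auto; try reflexivity; try lia.
  { splits; try lia. eapply listed_ext; [exact HD|]; intros q; split; auto.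
    intros [|(r' & Hr' & _)]; [auto|lia]. }
  { intros r v a o t (Sv & Sa & _) Hb Hr Er Eh (Hl & Hlow & Hlist & Ht); cbn [var arr] in Sv, Sa.
    assert (EX : a aX = a0 aX) by (rewrite Sa by reflexivity; apply Hb0; discriminate).
    assert (EY : a aY = a0 aY) by (rewrite Sa by reflexivity; apply Hb0; discriminate).
    assert (EC : a aC = a0 aC) by (rewrite Sa by reflexivity; apply Hb0; discriminate).
    assert (ER : a aRS = a0 aRS) by (rewrite Sa by reflexivity; apply Hb0; discriminate).
    assert (EH : a aHR = a0 aHR) by (rewrite Sa by reflexivity; apply Hb0; discriminate).
    assert (EK : a aMK = b0 aMK) by (apply Sa; reflexivity).
    assert (Ek' : v vk = k) by (rewrite Sv by reflexivity; auto).
    assert (Eu' : v vu = y1) by (rewrite Sv by reflexivity; auto).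
    clear Sv Sa.
    pose proof (Hcb r ltac:(lia)) as [HXr HYr]. pose proof (Hcb k ltac:(lia)) as [_ HYk].
    fold y1 in HYk.
    pose proof (RS_spec _ _ _ _ HP r ltac:(lia)) as [HR1 HR2].
    wp1; wp1; rewrite ?EY, ?Er, ?Eu'; try lia.
    wp1. eapply (wp_mono _ _ _ (fun st' => exists v' t', st' = State v' a o t' /\
       v' vlo = v vlo /\ v' vi = r /\ v' vk = k /\ v' vu = y1 /\ v' vM = n + 1 /\
       v' vd = dd r /\ t' <= t + 20)).
    { assert (Edd : dd r = Z.abs (a0 aY r - y1)) by reflexivity.
      wp1.
      - wp1; try lia. eexists _, _; split; [reflexivity|]; ev; splits; auto; lia.
      - wp1; eexists _, _; split; [reflexivity|]; ev; splits; auto; lia. }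
    assert (Hdd : 0 <= dd r <= 2 * M) by (unfold dd; lia).
    intros st1 _ _ (v1 & t1 & -> & F1 & F2 & F3 & F4 & F5 & F6 & Ht1).
    wp1. eapply (wp_mono _ _ _ (fun st' => exists v' t', st' = State v' a o t' /\
       v' vlo = Z.max (v vlo) (a0 aRS r) /\ v' vi = r /\ v' vk = k /\ v' vu = y1 /\
       v' vM = n + 1 /\ v' vd = dd r /\ t' <= t1 + 20)).
    { wp1; rewrite ?ER, ?F1, ?F2 in *.
      - wp1; rewrite ?ER, ?F2; try lia.
        eexists _, _; split; [reflexivity|]; ev; rewrite ?ER, ?F2; splits; auto; lia.
      - wp1; eexists _, _; split; [reflexivity|]; ev; splits; auto; lia. }
    intros st2 _ _ (v2 & t2 & -> & G1 & G2 & G3 & G4 & G5 & G6 & Ht2).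
    clear F1 F2 F3 F4 F5 F6; rename G1 into F1, G2 into F2, G3 into F3, G4 into F4,
      G5 into F5, G6 into F6.
    wp1; wp1; rewrite ?EX, ?F2, ?F6; try lia.
    set (l0 := Z.max (v vlo) (a0 aRS r)) in *.
    set (q := a0 aX r - dd r) in *.
    assert (Hl0 : a0 aRS r <= l0 <= r) by lia.
    assert (Hlow0 : forall i, 1 <= i < l0 -> a0 aY i = a0 aY r -> a0 aX i < q).
    { intros i Hi Ei; apply Hlow; auto; [lia|].
      pose proof (RS_min _ _ _ _ HP i r ltac:(lia) ltac:(lia) Ei); lia. }
    wp1. eapply (wp_mono _ _ _ (fun st' => exists v' a' t', st' = State v' a' o t' /\
       (forall x, a' x = a x) /\
       v' vi = r /\ v' vk = k /\ v' vu = y1 /\ v' vM = n + 1 /\ v' vd = dd r /\ v' vq = q /\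
       l0 <= v' vlo <= r /\ q <= a0 aX (v' vlo) /\
       (forall i, 1 <= i < v' vlo -> a0 aY i = a0 aY r -> a0 aX i < q) /\
       t' <= t2 + 20 + 20 * (v' vlo - l0))).
    { apply (wp_while _ _ (fun v' a' o' t' => l0 <= v' vlo <= r /\ o' = o /\
        (forall i, 1 <= i < v' vlo -> a0 aY i = a0 aY r -> a0 aX i < q) /\
        t' <= t2 + 10 + 20 * (v' vlo - l0)) (fun v' _ => r - v' vlo)); ev.
      { rewrite F1; splits; auto; lia. }
      intros v' a' o' t' (Sv & Sa & _) _ (J1 & J2 & J3 & J4); cbn [var arr] in Sv, Sa.
      assert (EX' : a' aX = a0 aX) by (rewrite Sa by reflexivity; auto).
      assert (Eq' : v' vq = q) by (rewrite Sv by reflexivity; auto).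
      rewrite EX', Eq'.
      split; [split; [exact I|lia]|split; [exact I|split]]; intros C.
      - split; [lia|].
        assert (v' vlo <> r) by (intros E; rewrite E in C; unfold q in C; lia).
        wp1. splits; auto; try lia.
        intros i Hi Ei; destruct (Z.eq_dec i (v' vlo)) as [->|]; [lia|apply J3; auto; lia].
      - subst o'; eexists _, _, _; split; [reflexivity|].
        rewrite !Sv by reflexivity; ev; splits; auto; lia. }
    clear F1 F2 F3 F4 F5 F6.
    intros st3 Hb3 _ (v' & a' & t' & -> & Ea' & F1 & F2 & F3 & F4 & F5 & F6 & Hl1 & Hql & Hlow1 &
      Ht').
    rewrite <- (Ea' aX) in EX; rewrite <- (Ea' aY) in EY; rewrite <- (Ea' aC) in EC.
    rewrite <- (Ea' aRS) in ER; rewrite <- (Ea' aHR) in EH; rewrite <- (Ea' aMK) in EK.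
    clear Ea' Hb.
    remember (v' vlo) as l eqn:El; symmetry in El.
    assert (HYl : a0 aY l = a0 aY r) by (apply (row_between _ _ _ _ HP); lia).
    (* Side and left abscissa are forced by the right corner [r], so there is at most one candidate
       for each [r]. *)
    assert (Hat : forall x y d, scanned_at P n s a0 y1 r (x, y, d) ->
       0 < d /\ d = dd r /\ x = q /\ In (q, a0 aY r) P /\ In (q, y1) P /\ In (a0 aX r, y1) P).
    { intros x y d ((Hd & S1 & S2 & S3 & S4) & E1 & [[E2 E3]|(_ & E2 & E3)]).
      - assert (d = dd r) by (unfold dd; lia). assert (x = q) by (unfold q; lia).
        subst; rewrite E1, E3; splits; auto; lia.
      - assert (d = dd r) by (unfold dd; lia). assert (x = q) by (unfold q; lia).
        rewrite E2 in S3, S4. subst; rewrite E1; splits; auto; lia. }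
    (* All branches of the tests end here. If the next point is in the same row, the distance is
       unchanged and its abscissa larger, so the points passed by the pointer stay passed; otherwise
       none of them lies in its row. *)
    assert (Fin : forall o3 t3, t3 <= t' + 100 ->
      listed o3 (fun p => D p \/ scanned P n s a0 y1 (r + 1) p) ->
      1 <= l <= r + 1 /\
      (r + 1 <= n -> forall i, 1 <= i < l -> a0 aY i = a0 aY (r + 1) ->
         a0 aX i < a0 aX (r + 1) - dd (r + 1)) /\
      listed o3 (fun p => D p \/ scanned P n s a0 y1 (r + 1) p) /\
      t3 + 6 <= t0 + 200 * (r + 1) + 20 * l).
    { intros o3 t3 Ht3 Hl3; splits; auto; try lia.
      intros Hrn i Hi Ei. pose proof (Y_mono _ _ _ _ HP i r ltac:(lia) ltac:(lia) ltac:(lia)).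
      pose proof (Y_mono _ _ _ _ HP r (r + 1) ltac:(lia) ltac:(lia) ltac:(lia)).
      assert (Er1 : a0 aY (r + 1) = a0 aY r) by lia.
      pose proof (X_mono _ _ _ _ HP r (r + 1) ltac:(lia) ltac:(lia) ltac:(lia) ltac:(lia)).
      specialize (Hlow1 i Hi ltac:(lia)); unfold q, dd in *; rewrite Er1; lia. }
    assert (None : (forall p, ~ scanned_at P n s a0 y1 r p) ->
      listed o (fun p => D p \/ scanned P n s a0 y1 (r + 1) p)).
    { intros H; eapply listed_ext; [exact Hlist|]; intros p.
      rewrite (scanned_succ P n s a0 y1 r p) by lia; specialize (H p); tauto. }
    assert (Some : forall p, (forall p', scanned_at P n s a0 y1 r p' <-> p' = p) ->
      listed (o ++ [p]) (fun p => D p \/ scanned P n s a0 y1 (r + 1) p)).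
    { intros p H; assert (Hp : scanned_at P n s a0 y1 r p) by (apply H; auto).
      eapply listed_snoc; [exact Hlist| |].
      - intros [HDp|(r' & Hr' & Hp')]; [exact (Hdisj p r ltac:(lia) HDp Hp)|].
        assert (r = r'); [|lia].
        eapply (scanned_at_inj P n s a0 HP); eauto; lia.
      - intros p'; rewrite (scanned_succ P n s a0 y1 r p') by lia; rewrite H; tauto. }
    assert (Hnone : ~ (In (q, a0 aY r) P /\ In (q, y1) P /\ In (a0 aX r, y1) P) ->
      forall p, ~ scanned_at P n s a0 y1 r p).
    { intros H [[x y] d] Hp; apply Hat in Hp; tauto. }
    assert (HMK3 : forall j, 1 <= j <= n -> In (a0 aX j, y1) P -> b0 aMK (a0 aC j) = k).
    { intros j Hj Hin; apply HMK2.
      apply (point_In _ _ _ _ HP) in Hin as (t4 & Ht4 & E1 & E2).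
      exists t4; splits; auto; try lia. apply (C_eq _ _ _ _ HP); auto. }
    assert (HMK4 : forall j, 1 <= j <= n -> k <= b0 aMK (a0 aC j) -> In (a0 aX j, y1) P).
    { intros j Hj Hge; specialize (HMK1 (a0 aC j)).
      destruct (proj1 (HMK2 (a0 aC j)) ltac:(lia)) as (t4 & Ht4 & E1 & E2).
      apply (point_In _ _ _ _ HP); exists t4; splits; auto; try lia.
      apply (C_eq _ _ _ _ HP); auto. }
    pose proof (C_range _ _ _ _ HP l ltac:(lia)) as HCl.
    pose proof (C_range _ _ _ _ HP r ltac:(lia)) as HCr.
    assert (Hpr : In (a0 aX r, a0 aY r) P).
    { apply (point_In _ _ _ _ HP); exists r; splits; auto; lia. }
    wp1; rw EX EY EC EK EH ER F1 F2 F3 F4 F5 F6 El; try lia.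
    { wp1; rewrite ?El; apply Fin; [lia|apply None, Hnone].
      intros (Hin & _ & _); apply (point_In _ _ _ _ HP) in Hin as (i & Hi & E1 & E2).
      destruct (Z_lt_le_dec i l) as [|]; [specialize (Hlow1 i); lia|].
      destruct (Z.eq_dec i l) as [->|]; [lia|].
      pose proof (X_mono _ _ _ _ HP l i ltac:(lia) ltac:(lia) ltac:(lia) ltac:(lia)); lia. }
    assert (EXl : a0 aX l = q) by lia.
    assert (Hpl : In (q, a0 aY r) P).
    { apply (point_In _ _ _ _ HP); exists l; splits; auto; lia. }
    wp1; rw EX EY EC EK EH ER F1 F2 F3 F4 F5 F6 El; try (splits; auto; lia).
    { wp1; rewrite ?El; apply Fin; [lia|apply None, Hnone].
      intros (_ & Hin & _); rewrite <- EXl in Hin; apply HMK3 in Hin; lia. }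
    wp1; rw EX EY EC EK EH ER F1 F2 F3 F4 F5 F6 El; try (splits; auto; lia).
    { wp1; rewrite ?El; apply Fin; [lia|apply None, Hnone].
      intros (_ & _ & Hin); apply HMK3 in Hin; lia. }
    assert (Hq1 : In (q, y1) P) by (rewrite <- EXl; apply HMK4; auto; lia).
    assert (Hr1 : In (a0 aX r, y1) P) by (apply HMK4; auto; lia).
    wp1; rw EX EY EC EK EH ER F1 F2 F3 F4 F5 F6 El; try (splits; auto; lia).
    { wp1; rw EX EY EC EK EH ER F1 F2 F3 F4 F5 F6 El; apply Fin; [lia|apply Some].
      assert (E1 : y1 + dd r = a0 aY r) by (unfold dd; lia).
      assert (E2 : q + dd r = a0 aX r) by (unfold q; lia).
      intros [[x y] d]; split.
      - intros Hp; destruct (Hat _ _ _ Hp) as (Hd & -> & -> & _).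
        destruct Hp as (_ & _ & [[-> _]|(_ & ? & ?)]); [reflexivity|lia].
      - intros [= -> -> ->]; unfold scanned_at, is_square; rewrite E1, E2.
        splits; auto; lia. }
    wp1; rw EX EY EC EK EH ER F1 F2 F3 F4 F5 F6 El; try (splits; auto; lia).
    { wp1; rw EX EY EC EK EH ER F1 F2 F3 F4 F5 F6 El; try (splits; auto; lia).
      - wp1; rewrite ?El; apply Fin; [lia|apply None].
        intros [[x y] d] Hp; destruct (Hat _ _ _ Hp) as (Hd & _).
        destruct Hp as (_ & _ & [[-> ?]|(Hlt & _ & <-)]); [lia|].
        apply Hlt, (HR_spec _ _ _ _ HP r); auto; lia.
      - wp1; rw EX EY EC EK EH ER F1 F2 F3 F4 F5 F6 El; apply Fin; [lia|apply Some].
        assert (E1 : a0 aY r + dd r = y1) by (unfold dd; lia).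
        assert (E2 : q + dd r = a0 aX r) by (unfold q; lia).
        intros [[x y] d]; split.
        + intros Hp; destruct (Hat _ _ _ Hp) as (Hd & -> & -> & _).
          destruct Hp as (_ & _ & [[-> ?]|(_ & _ & ->)]); [lia|reflexivity].
        + intros [= -> -> ->]; unfold scanned_at, is_square; rewrite E1, E2.
          splits; auto; try lia. right; splits; auto.
          intros Hh; apply (HR_spec _ _ _ _ HP r) in Hh; lia. }
    wp1; rewrite ?El; apply Fin; [lia|apply None].
    intros [[x y] d] Hp; destruct (Hat _ _ _ Hp) as (Hd & -> & _).
    unfold dd in Hd; lia. }
  intros v a o t (Sv & Sa & _) Hb _ _ (Hl & _ & Hlist & Ht); cbn [outp time]; split; auto; lia.
Qed.

(** A heavy row is treated exactly once, when the loop reaches its only point of rank s; the index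
    of this point is the stamp of its marks. *)
Definition heavy : stmt :=
  vk ::= #1 ;;
  For vk vM (
    If (vk -! (aRS @@ vk)) vS Skip (
    If vS (vk -! (aRS @@ vk)) Skip (
      vu ::= aY @@ vk ;;
      mark ;;
      scan))).

Definition heavy_upto (P : list (Z * Z)) (n s : Z) (a : nat -> Z -> Z) (k : Z)
    (q : Z * Z * Z) : Prop :=
  let '(x, y, d) := q in
  is_square P q /\ exists k', 1 <= k' < k /\ k' - a aRS k' = s /\
    (a aY k' = y \/ (~ heavy_row n s a y /\ a aY k' = y + d)).

Lemma heavy_spec P n s L V M st (Q : state -> Prop) :
  0 <= n -> 0 <= s -> n < (s + 1) * (s + 1) ->
  L = 2 * n + 2 -> M = maxcoord P -> 4 * M + 4 * n + 8 <= V ->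
  prepared P n s (arr st) -> var st vM = n + 1 -> var st vS = s ->
  (forall c, arr st aMK c = 0) -> outp st = [] ->
  (forall st', same heavy st st' -> bounded V st' ->
     listed (outp st') (fun q => let '(x, y, d) := q in
       is_square P q /\ (heavy_row n s (arr st) y \/ heavy_row n s (arr st) (y + d))) ->
     time st' <= time st + 1000 * ((n + 1) * (s + 1)) -> Q st') ->
  wp L V heavy Q st.
Proof.
  intros Hn Hs Hns HL HM HV HP EM ES HMK Hout HQ.
  cut (wp L V heavy (fun st' =>
     listed (outp st') (fun q => let '(x, y, d) := q in
       is_square P q /\ (heavy_row n s (arr st) y \/ heavy_row n s (arr st) (y + d))) /\
     time st' <= time st + 1000 * ((n + 1) * (s + 1))) st).
  { intros W; eapply wp_mono; [exact W|]; intros st' Hb Hs' (H1 & H2); apply HQ; auto. }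
  clear HQ Q.
  destruct st as [v0 a0 o0 t0]; cbn [var arr outp time] in *.
  assert (HM0 : 0 <= M) by (subst M; apply maxcoord_nonneg).
  unfold heavy; do 2 wp1.
  (* [h] heavy rows have been treated, the last one at index [b]. Each occupies [s + 1] indices up
     to its point of rank [s], and these are disjoint, whence [h * (s + 1) <= b]. A later point
     either starts its row after [b] or has rank above [s]. *)
  eapply (wp_for_time _ _ (fun k v a o t => (forall c, a aMK c < k) /\
    listed o (heavy_upto P n s a0 k) /\
    exists h b, 0 <= h /\ h * (s + 1) <= b /\ 0 <= b < k /\
      (forall i, k <= i <= n -> b < a0 aRS i \/ s < i - a0 aRS i) /\
      t <= t0 + 60 * k + h * (500 * n + 300)) _ _ _ _ _ (n + 1)); ev; auto; try reflexivity;
        try lia.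
  { splits; try (intros; rewrite HMK; lia).
    - rewrite Hout; split; [constructor|]; intros [[x y] d]; cbn; split; [tauto|].
      intros (_ & k' & Hk' & _); lia.
    - exists 0, 0; splits; try lia.
      intros i Hi; left; pose proof (RS_spec _ _ _ _ HP i); lia. }
  { intros k v a o t (Sv & Sa & _) Hb Hk Ek Eh (I1 & I2 & h & b & I3 & I4 & I5 & I6 & I7).
    cbn [var arr] in Sv, Sa.
    assert (Ea : forall x, x <> aMK -> a x = a0 x).
    { intros x Hx; apply Sa; unfold For; cbn [moda mark scan].
      unfold For; cbn [moda]; rewrite (proj2 (Nat.eqb_neq x aMK)) by auto; reflexivity. }
    assert (ER : a aRS = a0 aRS) by (apply Sa; reflexivity).
    assert (EY : a aY = a0 aY) by (apply Sa; reflexivity).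
    assert (ES' : v vS = s) by (rewrite Sv by reflexivity; auto).
    assert (EM' : v vM = n + 1) by (rewrite Sv by reflexivity; auto).
    clear Sv Sa.
    pose proof (RS_spec _ _ _ _ HP k ltac:(lia)) as [HR1 HR2].
    assert (Skipped : k - a0 aRS k <> s -> listed o (heavy_upto P n s a0 (k + 1))).
    { intros Hne; eapply listed_ext; [exact I2|]; intros [[x y] d]; unfold heavy_upto.
      split; intros (Hsq & k' & Hk' & E); split; auto; exists k'; split; auto; try lia.
      destruct (Z.eq_dec k' k) as [->|]; lia. }
    assert (Skipped' : forall t', k - a0 aRS k <> s -> t' <= t + 50 ->
      (forall c, a aMK c < k + 1) /\ listed o (heavy_upto P n s a0 (k + 1)) /\
      exists h b, 0 <= h /\ h * (s + 1) <= b /\ 0 <= b < k + 1 /\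
       (forall i, k + 1 <= i <= n -> b < a0 aRS i \/ s < i - a0 aRS i) /\
       t' + 6 <= t0 + 60 * (k + 1) + h * (500 * n + 300)).
    { intros t' Hne Ht'; splits; auto.
      - intros c; specialize (I1 c); lia.
      - exists h, b; splits; auto; try lia. intros i Hi; apply I6; lia. }
    wp1; rewrite ?ER, ?Ek, ?ES' in *; try (splits; auto; lia).
    { wp1; apply Skipped'; lia. }
    wp1; rewrite ?ER, ?Ek, ?ES' in *; try (splits; auto; lia).
    { wp1; apply Skipped'; lia. }
    assert (Htrig : k - a0 aRS k = s) by lia.
    assert (Hhk : heavy_row n s a0 (a0 aY k)) by (exists k; splits; auto; lia).
    assert (Huniq : forall k', 1 <= k' <= n -> k' - a0 aRS k' = s -> a0 aY k' = a0 aY k ->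
      k' = k).
    { intros k' Hk' Ht' E; pose proof (RS_eq _ _ _ _ HP k' k Hk' ltac:(lia) E); lia. }
    wp1; wp1; rewrite ?Ek, ?EY; try lia.
    { pose proof (coord_bound _ _ _ _ HP k ltac:(lia)); lia. }
    wp1; eapply (mark_spec P n s L V a0 k); ev; auto; try lia.
    intros [v1 a1 o1 t1] (Sv & Sa & So) Hb1 HK1 HK2 Ht1; cbn [var arr outp time] in *.
    specialize (So eq_refl); subst o1.
    assert (Ea1 : forall x, x <> aMK -> a1 x = a0 x).
    { intros x Hx; rewrite <- Ea by auto; apply Sa; unfold mark, For; cbn [moda].
      rewrite (proj2 (Nat.eqb_neq x aMK)) by auto; reflexivity. }
    eapply (scan_spec P n s L V M a0 k (heavy_upto P n s a0 k)); ev; auto; try lia.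
    1-2: rewrite Sv by reflexivity; auto.
    { intros [[x y] d] r Hr (Hsq & k' & Hk' & Ht' & E) (_ & _ & [[-> _]|(Hl & E' & _)]).
      - destruct E as [E|[Hl _]]; [|tauto].
        specialize (Huniq k' ltac:(lia) Ht' E); lia.
      - destruct E as [E|[_ E]].
        + apply Hl; exists k'; splits; auto; lia.
        + specialize (Huniq k' ltac:(lia) Ht' ltac:(lia)); lia. }
    intros [v2 a2 o2 t2] (_ & Sa2 & _) Hb2 Hl2 Ht2; cbn [var arr outp time] in *.
    splits.
    - intros c; rewrite (Sa2 aMK) by reflexivity; specialize (HK1 c); lia.
    - eapply listed_ext; [exact Hl2|]; intros [[x y] d]; unfold heavy_upto, scanned, scanned_at.
      split.
      + intros [(Hsq & k' & Hk' & E)|(r & Hr & Hsq & E1 & E2)]; split; auto.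
        * exists k'; split; auto; lia.
        * exists k; splits; auto; try lia.
          destruct E2 as [[-> _]|(Hl & -> & _)]; auto.
      + intros (Hsq & k' & Hk' & Ht' & E); destruct (Z.eq_dec k' k) as [->|].
        * right; pose proof Hsq as (Hd & S1 & S2 & S3 & S4).
          destruct E as [E|[Hl E]].
          -- apply (point_In _ _ _ _ HP) in S4 as (r & Hr & E1 & E2).
             exists r; splits; auto; lia.
          -- apply (point_In _ _ _ _ HP) in S2 as (r & Hr & E1 & E2).
             exists r; splits; auto; lia.
        * left; split; auto; exists k'; splits; auto; lia.
    - exists (h + 1), k; splits; try lia.
      + destruct (I6 k); lia.
      + intros i Hi; pose proof (RS_spec _ _ _ _ HP i ltac:(lia)) as [HR3 HR4].
        destruct (Z.eq_dec (a0 aY i) (a0 aY k)) as [E|E].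
        * right; rewrite (RS_eq _ _ _ _ HP i k); auto; lia.
        * left. pose proof (Y_mono _ _ _ _ HP k i ltac:(lia) ltac:(lia) ltac:(lia)).
          destruct (Z_lt_le_dec k (a0 aRS i)) as [|C]; auto.
          pose proof (Y_mono _ _ _ _ HP (a0 aRS i) k ltac:(lia) C ltac:(lia)); lia. }
  intros v a o t (Sv & Sa & _) Hb _ _ (_ & Hl & h & b & I3 & I4 & I5 & _ & I7); cbn [outp time].
  split.
  - eapply listed_ext; [exact Hl|]; intros [[x y] d]; unfold heavy_upto; split.
    + intros (Hsq & k' & Hk' & Ht' & E); split; auto; destruct E as [E|[_ E]]; [left|right];
        exists k'; splits; auto; lia.
    + intros (Hsq & E); split; auto.
      (* The lower row contains a point of [P], so its flag in [aHR] decides whether it is heavy. *)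
      assert (Hdec : heavy_row n s a0 y \/ ~ heavy_row n s a0 y).
      { pose proof Hsq as (_ & S1 & _); apply (point_In _ _ _ _ HP) in S1 as (j & Hj & _ & <-).
        rewrite <- (HR_spec _ _ _ _ HP j Hj); lia. }
      destruct Hdec as [(k' & Hk' & E1 & E2)|Hnot].
      * exists k'; splits; auto; lia.
      * destruct E as [E|(k' & Hk' & E1 & E2)]; [tauto|]; exists k'; splits; auto; lia.
  (* From [h * (s + 1) <= b <= n < (s + 1) * (s + 1)]: at most [s] scans of linear cost. *)
  - assert (h < s + 1) by nia.
    assert (h * (500 * n + 300) <= s * (500 * n + 300)) by nia.
    nia.
Qed.

(** * Squares between light rows *)

Section Buckets.
Variables (P : list (Z * Z)) (n s : Z) (a : nat -> Z -> Z).
Hypothesis HP : prepared P n s a.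
Notation X := (a aX).
Notation Y := (a aY).
Notation C := (a aC).
Notation RS := (a aRS).
Notation PO := (a aPO).
Notation light y := (~ heavy_row n s a y).

(** The pairs [(PO k', q')] processed before [(PO k, q)]; those with right point in column
    [g] and left point in column [c] form one bucket, represented by its left points. *)
Definition bucket (k q g c q' : Z) : Prop :=
  C q' = c /\ exists k', 1 <= k' <= n /\ C (PO k') = g /\ RS (PO k') <= q' < PO k' /\
    light (Y (PO k')) /\ (k' < k \/ k' = k /\ q' < q).

(** In a bucket, [cu], [la] and [nx] form a list of increasing ordinates, whose elements
    before [cu] are too low to be the lower left corner of a square with a later pair. *)
Definition chain (B : Z -> Prop) (g cu la : Z) (nx : Z -> Z) : Prop :=
  B cu /\ B la /\ (forall q, B q -> Y q <= Y la) /\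
  (forall q, B q -> Y q < Y la ->
     B (nx q) /\ Y q < Y (nx q) /\ forall q', B q' -> Y q < Y q' -> Y (nx q) <= Y q') /\
  (forall q p, B q -> Y q < Y cu -> 1 <= p <= n -> C p = g -> Y q < Y la - (X p - X q)).

(** [st c] is the right column for which the list of the left column [c] was last restarted, and 0
    if there is none yet; lists of other right columns are forgotten. *)
Definition chains (B : Z -> Z -> Z -> Prop) (st cu la nx : Z -> Z) : Prop :=
  forall c, 1 <= c -> 1 <= st c -> chain (B (st c) c) (st c) (cu c) (la c) nx.

(** [pr] lists the processed pairs and [adv] the list cells left behind by the [cu]
    pointers; comparing their lengths bounds the total time spent on moving them. *)
Definition ghost (B : Z -> Z -> Z -> Prop) (st cu : Z -> Z) (pr adv : list (Z * Z)) : Prop :=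
  NoDup adv /\ (forall g c q, B g c q -> In (g, q) pr) /\
  (forall g q, In (g, q) adv -> B g (C q) q /\ (st (C q) = g -> Y q < Y (cu (C q)))).

Lemma ghost_length B st cu pr adv :
  ghost B st cu pr adv -> (length adv <= length pr)%nat.
Proof.
  intros (H1 & H2 & H3); apply NoDup_incl_length; auto.
  intros [g q] Hin; apply H3 in Hin as [Hin _]; eapply H2; eauto.
Qed.

Lemma chain_ext B B' g cu la nx nx' :
  chain B g cu la nx -> (forall q, B q <-> B' q) -> (forall q, B q -> nx q = nx' q) ->
  chain B' g cu la nx'.
Proof.
  intros (H1 & H2 & H3 & H4 & H5) HB Hnx; unfold chain; splits.
  - apply HB; auto.
  - apply HB; auto.
  - intros q Hq; apply H3, HB; auto.
  - intros q Hq Hlt; apply HB in Hq; rewrite <- Hnx by auto.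
    destruct (H4 q Hq Hlt) as (G1 & G2 & G3); splits; auto; [apply HB; auto|].
    intros q' Hq'; apply G3, HB; auto.
  - intros q p Hq; apply H5, HB; auto.
Qed.

Lemma chains_ext B B' st cu la nx :
  chains B st cu la nx -> (forall g c q, B g c q <-> B' g c q) -> chains B' st cu la nx.
Proof. intros H HB c Hc Hg; eapply chain_ext; eauto. Qed.

Lemma ghost_ext B B' st cu pr adv :
  ghost B st cu pr adv -> (forall g c q, B g c q <-> B' g c q) -> ghost B' st cu pr adv.
Proof.
  intros (H1 & H2 & H3) HB; unfold ghost; splits; auto.
  - intros g c q Hq; eapply H2, HB; eauto.
  - intros g q Hq; rewrite <- HB; auto.
Qed.

Lemma PO_range k : 1 <= k <= n -> 1 <= PO k <= n.
Proof. apply (prep_perm _ _ _ _ HP). Qed.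

Lemma PO_lt k k' : 1 <= k -> k < k' -> k' <= n -> klt X Y (PO k) (PO k').
Proof. apply (prep_perm _ _ _ _ HP). Qed.

Lemma PO_surj i : 1 <= i <= n -> exists k, 1 <= k <= n /\ PO k = i.
Proof. apply (prep_perm _ _ _ _ HP). Qed.

Lemma PO_inj k k' : 1 <= k <= n -> 1 <= k' <= n -> PO k = PO k' -> k = k'.
Proof.
  intros Hk Hk' E; destruct (Z.lt_trichotomy k k') as [H|[H|H]]; auto; exfalso.
  - destruct (PO_lt k k' ltac:(lia) ltac:(lia) ltac:(lia)) as [D|[_ D]]; rewrite E in D; lia.
  - destruct (PO_lt k' k ltac:(lia) ltac:(lia) ltac:(lia)) as [D|[_ D]]; rewrite E in D; lia.
Qed.

(** The inner loop runs from the first point of the row to the right point. This lemma and the next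
    identify its two ends with the states [(k, 0)] and [(k + 1, 0)] of the outer loop. *)
Lemma bucket_first k q g c q' :
  1 <= k <= n -> q <= RS (PO k) -> (bucket k q g c q' <-> bucket k 0 g c q').
Proof.
  intros Hk Hq; unfold bucket; split; intros (E & k' & Hk' & E1 & E2 & E3 & E4); split; auto;
    exists k'; splits; auto; try lia; destruct E4 as [|[-> ?]]; auto; try lia.
  pose proof (RS_spec _ _ _ _ HP (PO k) (PO_range k Hk)); lia.
Qed.

Lemma bucket_last k g c q' : bucket k (PO k) g c q' <-> bucket (k + 1) 0 g c q'.
Proof.
  unfold bucket; split; intros (E & k' & Hk' & E1 & E2 & E3 & E4); split; auto;
    exists k'; splits; auto; try lia.
  pose proof (RS_spec _ _ _ _ HP (PO k') (PO_range k' Hk')).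
  destruct (Z.eq_dec k' k) as [->|]; lia.
Qed.

Lemma bucket_heavy k g c q' :
  heavy_row n s a (Y (PO k)) -> (bucket k 0 g c q' <-> bucket (k + 1) 0 g c q').
Proof.
  intros Hh; unfold bucket; split; intros (E & k' & Hk' & E1 & E2 & E3 & E4); split; auto;
    exists k'; splits; auto; try lia.
  pose proof (RS_spec _ _ _ _ HP (PO k') (PO_range k' Hk')).
  destruct (Z.eq_dec k' k) as [->|]; [tauto|lia].
Qed.

Lemma bucket_row k q g c q' :
  bucket k q g c q' -> exists k', 1 <= k' <= n /\ C (PO k') = g /\ Y q' = Y (PO k') /\
    q' < PO k' /\ light (Y q') /\ 1 <= q' <= n /\ (k' < k \/ k' = k /\ q' < q).
Proof.
  intros (E & k' & Hk' & E1 & E2 & E3 & E4); exists k'.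
  pose proof (PO_range k' Hk') as Hp; pose proof (RS_spec _ _ _ _ HP _ Hp) as [HR1 HR2].
  assert (Y q' = Y (PO k')) as Ey by (apply (row_between _ _ _ _ HP); lia).
  splits; auto; try lia; rewrite Ey; auto.
Qed.

Section Insert.
Variables (k q : Z).
Hypothesis Hk : 1 <= k <= n.
Let p := PO k.
Hypothesis Hlight : light (Y p).
Hypothesis Hq : RS p <= q < p.
Let c := C q.
Let g := C p.
Let d := X p - X q.
Let t := Y q - d.
Let B := bucket k q.
Let B' := bucket k (q + 1).

Lemma right_range : 1 <= p <= n.
Proof. apply PO_range; auto. Qed.

Lemma left_range : 1 <= q <= n.
Proof. pose proof right_range; pose proof (RS_spec _ _ _ _ HP p right_range); lia. Qed.

Lemma same_row : Y q = Y p.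
Proof. pose proof right_range; apply (row_between _ _ _ _ HP); lia. Qed.

Lemma side_pos : 0 < d.
Proof.
  pose proof right_range; pose proof left_range; pose proof same_row.
  pose proof (X_mono _ _ _ _ HP q p); unfold d; lia.
Qed.

Lemma bucket_succ g' c' q' : B' g' c' q' <-> B g' c' q' \/ (g' = g /\ c' = c /\ q' = q).
Proof.
  unfold B', B, bucket; split.
  - intros (E & k' & Hk' & E1 & E2 & E3 & E4).
    destruct (Z.eq_dec k' k) as [->|]; [|left; split; auto; exists k'; splits; auto; lia].
    destruct (Z.eq_dec q' q) as [->|]; [right; subst; auto|].
    left; split; auto; exists k; splits; auto; lia.
  - intros [(E & k' & Hk' & E1 & E2 & E3 & E4)|(-> & -> & ->)]; split; auto.
    + exists k'; splits; auto; lia.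
    + exists k; fold p; splits; auto; lia.
Qed.

(** Right points of one column come by increasing height, and the row of [p] has only one point in
    column [c], namely [q], which is not yet in the bucket. So a list grows at its top. *)
Lemma bucket_below q' : B g c q' -> Y q' < Y q.
Proof.
  intros Hq'; pose proof right_range; pose proof left_range; pose proof same_row.
  pose proof (proj1 Hq') as Ec.
  destruct (bucket_row _ _ _ _ _ Hq') as (k' & Hk' & E1 & E2 & E3 & E4 & E5 & E6).
  assert (Ex : X q' = X q) by (apply (C_eq _ _ _ _ HP); auto).
  destruct E6 as [E6|[-> E6]].
  - rewrite E2, same_row. pose proof (PO_range k' Hk').
    assert (X (PO k') = X p) by (apply (C_eq _ _ _ _ HP); auto).
    destruct (PO_lt k' k ltac:(lia) ltac:(lia) ltac:(lia)) as [D|[_ D]]; fold p in D; lia.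
  - exfalso; assert (q' = q); [|lia].
    apply (point_inj _ _ _ _ HP); auto; rewrite E2, same_row; reflexivity.
Qed.

(** The state while the pointer of the current bucket, now [u], is being advanced. *)
Definition advancing (st cu la nx : Z -> Z) (pr adv : list (Z * Z)) (u : Z) : Prop :=
  st c = g /\ la c = q /\ B' g c u /\
  (forall q', B' g c q' -> Y q' < Y u -> Y q' < t) /\
  (forall q', B' g c q' -> Y q' <= Y q) /\
  (forall q', B' g c q' -> Y q' < Y q ->
     B' g c (nx q') /\ Y q' < Y (nx q') /\
     forall q'', B' g c q'' -> Y q' < Y q'' -> Y (nx q') <= Y q'') /\
  (forall c', c' <> c -> 1 <= c' -> 1 <= st c' ->
     chain (B' (st c') c') (st c') (cu c') (la c') nx) /\
  NoDup adv /\ (forall g' c' q', B' g' c' q' -> In (g', q') pr) /\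
  (forall g' q', In (g', q') adv -> B' g' (C q') q' /\
     (C q' = c -> g' = g -> Y q' < Y u) /\
     (C q' <> c -> st (C q') = g' -> Y q' < Y (cu (C q')))).

Lemma other_chain st cu la nx nx' c' :
  chains B st cu la nx -> (forall q', C q' = c' -> nx q' = nx' q') ->
  c' <> c -> 1 <= c' -> 1 <= st c' -> chain (B' (st c') c') (st c') (cu c') (la c') nx'.
Proof.
  intros HC Hnx Hc1 Hc2 Hg; eapply chain_ext; [apply HC; auto| |].
  - intros q'; rewrite bucket_succ; intuition.
  - intros q' Hq'; apply Hnx, Hq'.
Qed.

Lemma ghost_succ st cu pr adv :
  ghost B st cu pr adv ->
  (forall g' c' q', B' g' c' q' -> In (g', q') ((g, q) :: pr)).
Proof.
  intros (_ & H & _) g' c' q' Hq'; apply bucket_succ in Hq' as [Hq'|(-> & _ & ->)].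
  - right; eauto.
  - left; reflexivity.
Qed.

(** A cell [q'] already passed satisfies [Y q' < Y (la c) - d] by the last clause of [chain]. The
    old last cell lies below [q] and the distance [d] of the two columns has not changed, so [q'] is
    below the new target [t] as well. *)
Lemma advancing_append st cu la nx pr adv :
  chains B st cu la nx -> ghost B st cu pr adv -> 1 <= c -> 1 <= g -> st c = g ->
  advancing st cu (updz la c q) (updz nx (la c) q) ((g, q) :: pr) adv (cu c).
Proof.
  intros HC HG Hc1 Hg1 Eg; pose proof HG as (G1 & G2 & G3).
  pose proof (HC c Hc1) as Hch; rewrite Eg in Hch; destruct (Hch Hg1) as (C1 & C2 & C3 & C4 & C5).
  pose proof (bucket_below _ C2) as Hla; pose proof (bucket_below _ C1) as Hcu.
  pose proof side_pos as Hd.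
  assert (Bq : B' g c q) by (apply bucket_succ; auto).
  assert (Bold : forall q', B g c q' -> B' g c q') by (intros; apply bucket_succ; auto).
  unfold advancing; splits; auto.
  - apply updz_same.
  - intros q' Hq' Hlt; apply bucket_succ in Hq' as [Hq'|(_ & _ & ->)]; [|lia].
    pose proof (C5 q' p Hq' Hlt right_range eq_refl) as H.
    assert (X q' = X q).
    { destruct (bucket_row _ _ _ _ _ Hq') as (k' & _ & _ & _ & _ & _ & Hn & _).
      apply (C_eq _ _ _ _ HP); auto; [apply left_range|apply Hq']. }
    unfold t, d; lia.
  - intros q' Hq'; apply bucket_succ in Hq' as [Hq'|(_ & _ & ->)]; [|lia].
    apply bucket_below in Hq'; lia.
  - intros q' Hq' Hlt; apply bucket_succ in Hq' as [Hq'|(_ & _ & ->)]; [|lia].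
    destruct (Z.eq_dec q' (la c)) as [->|Hne].
    + rewrite updz_same; splits; auto. intros q'' Hq'' Hlt'.
      apply bucket_succ in Hq'' as [Hq''|(_ & _ & ->)]; [|lia].
      apply C3 in Hq''; lia.
    + rewrite updz_other by auto.
      assert (Hlt2 : Y q' < Y (la c)).
      { pose proof (C3 q' Hq'). destruct (Z.eq_dec (Y q') (Y (la c))) as [E|]; [|lia].
        exfalso; apply Hne.
        destruct (bucket_row _ _ _ _ _ Hq') as (? & _ & _ & _ & _ & _ & Hn1 & _).
        destruct (bucket_row _ _ _ _ _ C2) as (? & _ & _ & _ & _ & _ & Hn2 & _).
        apply (point_inj _ _ _ _ HP); auto. apply (C_eq _ _ _ _ HP); auto.
        rewrite (proj1 Hq'), (proj1 C2); reflexivity. }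
      destruct (C4 q' Hq' Hlt2) as (D1 & D2 & D3); splits; auto.
      intros q'' Hq'' Hlt'; apply bucket_succ in Hq'' as [Hq''|(_ & _ & ->)]; [auto|].
      apply bucket_below in D1; lia.
  - intros c' Hne Hc2 Hg2; rewrite (updz_other _ _ _ c') by auto.
    eapply other_chain; eauto. intros q' Eq'; rewrite updz_other; auto.
    intros ->; apply Hne; rewrite <- Eq'; apply C2.
  - eapply ghost_succ; eauto.
  - intros g' q' Hin; destruct (G3 g' q' Hin) as [D1 D2]; splits.
    + apply bucket_succ; auto.
    + intros E ->; rewrite E in D2; auto.
    + intros _; auto.
Qed.

(** Restarting drops a list made for another right column. Cells recorded there in [adv] keep their
    records, since the comparison with the pointer only concerns the current right column, whose
    bucket was empty. *)
Lemma advancing_fresh st cu la nx pr adv :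
  chains B st cu la nx -> ghost B st cu pr adv -> (forall q', ~ B g c q') ->
  advancing (updz st c g) (updz cu c q) (updz la c q) nx ((g, q) :: pr) adv q.
Proof.
  intros HC HG Hempty; pose proof HG as (G1 & G2 & G3).
  assert (Hall : forall q', B' g c q' -> q' = q).
  { intros q' Hq'; apply bucket_succ in Hq' as [Hq'|(_ & _ & ->)]; [|auto].
    exfalso; exact (Hempty _ Hq'). }
  unfold advancing; splits; try apply updz_same; auto.
  - apply bucket_succ; auto.
  - intros q' Hq'; apply Hall in Hq' as ->; lia.
  - intros q' Hq'; apply Hall in Hq' as ->; lia.
  - intros q' Hq'; apply Hall in Hq' as ->; lia.
  - intros c' Hne Hc2; rewrite !updz_other by auto; intros Hg2.
    eapply other_chain; eauto.
  - eapply ghost_succ; eauto.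
  - intros g' q' Hin; destruct (G3 g' q' Hin) as [D1 D2]; splits.
    + apply bucket_succ; auto.
    + intros E ->; rewrite E in D1; exfalso; exact (Hempty _ D1).
    + intros Hne; rewrite !updz_other by auto; auto.
Qed.

(** As [t < Y q], the pointer is not at the last cell, so it has a successor. The recorded cells of
    this list are strictly below the pointer, so [(g, u)] is not recorded twice. *)
Lemma advancing_step st cu la nx pr adv u :
  advancing st cu la nx pr adv u -> Y u < t ->
  advancing st cu la nx pr ((g, u) :: adv) (nx u) /\ Y u < Y (nx u).
Proof.
  intros (A1 & A2 & A3 & A4 & A5 & A6 & A7 & A8 & A9 & A10) Hlt.
  pose proof side_pos as Hd. assert (Huq : Y u < Y q) by (unfold t in *; lia).
  destruct (A6 u A3 Huq) as (D1 & D2 & D3).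
  split; [|auto]; unfold advancing; splits; auto.
  - intros q' Hq' Hlt'; destruct (Z_lt_le_dec (Y u) (Y q')) as [H|H]; [|lia].
    specialize (D3 q' Hq' H); lia.
  - constructor; auto. intros Hin; destruct (A10 _ _ Hin) as (_ & E & _).
    specialize (E (proj1 A3) eq_refl); lia.
  - intros g' q' [[= <- <-]|Hin].
    + splits; auto; [rewrite (proj1 A3); auto|]. intros Hne; elim Hne; apply A3.
    + destruct (A10 g' q' Hin) as (E1 & E2 & E3); splits; auto.
      intros Ec Eg; specialize (E2 Ec Eg); lia.
Qed.

(** All cells below [u] are below [t], and [t] depends on the right point only through its column
    and the height of [q], now the last cell: this is the last clause of [chain]. *)
Lemma advancing_stop st cu la nx pr adv u :
  advancing st cu la nx pr adv u ->
  chains B' st (updz cu c u) la nx /\ ghost B' st (updz cu c u) pr adv.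
Proof.
  intros (A1 & A2 & A3 & A4 & A5 & A6 & A7 & A8 & A9 & A10).
  split.
  - intros c' Hc' Hg'; destruct (Z.eq_dec c' c) as [->|Hne].
    + rewrite updz_same, A1, A2; unfold chain; splits; auto.
      * apply bucket_succ; auto.
      * intros q' p' Hq' Hlt right_range' Ep'; pose proof right_range.
        assert (X p' = X p) by (apply (C_eq _ _ _ _ HP); auto).
        assert (X q' = X q).
        { destruct (bucket_row _ _ _ _ _ Hq') as (? & _ & _ & _ & _ & _ & Hn & _).
          apply (C_eq _ _ _ _ HP); auto; [apply left_range|apply Hq']. }
        specialize (A4 q' Hq' Hlt); unfold t, d in A4; lia.
    + rewrite updz_other by auto; apply A7; auto.
  - unfold ghost; splits; auto.
    intros g' q' Hin; destruct (A10 g' q' Hin) as (E1 & E2 & E3); split; auto.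
    intros Eg; destruct (Z.eq_dec (C q') c) as [E|Hne].
    + rewrite E, updz_same; apply E2; auto. congruence.
    + rewrite updz_other by auto; auto.
Qed.

End Insert.

End Buckets.

(** * The squares reported by the second pass *)

Section Pairs.
Variables (P : list (Z * Z)) (n s : Z) (a : nat -> Z -> Z).
Hypothesis HP : prepared P n s a.
Notation X := (a aX).
Notation Y := (a aY).
Notation C := (a aC).
Notation RS := (a aRS).
Notation PO := (a aPO).

Definition upper_side_upto (k q : Z) (w : Z * Z * Z) : Prop :=
  let '(x, y, d) := w in
  exists k' q', 1 <= k' <= n /\ 1 <= q' <= n /\ X (PO k') = x + d /\ Y (PO k') = y + d /\
    X q' = x /\ Y q' = y + d /\ (k' < k \/ k' = k /\ q' < q).

(** The whole output at this moment: the squares of the first pass, and those whose upper side has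
    been met. Including the former makes it all squares in the end. *)
Definition light_upto (k q : Z) (w : Z * Z * Z) : Prop :=
  let '(x, y, d) := w in
  is_square P w /\
  ((heavy_row n s a y \/ heavy_row n s a (y + d)) \/ upper_side_upto k q w).

Lemma light_upto_first k q w :
  1 <= k <= n -> q <= RS (PO k) -> (light_upto k q w <-> light_upto k 0 w).
Proof.
  destruct w as [[x y] d]; intros Hk Hq; unfold light_upto, upper_side_upto.
  pose proof (PO_range _ _ _ _ HP k Hk) as Hp.
  pose proof (RS_spec _ _ _ _ HP _ Hp).
  split; intros (Hs & [Hh|(k' & q' & H1 & H2 & H3 & H4 & H5 & H6 & H7)]);
    split; auto; right; exists k', q'; splits; auto; try lia.
  destruct H7 as [|[-> H7]]; auto; exfalso.
  pose proof (RS_min _ _ _ _ HP q' (PO k) H2 Hp ltac:(lia)); lia.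
Qed.

Lemma light_upto_last k w : light_upto k (PO k) w <-> light_upto (k + 1) 0 w.
Proof.
  destruct w as [[x y] d]; unfold light_upto, upper_side_upto.
  split; intros (Hs & [Hh|(k' & q' & H1 & H2 & H3 & H4 & H5 & H6 & H7)]);
    split; auto; right; exists k', q'; splits; auto; try lia.
  destruct (Z.eq_dec k' k) as [->|]; [right; split; auto|lia].
  pose proof (PO_range _ _ _ _ HP k H1) as Hp.
  destruct Hs as [Hd _].
  destruct (Z_lt_le_dec q' (PO k)) as [|Hge]; auto; exfalso.
  destruct (Z.eq_dec q' (PO k)) as [->|]; [lia|].
  pose proof (X_mono _ _ _ _ HP (PO k) q'); lia.
Qed.

Lemma light_upto_heavy k w :
  heavy_row n s a (Y (PO k)) -> (light_upto k 0 w <-> light_upto (k + 1) 0 w).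
Proof.
  destruct w as [[x y] d]; intros Hh; unfold light_upto, upper_side_upto.
  split; intros (Hs & [Hh'|(k' & q' & H1 & H2 & H3 & H4 & H5 & H6 & H7)]); split; auto.
  - right; exists k', q'; splits; auto; lia.
  - destruct (Z.eq_dec k' k) as [->|].
    + left; right; rewrite <- H4; auto.
    + right; exists k', q'; splits; auto; lia.
Qed.

Lemma light_upto_end w : light_upto (n + 1) 0 w <-> is_square P w.
Proof.
  destruct w as [[x y] d]; unfold light_upto, upper_side_upto; split; [tauto|].
  intros Hs; split; auto; right.
  pose proof Hs as (Hd & _ & _ & S1 & S2).
  apply (point_In _ _ _ _ HP) in S1 as (q & Hq & E1 & E2).
  apply (point_In _ _ _ _ HP) in S2 as (p & Hp & E3 & E4).
  destruct (PO_surj _ _ _ _ HP p Hp) as (k & Hk & <-).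
  exists k, q; splits; auto; lia.
Qed.

Lemma light_upto_start w :
  light_upto 1 0 w <->
  let '(x, y, d) := w in
  is_square P w /\ (heavy_row n s a y \/ heavy_row n s a (y + d)).
Proof.
  destruct w as [[x y] d]; unfold light_upto, upper_side_upto; split.
  - intros (Hs & [Hh|(k' & q' & H1 & H2 & H3 & H4 & H5 & H6 & H7)]); [auto|lia].
  - tauto.
Qed.

(** Points of equal abscissa are consecutive in [aPO]. So if the column of the next point already
    contains right points, it is the current column, and its lists have not been replaced. *)
Lemma column_next (st : Z -> Z) k :
  1 <= k -> k + 1 <= n ->
  (forall c q, bucket n s a (k + 1) 0 (C (PO k)) c q -> st c = C (PO k)) ->
  forall c q, bucket n s a (k + 1) 0 (C (PO (k + 1))) c q -> st c = C (PO (k + 1)).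
Proof.
  intros Hk Hkn H c q Hq.
  assert (E : C (PO k) = C (PO (k + 1))); [|rewrite <- E in *; eauto].
  destruct Hq as (_ & k' & Hk' & E1 & E2 & E3 & E4).
  pose proof (PO_range _ _ _ _ HP k' Hk') as Hp'.
  pose proof (RS_spec _ _ _ _ HP _ Hp').
  pose proof (PO_range _ _ _ _ HP k ltac:(lia)) as Hp.
  pose proof (PO_range _ _ _ _ HP (k + 1) ltac:(lia)) as Hp1.
  apply (C_eq _ _ _ _ HP); auto. apply (C_eq _ _ _ _ HP) in E1; auto.
  destruct (Z.eq_dec k' k) as [->|]; [auto|].
  destruct (PO_lt _ _ _ _ HP k' k) as [D|[D _]]; try lia;
  destruct (PO_lt _ _ _ _ HP k (k + 1)) as [D'|[D' _]]; lia.
Qed.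

Section Step.
Variables (k q : Z).
Hypothesis Hk : 1 <= k <= n.
Let p := PO k.
Hypothesis Hlight : ~ heavy_row n s a (Y p).
Hypothesis Hq : RS p <= q < p.
Let c := C q.
Let g := C p.
Let d := X p - X q.
Let t := Y q - d.

Local Lemma step_facts :
  1 <= p <= n /\ 1 <= q <= n /\ Y q = Y p /\ 0 < d.
Proof.
  pose proof (PO_range _ _ _ _ HP k Hk). splits; try (unfold p in *; lia).
  - pose proof (left_range _ _ _ _ HP k q Hk Hq); lia.
  - apply (same_row _ _ _ _ HP k q Hk Hq).
  - apply (side_pos _ _ _ _ HP k q Hk Hq).
Qed.

Lemma upper_side_new x y d' :
  0 < d' -> upper_side_upto k (q + 1) (x, y, d') ->
  upper_side_upto k q (x, y, d') \/ (x, y, d') = (X q, t, d).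
Proof.
  destruct step_facts as (F1 & F2 & F3 & F4).
  intros Hd (k' & q' & H1 & H2 & H3 & H4 & H5 & H6 & H7).
  destruct (Z.eq_dec k' k) as [->|]; [destruct (Z.eq_dec q' q) as [->|]|].
  - right; fold p in H3, H4; unfold t, d; f_equal; [f_equal|]; lia.
  - left; exists k, q'; splits; auto; lia.
  - left; exists k', q'; splits; auto; lia.
Qed.

Lemma upper_side_mono w : upper_side_upto k q w -> upper_side_upto k (q + 1) w.
Proof.
  destruct w as [[x y] d']; intros (k' & q' & H).
  exists k', q'; intuition lia.
Qed.

(** The cell [u] at height [t] and its right point form the lower side. Both rows are light, so the
    first pass did not report the square, and its upper corners determine [k] and [q], so the second
    did not either. *)
Lemma light_upto_out u :
  bucket n s a k (q + 1) g c u -> Y u = t ->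
  ~ light_upto k q (X q, t, d) /\
  forall w, light_upto k (q + 1) w <-> light_upto k q w \/ w = (X q, t, d).
Proof.
  destruct step_facts as (F1 & F2 & F3 & F4).
  intros Hu Eu; pose proof (proj1 Hu) as Ec.
  destruct (bucket_row _ _ _ _ HP _ _ _ _ _ Hu) as (k1 & K1 & K2 & K3 & K4 & K5 & K6 & K7).
  pose proof (PO_range _ _ _ _ HP k1 K1) as K8.
  assert (Exu : X u = X q) by (apply (C_eq _ _ _ _ HP); auto).
  assert (Exp : X (PO k1) = X p) by (apply (C_eq _ _ _ _ HP); auto).
  assert (E1 : X q + d = X p) by (unfold d; lia).
  assert (E2 : t + d = Y q) by (unfold t; lia).
  assert (Hs0 : is_square P (X q, t, d)).
  { unfold is_square; rewrite E1, E2; splits; auto; apply (point_In _ _ _ _ HP).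
    - exists u; auto.
    - exists (PO k1); splits; auto; lia.
    - exists q; auto.
    - exists p; auto. }
  split.
  - intros (_ & [[Hh|Hh]|(k' & q' & H1 & H2 & H3 & H4 & H5 & H6 & H7)]).
    + apply K5; rewrite Eu; auto.
    + apply Hlight; rewrite <- F3, <- E2; auto.
    + rewrite E1 in H3; rewrite E2 in H4, H6.
      assert (q' = q) by (apply (point_inj _ _ _ _ HP); auto); subst q'.
      assert (PO k' = p) as E.
      { apply (point_inj _ _ _ _ HP); auto; [apply (PO_range _ _ _ _ HP); auto|lia]. }
      apply (PO_inj _ _ _ _ HP) in E; auto; lia.
  - intros [[x y] d']; unfold light_upto; split.
    + intros (Hs & [Hh|Hu']); [auto|].
      destruct (upper_side_new x y d' (proj1 Hs) Hu') as [|[= -> -> ->]]; auto.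
    + intros [(Hs & [Hh|Hu'])|[= -> -> ->]]; split; auto.
      * right; apply upper_side_mono; auto.
      * right; exists k, q; splits; auto; try lia.
        fold p; lia.
Qed.

(** If the lower row of such a square is light, its lower side is in the bucket at height [t]; but
    every cell below the pointer is strictly below [t]. So that row is heavy, and the square was
    reported by the first pass. *)
Lemma light_upto_none st cu la nx pr adv u :
  advancing n s a k q st cu la nx pr adv u -> t < Y u ->
  forall w, light_upto k (q + 1) w <-> light_upto k q w.
Proof.
  destruct step_facts as (F1 & F2 & F3 & F4).
  intros (_ & _ & _ & A4 & _) Hlt [[x y] d']; unfold light_upto; split.
  - intros (Hs & [Hh|Hu]); [auto|].
    destruct (upper_side_new x y d' (proj1 Hs) Hu) as [|[= -> -> ->]]; [auto|].
    split; auto; left; left.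
    pose proof Hs as (_ & S1 & S2 & _).
    apply (point_In _ _ _ _ HP) in S1 as (i & Hi & I1 & I2).
    apply (point_In _ _ _ _ HP) in S2 as (j & Hj & J1 & J2).
    assert (E1 : X q + d = X p) by (unfold d; lia).
    destruct (PO_surj _ _ _ _ HP j Hj) as (kj & Hkj & <-).
    rewrite <- I2. apply (HR_spec _ _ _ _ HP i Hi).
    (* The flag decides whether the lower row is heavy; a light one is to be refuted. *)
    destruct (Z_lt_le_dec 0 (a aHR (RS i))) as [|Hle]; [auto|exfalso].
    assert (Hli : ~ heavy_row n s a (Y i)).
    { intros Hh; apply (HR_spec _ _ _ _ HP i Hi) in Hh; lia. }
    assert (Hij : i < PO kj).
    { destruct (Z_lt_le_dec i (PO kj)) as [|Hge]; auto; exfalso.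
      destruct (Z.eq_dec i (PO kj)) as [->|]; [lia|].
      pose proof (X_mono _ _ _ _ HP (PO kj) i); lia. }
    assert (Hty : t < Y q) by (unfold t; lia).
    assert (bucket n s a k (q + 1) g c i).
    { split; [apply (C_eq _ _ _ _ HP); auto|]. exists kj; splits; auto; try lia.
      - apply (C_eq _ _ _ _ HP); auto; lia.
      - apply (RS_min _ _ _ _ HP); auto; lia.
      - rewrite J2, <- I2; auto.
      - left. destruct (Z_lt_le_dec kj k) as [|Hge]; auto; exfalso.
        destruct (Z.eq_dec kj k) as [->|]; [fold p in J2; lia|].
        destruct (PO_lt _ _ _ _ HP k kj) as [D|[_ D]]; try lia; fold p in D; lia. }
    specialize (A4 i H); unfold t, d, p in *; lia.
  - intros (Hs & [Hh|Hu]); split; auto. right; apply upper_side_mono; auto.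
Qed.

End Step.

End Pairs.

(** * The program of the second pass *)

Definition fresh : stmt :=
  Store aST vc (aC @@ vp) ;; Store aCU vc vq ;; Store aLA vc vq.

Definition append : stmt :=
  Store aNX (aLA @@ vc) vq ;; Store aLA vc vq.

(** The loop stops at the latest at the cell of [vq] itself, whose ordinate exceeds [vt]. It ends at
    the lowest cell not below [vt], which is a lower left corner exactly if its ordinate equals
    [vt]. *)
Definition pair_step : stmt :=
  vc ::= aC @@ vq ;;
  If (aST @@ vc) (aC @@ vp) fresh (If (aC @@ vp) (aST @@ vc) fresh append) ;;
  vd ::= (aX @@ vp) -! (aX @@ vq) ;;
  vt ::= (aY @@ vq) -! vd ;;
  vu ::= aCU @@ vc ;;
  While (aY @@ vu) vt (vu ::= aNX @@ vu) ;;
  Store aCU vc vu ;;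
  If vt (aY @@ vu) Skip (Out (aX @@ vq) vt vd).

Definition light : stmt :=
  vk ::= #1 ;;
  For vk vM (
    vp ::= aPO @@ vk ;;
    If #0 (aHR @@ (aRS @@ vp)) Skip (
      vq ::= aRS @@ vp ;;
      For vq vp pair_step)).

Definition fixed_array (x : nat) : Prop :=
  x <> aST /\ x <> aCU /\ x <> aLA /\ x <> aNX.

(** [pr] and [adv] exist in the proof only. The time is constant apart from the pointer moves, which
    are measured by the growth of [adv]. *)
Lemma pair_step_spec P n s L V M a0 k q pr adv st (Q : state -> Prop) :
  0 <= n -> L = 2 * n + 2 -> M = maxcoord P -> 4 * M + 4 * n + 8 <= V ->
  prepared P n s a0 -> (forall x, fixed_array x -> arr st x = a0 x) ->
  1 <= k <= n -> ~ heavy_row n s a0 (a0 aY (a0 aPO k)) ->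
  a0 aRS (a0 aPO k) <= q < a0 aPO k ->
  var st vp = a0 aPO k -> var st vq = q ->
  chains n a0 (bucket n s a0 k q) (arr st aST) (arr st aCU) (arr st aLA) (arr st aNX) ->
  ghost a0 (bucket n s a0 k q) (arr st aST) (arr st aCU) pr adv ->
  (forall c q', bucket n s a0 k q (a0 aC (a0 aPO k)) c q' -> arr st aST c = a0 aC (a0 aPO k)) ->
  listed (outp st) (light_upto P n s a0 k q) ->
  (forall st' adv', same pair_step st st' -> bounded V st' ->
     let pr' := (a0 aC (a0 aPO k), q) :: pr in
     chains n a0 (bucket n s a0 k (q + 1)) (arr st' aST) (arr st' aCU) (arr st' aLA) (arr st'
       aNX) ->
     ghost a0 (bucket n s a0 k (q + 1)) (arr st' aST) (arr st' aCU) pr' adv' ->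
     (forall c q', bucket n s a0 k (q + 1) (a0 aC (a0 aPO k)) c q' ->
        arr st' aST c = a0 aC (a0 aPO k)) ->
     listed (outp st') (light_upto P n s a0 k (q + 1)) ->
     time st' <= time st + 150 + 40 * (Z.of_nat (length adv') - Z.of_nat (length adv)) ->
     Q st') ->
  wp L V pair_step Q st.
Proof.
  intros Hn HL HM HV HP Ha0 Hk Hlight Hq Ep Eq HC HG HF HD HQ.
  apply (wp_mono _ _ _ (fun st' => exists adv',
     let pr' := (a0 aC (a0 aPO k), q) :: pr in
     chains n a0 (bucket n s a0 k (q + 1)) (arr st' aST) (arr st' aCU) (arr st' aLA) (arr st'
       aNX) /\
     ghost a0 (bucket n s a0 k (q + 1)) (arr st' aST) (arr st' aCU) pr' adv' /\
     (forall c q', bucket n s a0 k (q + 1) (a0 aC (a0 aPO k)) c q' ->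
        arr st' aST c = a0 aC (a0 aPO k)) /\
     listed (outp st') (light_upto P n s a0 k (q + 1)) /\
     time st' <= time st + 150 + 40 * (Z.of_nat (length adv') - Z.of_nat (length adv)))).
  2: { intros st' Hb Hs (adv' & H1 & H2 & H3 & H4 & H5); eapply HQ; eauto. }
  clear HQ Q.
  destruct st as [v0 b0 o0 t0]; cbn [var arr outp time] in *.
  assert (HM0 : 0 <= M) by (subst M; apply maxcoord_nonneg).
  assert (Hcb : forall j, 1 <= j <= n -> Z.abs (a0 aX j) <= M /\ Z.abs (a0 aY j) <= M)
    by (intros j Hj; subst M; eapply coord_bound; eauto).
  pose proof (right_range _ _ _ _ HP k Hk) as Hp.
  pose proof (left_range _ _ _ _ HP k q Hk Hq) as Hqn.
  pose proof (side_pos _ _ _ _ HP k q Hk Hq) as Hd.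
  pose proof (C_range _ _ _ _ HP q Hqn) as Hc.
  pose proof (C_range _ _ _ _ HP _ Hp) as Hg.
  set (p := a0 aPO k) in *; set (c := a0 aC q) in *; set (g := a0 aC p) in *.
  assert (EX : b0 aX = a0 aX) by (apply Ha0; unfold fixed_array; lia).
  assert (EY : b0 aY = a0 aY) by (apply Ha0; unfold fixed_array; lia).
  assert (EC : b0 aC = a0 aC) by (apply Ha0; unfold fixed_array; lia).
  unfold pair_step; wp1; wp1; rewrite ?EC, ?Eq; try lia.
  fold c.
  wp1. apply (wp_mono _ _ _ (fun st' => exists v1 a1 t1 u, st' = State v1 a1 o0 t1 /\
      t1 <= t0 + 60 /\ v1 vp = p /\ v1 vq = q /\ v1 vc = c /\
      a1 aX = a0 aX /\ a1 aY = a0 aY /\ a1 aC = a0 aC /\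
      a1 aCU c = u /\ advancing n s a0 k q (a1 aST) (a1 aCU) (a1 aLA) (a1 aNX) ((g, q) :: pr) adv
        u /\
      (forall c', c' <> c -> a1 aST c' = b0 aST c'))).
  (* Inequality is detected by either of two strict comparisons, and both lead to the same code. *)
  { assert (Hfresh : b0 aST c <> g -> forall v1 t1, v1 vp = p -> v1 vq = q -> v1 vc = c ->
      t1 <= t0 + 30 -> forall R : state -> Prop,
      (forall a1 t2, t2 <= t1 + 25 ->
        a1 aX = a0 aX -> a1 aY = a0 aY -> a1 aC = a0 aC -> a1 aCU c = q ->
        advancing n s a0 k q (a1 aST) (a1 aCU) (a1 aLA) (a1 aNX) ((g, q) :: pr) adv q ->
        (forall c', c' <> c -> a1 aST c' = b0 aST c') -> R (State v1 a1 o0 t2)) ->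
      wp L V fresh R (State v1 b0 o0 t1)).
    { intros Hne v1 t1 E1 E2 E3 Ht1 R HR; unfold fresh.
      wp1; wp1; rewrite ?EC, ?E1, ?E2, ?E3; fold g; try (splits; auto; lia).
      do 3 wp1; rewrite ?E1, ?E2, ?E3; try (splits; auto; lia).
      apply HR; ev; auto; try lia.
      - apply updz_same.
      - apply (advancing_fresh n s a0 k q Hk Hlight Hq); auto.
        intros q' Hq'; apply Hne; eapply HF; eauto.
      - intros c' Hc'; apply updz_other; auto. }
    wp1; rewrite ?EC, ?Ep in *; fold g; try (splits; auto; lia).
    - apply Hfresh; ev; auto; try lia; try (unfold g; lia).
      intros a1 t2 Ht2 G1 G2 G3 G4 G5 G6; eexists _, _, _, _; split; [reflexivity|]; ev;
        splits; eauto; lia.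
    - wp1; rewrite ?EC, ?Ep in *; fold g; try (splits; auto; lia).
      + apply Hfresh; ev; auto; try lia; try (unfold g; lia).
        intros a1 t2 Ht2 G1 G2 G3 G4 G5 G6; eexists _, _, _, _; split; [reflexivity|]; ev;
          splits; eauto; lia.
      + assert (Est : b0 aST c = g) by (unfold g; lia).
        pose proof (HC c ltac:(lia)) as Hch; rewrite Est in Hch; specialize (Hch ltac:(lia)).
        destruct Hch as (_ & Hla & _).
        destruct (bucket_row _ _ _ _ HP _ _ _ _ _ Hla) as (k1 & _ & _ & _ & _ & _ & K6 & _).
        unfold append; do 3 wp1; rewrite ?Eq; try (splits; auto; lia).
        eexists _, _, _, _; split; [reflexivity|]; ev; splits; eauto; try lia.
        apply (advancing_append P n s a0 HP k q Hk Hlight Hq); auto; fold c; fold p; fold g;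
          lia. }
  intros st1 Hb1 _ (v1 & a1 & t1 & u & -> & Ht1 & E1 & E2 & E3 & EX1 & EY1 & EC1 & Eu & HA & HST).
  pose proof (Hcb _ Hp) as [Hpx Hpy]; pose proof (Hcb _ Hqn) as [Hqx Hqy].
  assert (HuR : forall u' adv', advancing n s a0 k q (a1 aST) (a1 aCU) (a1 aLA) (a1 aNX) ((g, q)
    :: pr) adv' u' -> 1 <= u' <= n).
  { intros u' adv' (_ & _ & Hu & _).
    destruct (bucket_row _ _ _ _ HP _ _ _ _ _ Hu) as (k1 & _ & _ & _ & _ & _ & K6 & _); auto. }
  pose proof (HuR _ _ HA) as Hu.
  wp1; wp1; rewrite ?EX1, ?E1, ?E2; try (splits; auto; lia).
  wp1; wp1; rewrite ?EY1, ?E2; try (splits; auto; lia).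
  set (d := a0 aX p - a0 aX q) in *. set (t := a0 aY q - d) in *.
  wp1; wp1; rewrite ?E3, ?Eu; try (splits; auto; lia).
  wp1. apply (wp_mono _ _ _ (fun st' => exists v2 a2 t2 adv', st' = State v2 a2 o0 t2 /\
      (forall x, a2 x = a1 x) /\ v2 vq = q /\ v2 vc = c /\ v2 vd = d /\ v2 vt = t /\
      advancing n s a0 k q (a1 aST) (a1 aCU) (a1 aLA) (a1 aNX) ((g, q) :: pr) adv' (v2 vu) /\
      t <= a0 aY (v2 vu) /\
      t2 <= t1 + 50 + 40 * (Z.of_nat (length adv') - Z.of_nat (length adv)))).
  (* Each move raises the ordinate of the pointer, which is at most [M]; hence the measure. *)
  { apply (wp_while _ _ (fun v a o t2 => exists adv', o = o0 /\
      advancing n s a0 k q (a1 aST) (a1 aCU) (a1 aLA) (a1 aNX) ((g, q) :: pr) adv' (v vu) /\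
      t2 <= t1 + 40 + 40 * (Z.of_nat (length adv') - Z.of_nat (length adv)))
      (fun v _ => M - a0 aY (v vu))); ev.
    { exists adv; splits; auto; lia. }
    intros v a o t2 (Sv & Sa & _) Hb (adv' & -> & HA' & Ht2); cbn [var arr] in Sv, Sa.
    assert (EY2 : a aY = a0 aY) by (rewrite Sa by reflexivity; auto).
    assert (EN2 : a aNX = a1 aNX) by (apply Sa; reflexivity).
    assert (Et2 : v vt = t) by (rewrite Sv by reflexivity; auto).
    pose proof (HuR _ _ HA') as Hu'; pose proof (Hcb _ Hu') as [_ Huy].
    rewrite EY2, Et2.
    split; [split; [exact I|lia]|split; [exact I|split]]; intros Hcmp.
    - split; [lia|].
      destruct (advancing_step P n s a0 HP k q Hk Hq _ _ _ _ _ _ _ HA' Hcmp) as [HA2 Hup].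
      pose proof (HuR _ _ HA2) as Hu2.
      wp1; rewrite ?EN2; try (splits; auto; lia).
      split; [|lia]. eexists; splits; [reflexivity|exact HA2|]. cbn [length]; lia.
    - exists v, a, (t2 + (1 + 2 + 1 + 3)), adv'; splits; auto; try lia.
      all: rewrite Sv by reflexivity; ev; auto. }
  intros st2 Hb2 _ (v2 & a2 & t2 & adv' & -> & Ea2 & F1 & F2 & F3 & F4 & HA2 & Hge & Ht2).
  pose proof (HuR _ _ HA2) as Hu2.
  destruct (advancing_stop P n s a0 HP k q Hk Hlight Hq _ _ _ _ _ _ _ HA2) as [HC2 HG2].
  fold c in HC2, HG2.
  assert (HF2 : forall c' q', bucket n s a0 k (q + 1) g c' q' -> a1 aST c' = g).
  { intros c' q' Hq'; destruct (Z.eq_dec c' c) as [->|Hne]; [apply HA2|].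
    rewrite HST by auto; apply (bucket_succ n s a0 k q Hk Hlight Hq) in Hq'.
    destruct Hq' as [Hq'|(_ & Hc' & _)]; [eapply HF; eauto|tauto]. }
  wp1; wp1; rewrite ?F1, ?F2; try (splits; auto; lia).
  wp1; rewrite ?Ea2, ?EY1, ?F4; try (splits; auto; lia).
  - wp1. exists adv'; rewrite !Ea2; splits; auto; try lia.
    eapply listed_ext; [exact HD|]; intros w; symmetry.
    eapply (light_upto_none P n s a0 HP k q Hk Hq); eauto.
    fold p; fold d; fold t; rewrite <- EY1, <- Ea2, <- F4; assumption.
  - wp1; rewrite ?Ea2, ?EX1, ?F1, ?F3, ?F4; try (splits; auto; lia).
    assert (Eyu : a0 aY (v2 vu) = t) by (rewrite <- EY1, <- Ea2, <- F4 in *; lia).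
    destruct (light_upto_out P n s a0 HP k q Hk Hlight Hq (v2 vu)) as [O1 O2]; auto.
    { apply HA2. }
    exists adv'; splits; auto; try lia.
    eapply listed_snoc; [exact HD|exact O1|exact O2].
Qed.

(** A point of rank at least [s] would have in its row the point [a aRS i + s], of rank exactly [s].
    This bounds the number of pairs by [s] for each right point. *)
Lemma light_rank P n s a i :
  prepared P n s a -> 0 <= s -> 1 <= i <= n -> ~ heavy_row n s a (a aY i) ->
  i - a aRS i < s.
Proof.
  intros HP Hs Hi Hl; destruct (Z_lt_le_dec (i - a aRS i) s) as [|Hge]; [auto|].
  exfalso; apply Hl; pose proof (RS_spec _ _ _ _ HP i Hi).
  assert (E : a aY (a aRS i + s) = a aY i) by (apply (row_between _ _ _ _ HP); lia).
  exists (a aRS i + s); splits; try lia.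
  rewrite (RS_eq _ _ _ _ HP (a aRS i + s) i); auto; lia.
Qed.

Lemma light_spec P n s L V M st (Q : state -> Prop) :
  0 <= n -> 0 <= s -> L = 2 * n + 2 -> M = maxcoord P -> 4 * M + 4 * n + 8 <= V ->
  prepared P n s (arr st) -> var st vM = n + 1 -> (forall c, arr st aST c = 0) ->
  listed (outp st) (fun q => let '(x, y, d) := q in
    is_square P q /\ (heavy_row n s (arr st) y \/ heavy_row n s (arr st) (y + d))) ->
  (forall st', same light st st' -> bounded V st' -> listed (outp st') (is_square P) ->
     time st' <= time st + 1000 * ((n + 1) * (s + 1)) -> Q st') ->
  wp L V light Q st.
Proof.
  intros Hn Hs HL HM HV HP EM HST HD HQ.
  cut (wp L V light (fun st' => listed (outp st') (is_square P) /\
     time st' <= time st + 1000 * ((n + 1) * (s + 1))) st).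
  { intros W; eapply wp_mono; [exact W|]; intros st' Hb Hs' (H1 & H2); apply HQ; auto. }
  clear HQ Q.
  destruct st as [v0 a0 o0 t0]; cbn [var arr outp time] in *.
  assert (HM0 : 0 <= M) by (subst M; apply maxcoord_nonneg).
  unfold light; do 2 wp1.
  set (len := fun l : list (Z * Z) => Z.of_nat (length l)).
  (* The third clause says that the lists of the current right column are alive; it is guarded
     because [aPO] is not specified at [n + 1]. *)
  set (J := fun k q (a : nat -> Z -> Z) (o : list (Z * Z * Z)) pr adv =>
    chains n a0 (bucket n s a0 k q) (a aST) (a aCU) (a aLA) (a aNX) /\
    ghost a0 (bucket n s a0 k q) (a aST) (a aCU) pr adv /\
    (1 <= k <= n -> forall c q', bucket n s a0 k q (a0 aC (a0 aPO k)) c q' ->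
       a aST c = a0 aC (a0 aPO k)) /\
    listed o (light_upto P n s a0 k q)).
  assert (J_ext : forall k q k2 q2 a o pr adv,
    J k q a o pr adv ->
    (forall g c q', bucket n s a0 k q g c q' <-> bucket n s a0 k2 q2 g c q') ->
    (forall w, light_upto P n s a0 k q w <-> light_upto P n s a0 k2 q2 w) ->
    (k2 = k \/ k2 = k + 1 /\ q2 = 0 /\ 1 <= k <= n) -> J k2 q2 a o pr adv).
  { intros k q k2 q2 a o pr adv (J1 & J2 & J3 & J4) HB HU Hk2; unfold J; splits.
    - eapply chains_ext; eauto.
    - eapply ghost_ext; eauto.
    - intros Hk c q' Hq'; destruct Hk2 as [->|(-> & -> & Hk1)].
      + apply J3 with q'; auto; apply HB; auto.
      + apply (column_next P n s a0 HP (a aST) k) with q'; auto; try lia.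
        intros c2 q3 Hq3; apply J3 with q3; auto; apply HB; auto.
    - eapply listed_ext; eauto. }
  (* Time is charged to the pairs processed and to the pointer moves; a right point contributes at
     most [s] pairs by [light_rank]. *)
  eapply (wp_for_time _ _ (fun k v a o t => exists pr adv, J k 0 a o pr adv /\
     len pr <= (k - 1) * s /\ t <= t0 + 60 * k + 250 * len pr + 40 * len adv)
     _ _ _ _ _ (n + 1)); ev; auto; try reflexivity; try lia.
  { exists [], []; splits; try (unfold len; cbn; lia). unfold J; splits.
    - intros c Hc; rewrite HST; lia.
    - unfold ghost; splits; [constructor| |intros g q []].
      intros g c q' Hq'; apply (bucket_row _ _ _ _ HP) in Hq' as (k' & Hq'); lia.
    - intros _ c q' Hq'; apply (bucket_row _ _ _ _ HP) in Hq' as (k' & Hq'); lia.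
    - eapply listed_ext; [exact HD|]; intros w; symmetry; apply light_upto_start. }
  { intros k v a o t (Sv & Sa & _) Hb Hk Ek Eh (pr & adv & HJ & Hpr & Ht);
    cbn [var arr] in Sv, Sa.
    assert (Ea : forall x, fixed_array x -> a x = a0 x).
    { intros x (N1 & N2 & N3 & N4); apply Sa; unfold For; cbn [moda pair_step fresh append].
      unfold For; cbn [moda].
      rewrite !(proj2 (Nat.eqb_neq x _)) by auto; reflexivity. }
    clear Sv Sa.
    assert (EP : a aPO = a0 aPO) by (apply Ea; unfold fixed_array; lia).
    assert (ER : a aRS = a0 aRS) by (apply Ea; unfold fixed_array; lia).
    assert (EH : a aHR = a0 aHR) by (apply Ea; unfold fixed_array; lia).
    pose proof (PO_range _ _ _ _ HP k ltac:(lia)) as Hp.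
    pose proof (RS_spec _ _ _ _ HP _ Hp) as [HR1 HR2].
    pose proof (HR_spec _ _ _ _ HP _ Hp) as HHR.
    wp1; wp1; rewrite ?EP, ?Ek; try lia.
    remember (a0 aPO k) as p eqn:Edp.
    wp1; rewrite ?ER, ?EH; try (splits; auto; lia).
    { wp1. exists pr, adv; splits; try lia.
      eapply J_ext; [exact HJ| | |right; splits; auto; lia].
      - intros; apply (bucket_heavy P n s a0 HP); rewrite <- Edp, <- HHR; auto.
        rewrite ?EH, ?ER in *; auto.
      - intros; apply (light_upto_heavy P n s a0); rewrite <- Edp, <- HHR; auto.
        rewrite ?EH, ?ER in *; auto. }
    assert (Hlight : ~ heavy_row n s a0 (a0 aY p)).
    { rewrite <- HHR, <- EH, <- ER; lia. }
    pose proof (light_rank P n s a0 p HP Hs Hp Hlight) as Hrank.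
    wp1; wp1; rewrite ?ER; try (splits; auto; lia).
    eapply (wp_for_time _ _ (fun q v a o t' => exists pr adv, J k q a o pr adv /\
       len pr <= (k - 1) * s + (q - a0 aRS p) /\
       t' <= t0 + 60 * k + 30 + 250 * len pr + 40 * len adv)
       _ _ _ _ _ p); ev; auto; try reflexivity; try lia.
    { exists pr, adv; splits; try lia. eapply J_ext; [exact HJ| | |left; reflexivity].
      - intros; symmetry; apply (bucket_first P n s a0 HP); [lia|rewrite <- Edp; lia].
      - intros; symmetry; apply (light_upto_first P n s a0 HP); [lia|rewrite <- Edp; lia]. }
    { clear pr adv HJ Hpr Ht.
      intros q v1 a1 o1 t1 (Sv & Sa & _) Hb1 Hq Eq Ep (pr & adv & HJ & Hpr & Ht);
        cbn [var arr] in Sv, Sa.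
      assert (Ea1 : forall x, fixed_array x -> a1 x = a0 x).
      { intros x Hx; rewrite <- (Ea x Hx); destruct Hx as (N1 & N2 & N3 & N4); apply Sa.
        unfold For; cbn [moda pair_step fresh append].
        rewrite !(proj2 (Nat.eqb_neq x _)) by auto; reflexivity. }
      clear Sv Sa; ev_in Hq. rewrite ?ER in Hq.
      destruct HJ as (J1 & J2 & J3 & J4).
      eapply (pair_step_spec P n s L V M a0 k q pr adv); rewrite <- ?Edp; ev; auto; try lia.
      { rewrite Edp; apply J3; lia. }
      intros [v2 a2 o2 t2] adv' _ Hb2 K1 K2 K3 K4 Ht2; cbn [var arr outp time] in *.
      exists ((a0 aC p, q) :: pr), adv'; unfold len in *; splits.
      - unfold J; splits; auto. intros _; rewrite <- Edp; exact K3.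
      - cbn [length]; lia.
      - cbn [length]; lia. }
    clear pr adv HJ Hpr Ht.
    intros v1 a1 o1 t1 _ Hb1 _ _ (pr & adv & HJ & Hpr & Ht).
    exists pr, adv; cbn [arr outp time]; splits; try lia.
    eapply J_ext; [exact HJ| | |right; splits; auto; lia].
    - intros; rewrite Edp; apply (bucket_last P n s a0 HP).
    - intros; rewrite Edp; apply (light_upto_last P n s a0 HP). }
  intros v a o t _ Hb _ _ (pr & adv & (J1 & J2 & J3 & J4) & Hpr & Ht); cbn [outp time].
  apply ghost_length in J2; split.
  - eapply listed_ext; [exact J4|]; intros w; apply (light_upto_end P n s a0 HP).
  (* The moves are at most as many as the pairs, and the pairs at most [n * s]. *)
  - unfold len in *. nia.
Qed.

(** * The complete algorithm *)

Definition squares : stmt := prepare ;; heavy ;; light.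

(** The constant 6000 is 4000 for the preparation and 1000 for each pass. The value bound leaves
    room for a coordinate minus a difference of two coordinates, which may reach
    [3 * maxcoord P]. *)
Lemma squares_exec P :
  NoDup P ->
  let n := Z.of_nat (length P) in
  let s := Z.sqrt n in
  exists st', exec (2 * n + 2) (4 * maxcoord P + 4 * n + 8) squares (init_state P) st' /\
    listed (outp st') (is_square P) /\ time st' <= 6000 * ((n + 1) * (s + 1)).
Proof.
  intros Hnd n s.
  set (L := 2 * n + 2); set (V := 4 * maxcoord P + 4 * n + 8).
  assert (HM : 0 <= maxcoord P) by apply maxcoord_nonneg.
  assert (Hn : 0 <= n) by (unfold n; lia).
  assert (Hs : 0 <= s) by apply Z.sqrt_nonneg.
  assert (Hs2 : s * s <= n < (s + 1) * (s + 1)) by exact (Z.sqrt_spec n Hn).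
  assert (W : wp L V squares (fun st' => listed (outp st') (is_square P) /\
                time st' <= 6000 * ((n + 1) * (s + 1))) (init_state P)).
  { unfold squares; wp1; apply prepare_spec; auto; [lia|].
    intros st1 (_ & Sa1 & So1) Hb1 EM1 ES1 HP1 Ht1; fold n in EM1, HP1, Ht1;
      fold s in ES1, HP1, Ht1.
    wp1; apply (heavy_spec P n s L V (maxcoord P)); auto; try lia.
    { intros c; rewrite Sa1 by reflexivity; reflexivity. }
    intros st2 (Sv2 & Sa2 & _) Hb2 Hl2 Ht2.
    assert (E : forall x, x <> aMK -> arr st2 x = arr st1 x).
    { intros x Hx; apply Sa2; unfold heavy, mark, scan, For; cbn [moda].
      rewrite (proj2 (Nat.eqb_neq x aMK)) by auto; reflexivity. }
    assert (HP2 : prepared P n s (arr st2)).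
    { destruct HP1 as [Q1 Q2 Q3 Q4 Q5].
      constructor; unfold columns_ok, rows_ok in *; rewrite !E by discriminate; auto. }
    apply (light_spec P n s L V (maxcoord P)); auto; try lia.
    - rewrite Sv2 by reflexivity; auto.
    - intros c; rewrite E, Sa1 by (discriminate || reflexivity); reflexivity.
    - unfold heavy_row in *; rewrite !E by discriminate; exact Hl2.
    - intros st3 _ _ Hl3 Ht3; split; [auto|lia]. }
  destruct W as (st' & X & _ & H); [|exists st'; auto].
  split; cbn; [lia|]. intros a i; destruct (Nat.eqb a 0); [|lia].
  pose proof (input_mem_bound P i); fold n in H; unfold V; lia.
Qed.

Close Scope Z_scope.

Theorem theorem2 :
  exists (p : program) (C : nat),
  forall P : list (Z * Z), NoDup P ->
  let n := length P in
  exists (t : nat) (cf : config),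
    iter_step p t (init P) = Some cf /\
    step p cf = None /\
    (t <= C * (n * Nat.sqrt n + 1))%nat /\
    (forall (k : nat) (c : config), (k <= t)%nat ->
       iter_step p k (init P) = Some c ->
       (forall r : nat,
          (Z.abs (reg c r) <= (maxcoord P + Z.of_nat n + 2) ^ Z.of_nat C)%Z) /\
       (forall a : Z, addr_of p c = Some a ->
          (0 <= a < Z.of_nat (C * (n + 1)))%Z)) /\
    NoDup (out cf) /\
    (forall s : Z * Z * Z, In s (out cf) <-> is_square P s).
Proof.
  (* Time needs [4 * 6000] and a little more, memory [34 * (n + 1)] cells, registers the exponent 8;
     one number covers them all. *)
  exists (compile squares), (Z.to_nat 30000).
  intros P Hnd n.
  assert (EC : Z.of_nat (Z.to_nat 30000) = 30000%Z) by (apply Z2Nat.id; discriminate).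
  (* The large unary numeral is kept from being computed; only its value in [Z] is used. *)
  remember (Z.to_nat 30000) as C eqn:HC; clear HC.
  destruct (squares_exec P Hnd) as (st' & X & [Hl1 Hl2] & Ht).
  set (N := Z.of_nat (length P)) in *.
  set (V := (4 * maxcoord P + 4 * N + 8)%Z) in *.
  pose proof (maxcoord_nonneg P) as HM.
  assert (HN : (0 <= N)%Z) by (unfold N; lia).
  destruct (compile_correct squares P V (16 * V + 17 * (2 * N + 2)) (17 * (2 * N + 2)) st')
    as (t & cf & H1 & H2 & H3 & H4 & H5); try (fold N; unfold V; lia);
    [reflexivity | unfold max_size, narr; fold N; lia | unfold narr; fold N; lia | exact X |].
  exists t, cf; split; [exact H1|split; [exact H2|split; [|split; [|split]]]].
  - assert (Es : Z.sqrt N = Z.of_nat (Nat.sqrt n)).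
    { apply Z.sqrt_unique. pose proof (Nat.sqrt_spec n (Nat.le_0_l n)). unfold N, n in *. lia. }
    rewrite Es in Ht.
    assert (Hbig : (Z.of_nat t <= 30000 * (N * Z.of_nat (Nat.sqrt n) + 1))%Z).
    (* For [N = 0] the summand 1 of the bound pays for the constant work; otherwise the root [s] is
       at least 1 and [(N + 1) * (s + 1) <= 4 * N * s]. *)
    { destruct (Z.eq_dec N 0) as [E|E]; [|].
      { assert (Z.of_nat (Nat.sqrt n) = 0)%Z by (rewrite <- Es, E; reflexivity); nia. }
      assert (1 <= Z.of_nat (Nat.sqrt n))%Z.
      { rewrite <- Es; change 1%Z with (Z.sqrt 1); apply Z.sqrt_le_mono; lia. }
      nia. }
    apply Nat2Z.inj_le; rewrite Nat2Z.inj_mul, EC, Nat2Z.inj_add, Nat2Z.inj_mul.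
    exact Hbig.
  - intros k c Hk Hc; destruct (H4 k c Hk Hc) as [Hr Ha]; split.
    + intros r; eapply Z.le_trans; [apply Hr|]; rewrite EC; fold N.
      set (b := (maxcoord P + N + 2)%Z).
      assert (Hb : (2 <= b)%Z) by (unfold b; lia).
      (* The register bound is at most [128 * b], and [128 = 2 ^ 7 <= b ^ 7]. *)
      apply Z.le_trans with (b ^ 8)%Z; [|apply Z.pow_le_mono_r; lia].
      apply Z.le_trans with (128 * b)%Z; [unfold V, b; lia|].
      change 8%Z with (Z.succ 7); rewrite Z.pow_succ_r, Z.mul_comm by lia.
      apply Z.mul_le_mono_nonneg_l; [lia|].
      change 128%Z with (2 ^ 7)%Z; apply Z.pow_le_mono_l; lia.
    + intros a Haddr; specialize (Ha a Haddr).
      rewrite Nat2Z.inj_mul, EC, Nat2Z.inj_add; fold N; lia.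
  - rewrite H5; exact Hl1.
  - rewrite H5; exact Hl2.
Qed.
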